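(* Let $d>1$ and let $\phi:[0,\infty)\to[0,\infty)$ be any bounded and measurable function such that $$\lim_{t\to\infty}(1+t)^{\frac{d+1}{2}}\phi(t)=0.$$ Let $B_d\subset\mathbb{R}^d$ be the unit ball. Then there does not exist a set $A\subset\mathbb{R}^d$ such that $\mathcal{E}(A)$ is a $\phi$-approximately orthogonal basis for $L^2(B_d)$.
   Context: $B_d=\{x\in\mathbb{R}^d:|x|\le 1\}$ is the Euclidean unit ball centered at the origin. For $A\subset\mathbb{R}^d$, write $\mathcal{E}(A)=\{e^{2\pi i x\cdot a}:a\in A\}$ (functions of $x$). For a bounded domain $\Omega\subset\mathbb{R}^d$ with indicator function $\chi_\Omega$, write $\widehat{\chi}_\Omega(\xi)=\int_\Omega e^{-2\pi i x\cdot\xi}\,dx$. Given a bounded measurable function $\phi:[0,\infty)\to[0,\infty)$ that tends to $0$ at infinity and $a\neq a'$ in $\mathbb{R}^d$, the exponentials $e^{2\pi i x\cdot a}$ and $e^{2\pi i x\cdot a'}$ are called $\phi$-approximately orthogonal (with respect to $\Omega$) if $$|\widehat{\chi}_\Omega(a-a')|\le\phi(|a-a'|).$$ $\mathcal{E}(A)$ is called a $\phi$-approximately orthogonal basis for $L^2(\Omega)$ if $\mathcal{E}(A)$ is a basis for $L^2(\Omega)$ and any two distinct elements of $\mathcal{E}(A)$ are $\phi$-approximately orthogonal. Here ''basis'' means Schauder basis of the Hilbert space $L^2(\Omega)$, with respect to some enumeration of $A$. *)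

(* Defs.v *)
From HB Require Import structures.
From mathcomp Require Import all_boot all_order all_algebra.
From mathcomp Require Import complex.
From mathcomp Require Import all_classical all_reals all_analysis.
From mathcomp Require Import measurable_realfun.

Set Implicit Arguments.
Unset Strict Implicit.
Unset Printing Implicit Defensive.
Import Order.TTheory GRing.Theory Num.Theory.
Import numFieldNormedType.Exports.

Local Open Scope classical_set_scope.
Local Open Scope ring_scope.

Definition measure_mx_display : measure_display -> measure_display.
Proof. exact. Qed.

Section measurable_mx.
Context {d : measure_display} {T : measurableType d} (m n : nat).

Definition mx_cylinders : set (set 'M[T]_(m, n)) :=
  [set B | exists i j, exists2 Y : set T,
     measurable Y & B = [set M : 'M[T]_(m, n) | Y (M i j)]].

Let mx_set0 : <<s mx_cylinders >> set0.
Proof. exact: sigma_algebra0. Qed.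

Let mx_setC A : <<s mx_cylinders >> A -> <<s mx_cylinders >> (~` A).
Proof. exact: sigma_algebraC. Qed.

Let mx_bigcup (F : (set 'M[T]_(m, n))^nat) :
  (forall i, <<s mx_cylinders >> (F i)) ->
  <<s mx_cylinders >> (\bigcup_i (F i)).
Proof. exact: sigma_algebra_bigcup. Qed.

HB.instance Definition _ := @isMeasurable.Build (measure_mx_display d)
  'M[T]_(m, n) <<s mx_cylinders >> mx_set0 mx_setC mx_bigcup.

Lemma measurable_coord (i : 'I_m) (j : 'I_n) :
  measurable_fun [set: 'M[T]_(m, n)] (fun M : 'M[T]_(m, n) => M i j).
Proof.
by move=> _ Y mY; rewrite setTI; apply: sub_sigma_algebra; exists i, j, Y.
Qed.

Lemma measurable_fun_mxP d0 (S : measurableType d0) (f : S -> 'M[T]_(m, n)) :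
  (forall i j, measurable_fun [set: S] (fun s => f s i j)) ->
  measurable_fun [set: S] f.
Proof.
move=> mf; apply: (@measurability _ _ _ _ _ _ mx_cylinders) => //.
by move=> _ [_ [i [j [Y mY ->]]] <-]; exact: mf.
Qed.

End measurable_mx.

Section lebesgue_rV.
Context {R : realType}.
Local Open Scope ereal_scope.

Definition cons_rV n (p : R * 'rV[R]_n) : 'rV[R]_n.+1 :=
  row_mx (const_mx p.1 : 'rV[R]_1) p.2.

Definition uncons_rV n (v : 'rV[R]_n.+1) : R * 'rV[R]_n :=
  (v ord0 ord0, \row_(i < n) v ord0 (lift ord0 i)).

(* Lebesgue measure on R^n as the n-fold product of the one on R; see
   lebesgue_rV_box for its characterization on boxes. *)
Fixpoint lebesgue_rV (n : nat) : set 'rV[R]_n -> \bar R :=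
  match n with
  | 0 => \d_ (0%R : 'rV[R]_0)
  | n'.+1 => pushforward (lebesgue_measure \x @lebesgue_rV n') (@cons_rV n')
  end.

Lemma cons_rV0 n (p : R * 'rV[R]_n) : cons_rV p ord0 ord0 = p.1.
Proof.
have -> : (ord0 : 'I_n.+1) = lshift n (ord0 : 'I_1) by exact/val_inj.
by apply: (etrans (row_mxEl (const_mx p.1) p.2 ord0 ord0)); rewrite mxE.
Qed.

Lemma cons_rVS n (p : R * 'rV[R]_n) (i : 'I_n) :
  cons_rV p ord0 (lift ord0 i) = p.2 ord0 i.
Proof.
have -> : lift ord0 i = rshift 1 i by exact/val_inj.
exact: (row_mxEr (const_mx p.1) p.2 ord0 i).
Qed.

Lemma cons_rVK n : cancel (@cons_rV n) (@uncons_rV n).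
Proof.
move=> [x v]; rewrite /uncons_rV cons_rV0; congr pair.
by apply/rowP => i; rewrite mxE cons_rVS.
Qed.

Lemma uncons_rVK n : cancel (@uncons_rV n) (@cons_rV n).
Proof.
move=> v; apply/rowP => i; case: (unliftP ord0 i) => [j|] ->.
  by rewrite cons_rVS mxE.
by rewrite cons_rV0.
Qed.

Lemma measurable_cons_rV n :
  measurable_fun [set: measurableTypeR R * 'rV[R]_n] (@cons_rV n).
Proof.
apply: measurable_fun_mxP => i j; rewrite (ord1 i).
case: (unliftP ord0 j) => [k|] ->.
  under eq_fun do rewrite cons_rVS.
  apply: (measurableT_comp (measurable_coord ord0 k)).
  exact: measurable_snd.
under eq_fun do rewrite cons_rV0.
exact: measurable_fst.
Qed.

Lemma measurable_uncons_rV n :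
  measurable_fun [set: 'rV[R]_n.+1]
    (@uncons_rV n : _ -> measurableTypeR R * 'rV[R]_n).
Proof.
apply: measurable_fun_pair => /=; first exact: measurable_coord.
apply: measurable_fun_mxP => i j; under eq_fun do rewrite mxE.
exact: measurable_coord.
Qed.

Section cons_measure.
Variables (n : nat) (mu : {sigma_finite_measure set 'rV[R]_n -> \bar R}).

Let nu := pushforward (lebesgue_measure \x mu) (@cons_rV n).

Let mcons A : measurable A -> measurable (@cons_rV n @^-1` A).
Proof.
by move=> mA; rewrite -[X in measurable X]setTI; exact: measurable_cons_rV.
Qed.

Let nu0 : nu set0 = 0.
Proof. by rewrite /nu /pushforward preimage_set0 measure0. Qed.

Let nu_ge0 A : 0 <= nu A.
Proof. exact: (measure_ge0 (lebesgue_measure \x mu)). Qed.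

Let nu_sigma_additive : semi_sigma_additive nu.
Proof.
move=> F mF tF mUF; rewrite /nu /pushforward preimage_bigcup.
apply: measure_semi_sigma_additive.
- by move=> k; exact: mcons.
- apply/trivIsetP => /= i j _ _ ij; rewrite -preimage_setI.
  by move/trivIsetP : tF => /(_ _ _ _ _ ij) ->//; rewrite preimage_set0.
- by rewrite -preimage_bigcup; exact: mcons.
Qed.

HB.instance Definition _ := isMeasure.Build _ _ _ nu
  nu0 nu_ge0 nu_sigma_additive.

Let nu_sigma_finite : sigma_finite setT nu.
Proof.
have /sigma_finiteP[F [TF ndF Foo]] := sigma_finiteT (@lebesgue_measure R).
have /sigma_finiteP[G [TG ndG Goo]] := sigma_finiteT mu.
exists (fun k => @uncons_rV n @^-1` (F k `*` G k)).
  rewrite -preimage_bigcup; apply/esym/seteqP; split=> // v _ /=.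
  have : setT (uncons_rV v).1 by [].
  have : setT (uncons_rV v).2 by [].
  rewrite TF TG => -[k _ Gk] [l _ Fl]; exists (maxn k l) => //; split.
    by move: Fl; exact/subsetPset/ndF/leq_maxr.
  by move: Gk; exact/subsetPset/ndG/leq_maxl.
move=> k; have [mF Fk] := Foo k; have [mG Gk] := Goo k; split.
  rewrite -[X in measurable X]setTI; apply: measurable_uncons_rV => //.
  exact: measurableX.
rewrite /nu /pushforward -comp_preimage.
rewrite (_ : _ \o _ = id); last by apply/funext => p /=; rewrite cons_rVK.
by rewrite preimage_id product_measure1E// lte_mul_pinfty// ge0_fin_numE.
Qed.

HB.instance Definition _ := Measure_isSigmaFinite.Build _ _ _ nu
  nu_sigma_finite.

Lemma cons_measureP :
  exists nu' : {sigma_finite_measure set 'rV[R]_n.+1 -> \bar R}, nu = nu'.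
Proof. by exists nu. Qed.

End cons_measure.

Let lebesgue_rV_struct n :
  exists mu : {sigma_finite_measure set 'rV[R]_n -> \bar R},
    @lebesgue_rV n = mu.
Proof.
elim: n => [|n [mu IH]]; first by exists (\d_ (0%R : 'rV[R]_0)).
by rewrite /= IH; exact: cons_measureP.
Qed.

Section lebesgue_rV_measure.
Variable n : nat.

Let lebesgue_rV0 : @lebesgue_rV n set0 = 0.
Proof. by have [mu ->] := lebesgue_rV_struct n; exact: measure0. Qed.

Let lebesgue_rV_ge0 A : 0 <= @lebesgue_rV n A.
Proof. by have [mu ->] := lebesgue_rV_struct n; exact: measure_ge0. Qed.

Let lebesgue_rV_sigma_additive : semi_sigma_additive (@lebesgue_rV n).
Proof.
by have [mu ->] := lebesgue_rV_struct n; exact: measure_semi_sigma_additive.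
Qed.

HB.instance Definition _ := isMeasure.Build _ _ _ (@lebesgue_rV n)
  lebesgue_rV0 lebesgue_rV_ge0 lebesgue_rV_sigma_additive.

Let lebesgue_rV_sigma_finite : sigma_finite setT (@lebesgue_rV n).
Proof. by have [mu ->] := lebesgue_rV_struct n; exact: sigma_finiteT. Qed.

HB.instance Definition _ := Measure_isSigmaFinite.Build _ _ _ (@lebesgue_rV n)
  lebesgue_rV_sigma_finite.

End lebesgue_rV_measure.

Lemma measurable_box n (B : 'I_n -> set (measurableTypeR R)) :
  (forall i, measurable (B i)) ->
  measurable [set x : 'rV[R]_n | forall i, B i (x ord0 i)].
Proof.
move=> mB; rewrite (_ : [set _ | _] =
  \bigcap_(i in [set: 'I_n]) [set x : 'rV[R]_n | B i (x ord0 i)]).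
  apply: fin_bigcap_measurable => // i _.
  rewrite -[X in measurable X]setTI.
  exact: (measurable_coord ord0 i measurableT (mB i)).
by apply/seteqP; split => x /= Bx i; [move=> _|]; exact: Bx.
Qed.

Lemma lebesgue_rV_box n (B : 'I_n -> set (measurableTypeR R)) :
  (forall i, measurable (B i)) ->
  lebesgue_rV [set x : 'rV[R]_n | forall i, B i (x ord0 i)] =
  \prod_(i < n) lebesgue_measure (B i).
Proof.
elim: n B => [|n IH] B mB.
  by rewrite big_ord0 /= diracE mem_set// => -[].
have mBS : measurable
    [set v : 'rV[R]_n | forall i, B (lift ord0 i) (v ord0 i)].
  by apply: (@measurable_box n (fun i => B (lift ord0 i))) => i.
rewrite big_ord_recl -(IH (fun i => B (lift ord0 i)))//.
rewrite -(product_measure1E lebesgue_measure (@lebesgue_rV n))//.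
congr (product_measure1 _ _ _) => /=; apply/seteqP; split => -[x v] /=.
  move=> H; split => [|i]; first by have := H ord0; rewrite cons_rV0.
  by have := H (lift ord0 i); rewrite cons_rVS.
move=> [H0 HS] i; case: (unliftP ord0 i) => [j|] ->.
  by rewrite cons_rVS.
by rewrite cons_rV0.
Qed.

End lebesgue_rV.
Arguments lebesgue_rV {R n}.

Section approximate_orthogonality.
Context {R : realType}.
Local Open Scope complex_scope.

Definition dotp d (x y : 'rV[R]_d) : R := \sum_(i < d) x ord0 i * y ord0 i.

(* The norm `|x| of the library on 'rV[R]_d is the sup norm. *)
Definition enorm d (x : 'rV[R]_d) : R := Num.sqrt (dotp x x).

Definition unit_ball d : set 'rV[R]_d := [set x | enorm x <= 1].

Definition cis (t : R) : R[i] := cos t +i* sin t.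

Section L2.
Context {dT : measure_display} {T : measurableType dT}.
Variables (mu : {measure set T -> \bar R}) (D : set T).

Definition Cmeasurable_fun (f : T -> R[i]) :=
  measurable_fun D (fun x => complex.Re (f x)) /\
  measurable_fun D (fun x => complex.Im (f x)).

Definition Cintegral (f : T -> R[i]) : R[i] :=
  (\int[mu]_(x in D) complex.Re (f x)) +i* (\int[mu]_(x in D) complex.Im (f x)).

Definition L2norm (f : T -> R[i]) : \bar R :=
  ('N[mu]_2%:E [(fun x => (Normc.normc (f x))%:E) \_ D])%E.

Definition in_L2 (f : T -> R[i]) := Cmeasurable_fun f /\ (L2norm f < +oo)%E.

(* Functions represent their a.e. classes; uniqueness of the coefficients does
   not depend on the representatives as convergence is in norm. *)
Definition schauder_basis_L2 (b : nat -> T -> R[i]) :=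
  (forall n, in_L2 (b n)) /\
  forall f, in_L2 f -> exists! c : nat -> R[i],
    L2norm (fun x => f x - \sum_(k < N) c k * b k x) @[N --> \oo] --> 0%E.

End L2.

Definition expo d (a : 'rV[R]_d) : 'rV[R]_d -> R[i] :=
  fun x => cis (2 * pi * dotp x a).

Definition fourier_indic d (Omega : set 'rV[R]_d) (xi : 'rV[R]_d) : R[i] :=
  Cintegral lebesgue_rV Omega (fun x => cis (- (2 * pi * dotp x xi))).

Definition approx_orthogonal d (phi : R -> R) (Omega : set 'rV[R]_d)
    (a a' : 'rV[R]_d) :=
  Normc.normc (fourier_indic Omega (a - a')) <= phi (enorm (a - a')).

Definition exp_basis d (Omega A : set 'rV[R]_d) :=
  exists a : nat -> 'rV[R]_d,
    set_bij [set: nat] A a /\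
    schauder_basis_L2 lebesgue_rV Omega (fun n => expo (a n)).

Definition approx_orthogonal_basis d (phi : R -> R) (Omega A : set 'rV[R]_d) :=
  exp_basis Omega A /\
  forall a a', A a -> A a' -> a != a' -> approx_orthogonal phi Omega a a'.

(* Measurability for the Lebesgue sigma-algebra: the canonical one of the
   library on R is the Borel sigma-algebra. *)
Definition Lebesgue_measurable_fun (D : set R) (f : R -> R) :=
  measurable_fun
    (D : set (g_sigma_algebraType (completed_algebra_gen (@lebesgue_measure R))))
    f.

End approximate_orthogonality.

(* Main.v *)
Require Import Defs.
From HB Require Import structures.
From mathcomp Require Import all_boot all_order all_algebra.
From mathcomp Require Import complex.
From mathcomp Require Import all_classical all_reals all_analysis.
From mathcomp Require Import measurable_realfun.
From mathcomp Require Import ring lra.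

Set Implicit Arguments.
Unset Strict Implicit.
Unset Printing Implicit Defensive.
Import Order.TTheory GRing.Theory Num.Theory.
Import numFieldNormedType.Exports.
Local Open Scope classical_set_scope.
Local Open Scope ring_scope.

(** Why there is no such basis.

    The coefficient functionals of a Schauder basis are continuous: by Banach's
    theorem there is a constant [M] such that the coefficients of [f] are
    bounded by [M] times the norm of [f] when the vectors of the basis have the
    same norm ([schauder_coef_bounded]). For a basis of exponentials with
    frequencies [a k] this has two consequences.
    - The frequencies are separated ([exp_basis_separated]): the difference of
      two exponentials of the basis has a coefficient equal to 1, while its norm
      on the ball is at most a constant times the distance of the frequencies.
    - The frequencies are relatively dense ([exp_basis_relatively_dense]): let
      [W] be the product of an exponential of frequency [p] and a fixed bump.
      Pairing the expansion of [W] with [W] itself bounds the squared norm of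
      [W], which does not depend on [p], by [M] times its norm times the sum
      over [k] of the moduli of the Fourier transform of the bump at [a k - p].
      As the [a k] are separated and the transform decays, this sum is small if all the
      [a k] are far from [p].

    The Fourier transform of the unit ball of dimension [d] at [xi] has a real
    part equal to a positive constant times [I (2 pi |xi|)], where [I] is a
    Bessel function up to a power of its argument ([Re_fourier_ball]). The
    function [h x = x ^ ((d + 1) / 2) * I x] solves [h'' = - (1 - k / x ^ 2) h],
    so that it oscillates like a sine of period [2 pi] whose amplitude does not
    vanish at infinity. Therefore, if [h] is small at two large points of
    bounded distance, this distance is close to a multiple of [pi]
    ([bessel_phase_rigidity]). The assumption on [phi] says that [h] is small at
    [2 pi |a - a'|] for frequencies [a] and [a'] that are far apart.

    Now fix two frequencies [y] and [y'] and let a third one, [x], go to infinity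
    within bounded distance of a half-line of direction [u] starting at [y];
    relative density provides it. Then [|x - y| - |x - y'|] tends to the scalar
    product of [u] and [y' - y] ([distance_difference_limit]). In dimension at
    least 2 the direction [u] can be chosen so that this limit lies strictly
    between 0 and 1/2 ([unit_vector_small_slope]), whereas twice the difference
    has to approach an integer. *)

(** * Continuity of the coefficient functionals *)

Section fast_cauchy.
Context {R : realType}.
Implicit Types (e : nat -> R).

(** The intervals of centre [x n] and radius [2 * e n] are nested. *)
Lemma real_fast_cauchy (x : nat -> R) e :
  (forall n, `|x n.+1 - x n| <= e n) -> (forall n, e n.+1 <= e n / 2) ->
  exists w, forall n, `|w - x n| <= 2 * e n.
Proof.
move=> xe eh.
have e0 n : 0 <= e n by apply: le_trans (xe n).
pose a n := x n - 2 * e n; pose c n := x n + 2 * e n.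
have aS n : a n <= a n.+1.
  by rewrite /a; have := xe n; have := eh n; rewrite ler_norml => ? /andP[]; lra.
have cS n : c n.+1 <= c n.
  by rewrite /c; have := xe n; have := eh n; rewrite ler_norml => ? /andP[]; lra.
have ha n m : (n <= m)%N -> a n <= a m.
  move=> /subnKC <-; elim: (m - n)%N => [|k IH]; first by rewrite addn0.
  by rewrite addnS (le_trans IH).
have hc n m : (n <= m)%N -> c m <= c n.
  move=> /subnKC <-; elim: (m - n)%N => [|k IH]; first by rewrite addn0.
  by rewrite addnS (le_trans _ IH).
have ac n : a n <= c n by rewrite /a /c; have := e0 n; lra.
have acnm n m : a n <= c m.
  rewrite (le_trans (ha n (maxn n m) (leq_maxl _ _)))//.
  by rewrite (le_trans (ac _))// hc// leq_maxr.
exists (sup (range a)) => n; rewrite ler_distl.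
have an : a n <= sup (range a).
  apply: ub_le_sup; last by exists n.
  by exists (c 0%N) => _ [m _ <-].
have cn : sup (range a) <= c n.
  by apply: ge_sup; [exists (a 0%N), 0%N|move=> _ [m _ <-]].
by apply/andP; move: an cn; rewrite /a /c; split; lra.
Qed.

Lemma normc_Re (z : R[i]) : `|complex.Re z| <= Normc.normc z.
Proof.
case: z => a b /=; rewrite -(sqrtr_sqr a) ler_wsqrtr//.
by rewrite lerDl sqr_ge0.
Qed.

Lemma normc_Im (z : R[i]) : `|complex.Im z| <= Normc.normc z.
Proof.
case: z => a b /=; rewrite -(sqrtr_sqr b) ler_wsqrtr//.
by rewrite lerDr sqr_ge0.
Qed.

Lemma normc_ReIm (z : R[i]) :
  Normc.normc z <= `|complex.Re z| + `|complex.Im z|.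
Proof.
case: z => a b /=; rewrite -[leRHS]ger0_norm ?addr_ge0//.
rewrite -sqrtr_sqr ler_wsqrtr// sqrrD !real_normK ?num_real//.
by rewrite -addrA lerD2l lerDr mulrn_wge0 ?mulr_ge0.
Qed.

Lemma normc_ge0 (z : R[i]) : 0 <= Normc.normc z.
Proof. by case: z => a b; exact: sqrtr_ge0. Qed.

Lemma normcNE (z : R[i]) : Normc.normc (- z) = Normc.normc z.
Proof. exact: (normcN z). Qed.

Lemma complex_fast_cauchy (z : nat -> R[i]) e :
  (forall n, Normc.normc (z n.+1 - z n) <= e n) ->
  (forall n, e n.+1 <= e n / 2) ->
  exists w, forall n, Normc.normc (w - z n) <= 4 * e n.
Proof.
move=> ze eh.
have [|a aP] := @real_fast_cauchy (fun n => complex.Re (z n)) e _ eh.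
  move=> n; apply: le_trans (ze n); apply: le_trans (normc_Re _).
  by case: (z n.+1) (z n) => [? ?] [? ?].
have [|b bP] := @real_fast_cauchy (fun n => complex.Im (z n)) e _ eh.
  move=> n; apply: le_trans (ze n); apply: le_trans (normc_Im _).
  by case: (z n.+1) (z n) => [? ?] [? ?].
exists (Complex a b) => n; apply: (le_trans (normc_ReIm _)).
have := aP n; have := bP n; case: (z n) => [? ?] /= ? ?; lra.
Qed.

End fast_cauchy.

Section schauder_coefficients.
Context {R : realType} (V : lmodType R[i]) (N : V -> R).
Hypothesis N_ge0 : forall u, 0 <= N u.
Hypothesis ND : forall u v, N (u + v) <= N u + N v.
Hypothesis NZ : forall c u, N (c *: u) = Normc.normc c * N u.
Hypothesis N_complete : forall (h : nat -> V) (e : nat -> R),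
  (forall n, N (h n.+1 - h n) <= e n) -> (forall n, e n.+1 <= e n / 4) ->
  exists f, forall n, N (f - h n) <= 8 * e n.
Variables (b : nat -> V) (beta : R).
Hypothesis beta_gt0 : 0 < beta.
Hypothesis b_lb : forall k, beta <= N (b k).

Let S (c : nat -> R[i]) n : V := \sum_(k < n) c k *: b k.

Let expands f c := forall e, 0 < e ->
  exists n0, forall n, (n0 <= n)%N -> N (f - S c n) <= e.

Hypothesis basis : forall f, exists! c, expands f c.

Let NN u : N (- u) = N u.
Proof. by rewrite -scaleN1r NZ normcNE Normc.normc1 mul1r. Qed.

Let NB u v : N (u - v) <= N u + N v.
Proof. by rewrite (le_trans (ND _ _))// NN. Qed.

Let N0 : N 0 = 0.
Proof. by rewrite -(scale0r (0 : V)) NZ Normc.normc0 mul0r. Qed.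

Let Ndist u v w : N (u - w) <= N (u - v) + N (v - w).
Proof. by rewrite -[u in leLHS](subrK v) -addrA ND. Qed.

Let SB c c' n : S (fun k => c k - c' k) n = S c n - S c' n.
Proof. by rewrite /S -sumrB; apply: eq_bigr => i _; rewrite scalerBl. Qed.

Let SZ a c n : S (fun k => a * c k) n = a *: S c n.
Proof. by rewrite /S scaler_sumr; apply: eq_bigr => i _; rewrite scalerA. Qed.

Let coef f : nat -> R[i] := projT1 (cid (basis f)).

Let coefP f : expands f (coef f).
Proof. by rewrite /coef; case: cid => c []. Qed.

Let coef_unique f c : expands f c -> coef f = c.
Proof. by rewrite /coef; case: cid => d [? h] ec; exact: h. Qed.

Let coefB f g k : coef (f - g) k = coef f k - coef g k.
Proof.
suff -> : coef (f - g) = (fun k => coef f k - coef g k) by [].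
apply: coef_unique => e e0.
have e20 : 0 < e / 2 by lra.
have [n1 h1] := coefP f e20; have [n2 h2] := coefP g e20.
exists (maxn n1 n2) => n; rewrite geq_max => /andP[/h1 {}h1 /h2 {}h2].
rewrite SB; have -> : f - g - (S (coef f) n - S (coef g) n) =
    (f - S (coef f) n) - (g - S (coef g) n).
  by rewrite !opprB [LHS]addrACA [RHS]addrACA (addrC (- g)).
by apply: le_trans (NB _ _) _; lra.
Qed.

Let coefZ a f k : coef (a *: f) k = a * coef f k.
Proof.
suff -> : coef (a *: f) = (fun k => a * coef f k) by [].
apply: coef_unique => e e0.
pose A := Normc.normc a + 1.
have A0 : 0 < A by have := normc_ge0 a; rewrite /A; lra.
have [n1 h1] := coefP f (divr_gt0 e0 A0).
exists n1 => n /h1 {}h1; rewrite SZ -scalerBr NZ.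
apply: le_trans (_ : A * N (f - S (coef f) n) <= _).
  by rewrite ler_wpM2r// /A; lra.
by rewrite mulrC -ler_pdivlMr.
Qed.

Let F M f := forall n, N (S (coef f) n) <= M.

Let F_exhaust f : exists M, F M f.
Proof.
have [n0 h] := coefP f ltr01.
have [M HM] : exists M, forall n, (n < n0)%N -> N (S (coef f) n) <= M.
  elim: n0 {h} => [|m [M IH]]; first by exists 0.
  exists (Num.max M (N (S (coef f) m))) => n; rewrite ltnS leq_eqVlt.
  by move=> /predU1P[->|/IH nM]; rewrite le_max ?lexx ?orbT// nM.
exists (Num.max M (N f + 1)) => n; rewrite le_max.
have [/HM -> //|/h h'] := ltnP n n0; apply/orP; right.
by rewrite -[X in N X](subKr f); apply: le_trans (NB _ _) _; lra.
Qed.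

Let FB M M' f g : F M f -> F M' g -> F (M + M') (f - g).
Proof.
move=> Ff Fg n; have -> : coef (f - g) = fun k => coef f k - coef g k.
  by apply/funext => k; rewrite coefB.
by rewrite SB (le_trans (NB _ _))// lerD.
Qed.

Let FZ M a f : F M f -> F (Normc.normc a * M) (a *: f).
Proof.
move=> Ff n; have -> : coef (a *: f) = fun k => a * coef f k.
  by apply/funext => k; rewrite coefZ.
by rewrite SZ NZ ler_wpM2l ?normc_ge0.
Qed.

(** Baire's theorem for the sets [F n]: otherwise there is a sequence of nested
    balls, the [n]-th of which avoids [F n]; their common point belongs to no
    [F n]. *)
Let F_somewhere_dense : exists (M r : R) (f : V), 0 < r /\
  forall h, N (h - f) < r -> forall e, 0 < e -> exists2 u, F M u & N (h - u) < e.
Proof.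
apply: contrapT => nex.
have step (p : V * R) (n : nat) : exists q : V * R, 0 < p.2 ->
    [/\ N (q.1 - p.1) <= p.2 / 16, 0 < q.2, q.2 <= p.2 / 4 &
        forall u, F n%:R u -> q.2 <= N (q.1 - u)].
  have [p0|] := ltP 0 p.2; last by exists p => ?; exfalso; lra.
  have [h [hp [e [e0 he]]]] : exists h, N (h - p.1) < p.2 / 16 /\
      exists e, 0 < e /\ forall u, F n%:R u -> e <= N (h - u).
    apply: contrapT => nh; apply: nex; exists n%:R, (p.2 / 16), p.1.
    split; first by lra.
    move=> h hp e e0; apply: contrapT => nu; apply: nh; exists h; split=> //.
    exists e; split=> // u Fu; rewrite leNgt; apply/negP => hu.
    by apply: nu; exists u.
  exists (h, Num.min e (p.2 / 4)) => _ /=; split.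
  - exact: ltW.
  - by rewrite lt_min e0; lra.
  - by rewrite ge_min lexx orbT.
  - by move=> u /he; apply: le_trans; rewrite ge_min lexx.
have [g gP] := choice (fun pn : (V * R) * nat => step pn.1 pn.2).
pose q := fix q n : V * R := if n is m.+1 then g (q m, m) else (0, 1).
have q0 n : 0 < (q n).2.
  elim: n => [|n IH] /=; first exact: ltr01.
  by have [] := gP (q n, n) IH.
(* the limit is within half of the n-th radius of the n-th centre *)
have [f fP] : exists f, forall n, N (f - (q n).1) <= 8 * ((q n).2 / 16).
  apply: (@N_complete (fun n => (q n).1) (fun n => (q n).2 / 16)) => n /=.
    by have [] := gP (q n, n) (q0 n).
  by have [_ _ + _] := gP (q n, n) (q0 n); lra.
have [M FM] := F_exhaust f.
pose n := Num.bound `|M|.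
have Fn : F n%:R f.
  move=> k; apply: le_trans (FM k) _; apply: le_trans (ler_norm M) _.
  exact/ltW/(archi_boundP (normr_ge0 _)).
have [_ _ _ /(_ f Fn)] := gP (q n, n) (q0 n).
rewrite -/(q n.+1) -[X in N X]opprB NN leNgt => /negP; apply.
by apply: le_lt_trans (fP n.+1) _; have := q0 n.+1; lra.
Qed.

(** The set [F M] approximates both the centre [f] of the ball of
    [F_somewhere_dense] and [f + t h]; hence [h], which is their difference
    divided by [t], is approximated from a multiple of [F (M + M)]. *)
Let F_dense_balls : exists2 K, 0 < K & forall rho h, 0 < rho -> N h <= rho ->
  exists2 u, F (K * rho) u & N (h - u) <= rho / 2.
Proof.
have [M [r [f [r0 dns]]]] := F_somewhere_dense.
have Mge0 : 0 <= M.
  have ff : N (f - f) < r by rewrite subrr N0.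
  have [u Fu _] := dns f ff _ ltr01.
  exact: le_trans (N_ge0 _) (Fu 0%N).
exists (4 * (M + 1) / r); first by apply: divr_gt0 => //; lra.
move=> rho h rho0 hrho.
pose t : R := r / (2 * rho).
have t0 : 0 < t by apply: divr_gt0 => //; lra.
have nt : Normc.normc (t%:C%C) = t by rewrite /= expr0n addr0 sqrtr_sqr gtr0_norm.
have nt' : Normc.normc ((t%:C%C)^-1) = t^-1 by rewrite Normc.normcV nt.
have tC0 : t%:C%C != 0 by rewrite eq_complex /= eqxx andbT gt_eqF.
have th : N (t%:C%C *: h) < r.
  rewrite NZ nt; apply: le_lt_trans (_ : t * rho < r).
    by rewrite ler_pM2l.
  have -> : t * rho = r / 2 by rewrite /t; field; rewrite gt_eqF.
  by lra.
have r80 : 0 < r / 8 by lra.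
have [u1 Fu1 h1] : exists2 u, F M u & N (f + t%:C%C *: h - u) < r / 8.
  by apply: dns => //; rewrite addrC addKr.
have [u2 Fu2 h2] : exists2 u, F M u & N (f - u) < r / 8.
  by apply: dns => //; rewrite subrr N0.
exists ((t%:C%C)^-1 *: (u1 - u2)).
  move=> n; apply: le_trans (FZ _ (FB Fu1 Fu2) n) _.
  rewrite nt' /t invf_div.
  have -> : 2 * rho / r * (M + M) = 4 * M / r * rho by field; rewrite gt_eqF.
  by rewrite ler_pM2r// ler_pM2r ?invr_gt0//; lra.
have -> : h - (t%:C%C)^-1 *: (u1 - u2) =
    (t%:C%C)^-1 *: ((f + t%:C%C *: h - u1) - (f - u2)).
  rewrite -[h in LHS](scalerK tC0) -scalerBr; congr (_ *: _).
  rewrite !opprB -[f + _ - u1]addrA [RHS]addrC addrA subrK.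
  by rewrite [RHS]addrCA.
rewrite NZ nt' -ler_pdivlMl ?invr_gt0// invrK.
apply: le_trans (NB _ _) _.
have -> : t * (rho / 2) = r / 4 by rewrite /t; field; rewrite gt_eqF.
lra.
Qed.

(** Banach's theorem on Schauder bases; [N] is only a seminorm because square
    integrable functions are not identified when they agree almost everywhere.
    By iterating [F_dense_balls], [f] is the sum of vectors [g (q J)] of
    [F (K * rho / 2 ^ J)]. Their coefficients sum to an expansion of [f] whose
    partial sums are bounded by a multiple of [rho]; since expansions are
    unique, it is the expansion of [f]. *)
Theorem schauder_coef_bounded : exists2 M : R, 0 < M &
  forall f c, expands f c -> forall rho, 0 < rho -> N f <= rho ->
  forall k, Normc.normc (c k) <= M * rho.
Proof.
have [K K0 KP] := F_dense_balls.
suff H f rho : 0 < rho -> N f <= rho -> F (8 * K * rho) f.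
  exists (16 * K / beta); first by rewrite divr_gt0// mulr_gt0.
  move=> f c /coef_unique <- rho rho0 frho k.
  have := H f rho rho0 frho => FF.
  have : N (S (coef f) k.+1 - S (coef f) k) <= 16 * K * rho.
    apply: le_trans (NB _ _) _.
    by have := FF k; have := FF k.+1; lra.
  rewrite {1}/S big_ord_recr /= addrAC subrr add0r NZ => hk.
  rewrite mulrAC ler_pdivlMr//; apply: le_trans hk.
  by rewrite ler_wpM2l ?normc_ge0.
move=> rho0 frho.
have step (p : V * R) : exists u, 0 < p.2 -> N p.1 <= p.2 ->
    F (K * p.2) u /\ N (p.1 - u) <= p.2 / 2.
  have [p0|p0] := ltP 0 p.2; last by exists 0 => ?; exfalso; lra.
  have [pN|pN] := leP (N p.1) p.2; last by exists 0 => ? ?; exfalso; lra.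
  by have [u ? ?] := KP _ _ p0 pN; exists u.
have [g gP] := choice step.
(* what remains of f after n approximations, and a bound for its norm *)
pose q := fix q n : V * R :=
  if n is m.+1 then ((q m).1 - g (q m), (q m).2 / 2) else (f, rho).
have q2 n : 0 < (q n).2 by elim: n => //= n IH; lra.
have q1 n : N (q n).1 <= (q n).2.
  by elim: n => //= n IH; have [] := gP (q n) (q2 n) IH.
have Fg n : F (K * (q n).2) (g (q n)) by have [] := gP (q n) (q2 n) (q1 n).
(* the coefficients of the sum of the first J approximations *)
pose z J k := coef f k - coef (q J).1 k.
have zS J k : z J.+1 k - z J k = coef (g (q J)) k.
  by rewrite /z /= coefB; ring.
have ex_lim k : exists w, forall J, Normc.normc (w - z J k) <=
    4 * (2 * (K * (q J).2) / beta).
  apply: (@complex_fast_cauchy R (fun J => z J k)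
    (fun J => 2 * (K * (q J).2) / beta)) => J; last by rewrite /=; lra.
  rewrite zS ler_pdivlMr//.
  apply: le_trans (_ : Normc.normc (coef (g (q J)) k) * N (b k) <= _).
    by rewrite ler_wpM2l ?normc_ge0.
  rewrite -NZ.
  have -> : coef (g (q J)) k *: b k =
      S (coef (g (q J))) k.+1 - S (coef (g (q J))) k.
    by rewrite /S big_ord_recr /= addrAC subrr add0r.
  apply: le_trans (NB _ _) _.
  by have := Fg J k; have := Fg J k.+1; lra.
have [w wP] := choice ex_lim.
have q2h J : (q J.+1).2 = (q J).2 / 2 by [].
have Sz J J' n : N (S (z (J + J')%N) n - S (z J) n) <=
    2 * K * ((q J).2 - (q (J + J')%N).2).
  elim: J' => [|J' IH]; first by rewrite addn0 !subrr mulr0 N0.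
  rewrite addnS; apply: le_trans (Ndist _ (S (z (J + J')%N) n) _) _.
  rewrite -SB; have -> : (fun k => z (J + J').+1 k - z (J + J')%N k) =
      coef (g (q (J + J')%N)) by apply/funext => k; rewrite zS.
  have := Fg (J + J')%N n; rewrite q2h; move: IH.
  have := q2 (J + J')%N; nra.
have qsmall e : 0 < e -> exists J, forall J', (J <= J')%N -> (q J').2 <= e.
  move=> e0.
  have qE n : (q n).2 <= rho / (n%:R + 1).
    elim: n => [|n IH]; first by rewrite /= add0r divr1.
    rewrite q2h; have n1 : 0 < (n%:R + 1 : R) by rewrite ltr_wpDl.
    have n2 : 0 < (n.+1%:R + 1 : R) by rewrite ltr_wpDl.
    move: IH; rewrite !ler_pdivlMr// => IH.
    apply: le_trans IH.
    have : 0 <= (q n).2 * n%:R by rewrite mulr_ge0// ltW.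
    rewrite -[n.+1]addn1 natrD; lra.
  exists (Num.bound (rho / e)) => J' HJ; apply: le_trans (qE J') _.
  have n1 : 0 < (J'%:R + 1 : R) by rewrite ltr_wpDl.
  rewrite ler_pdivrMr// mulrC -ler_pdivrMr//.
  apply: le_trans (ltW (archi_boundP _)) _; first by rewrite divr_ge0// ltW.
  by apply: le_trans (_ : J'%:R <= _); rewrite ?ler_nat// lerDl.
have Sw J n : N (S w n - S (z J) n) <= 2 * K * (q J).2.
  apply/ler_addgt0Pr => e e0.
  (* B depends on n: this only serves to let J' go to infinity in Sz *)
  have [B HB] : exists B, 0 < B /\ forall J', N (S w n - S (z J') n) <=
      B * (q J').2.
    rewrite /S; elim: (n) => [|m [B [B0 HB]]].
      by exists 1; split=> // J'; rewrite !big_ord0 subrr N0 mul1r ltW.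
    exists (B + 8 * K / beta * N (b m) + 1); split.
      have : 0 <= 8 * K / beta * N (b m).
        by rewrite mulr_ge0// divr_ge0 ?mulr_ge0// ltW.
      lra.
    move=> J'; rewrite !big_ord_recr /= opprD addrACA -scalerBl.
    apply: le_trans (ND _ _) _; rewrite NZ.
    have := HB J'; have := q2 J'.
    have : Normc.normc (w m - z J' m) * N (b m) <=
        4 * (2 * (K * (q J').2) / beta) * N (b m).
      by rewrite ler_wpM2r.
    have -> : 4 * (2 * (K * (q J').2) / beta) * N (b m) =
       (8 * K / beta * N (b m)) * (q J').2 by ring.
    nra.
  have [J1 J1P] := qsmall (e / B) (divr_gt0 e0 HB.1).
  have := J1P (J + J1)%N (leq_addl _ _); rewrite ler_pdivlMr ?HB.1// => hq.
  apply: le_trans (Ndist _ (S (z (J + J1)%N) n) _) _.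
  have := Sz J J1 n; have := HB.2 (J + J1)%N; have := q2 (J + J1)%N.
  have : 0 <= K * (q (J + J1)%N).2 by rewrite mulr_ge0// ltW.
  nra.
have wf : expands f w.
  move=> e e0.
  have K1 : 0 < 2 * (2 * K + 1) by lra.
  have [J HJ] := qsmall (e / (2 * (2 * K + 1))) (divr_gt0 e0 K1).
  have := HJ J (leqnn _); rewrite ler_pdivlMr// => hq.
  have e20 : 0 < e / 2 by lra.
  have [n0 hn0] := coefP (f - (q J).1) e20.
  exists n0 => n /hn0 {}hn0.
  have SzE : S (z J) n = S (coef (f - (q J).1)) n.
    by congr S; apply/funext => k; rewrite coefB.
  apply: le_trans (Ndist _ (S (z J) n) _) _.
  have := Sw J n; rewrite -[X in N X]opprB NN.
  have : N (f - S (z J) n) <= N (q J).1 + e / 2.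
    rewrite SzE -[X in N (X - _)](subrKC (q J).1 f) -addrA.
    by apply: le_trans (ND _ _) _; rewrite lerD2l.
  have := q1 J; nra.
move=> n; rewrite (coef_unique wf).
have := Sw 0%N n; have -> : S (z 0%N) n = 0.
  by rewrite /S big1// => k _; rewrite /z /= subrr scale0r.
rewrite subr0 /= => H0; apply: le_trans H0 _.
have : 0 < K * rho by rewrite mulr_gt0.
by lra.
Qed.

End schauder_coefficients.

(** * Completeness of the space of square integrable functions *)

Section sqmod.
Context {R : realType}.
Implicit Types z y : R[i].

Lemma ReD z y : complex.Re (z + y) = complex.Re z + complex.Re y.
Proof. by case: z y => [? ?] []. Qed.

Lemma ImD z y : complex.Im (z + y) = complex.Im z + complex.Im y.
Proof. by case: z y => [? ?] []. Qed.

Lemma ReM z y : complex.Re (z * y) =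
  complex.Re z * complex.Re y - complex.Im z * complex.Im y.
Proof. by case: z y => [? ?] []. Qed.

Lemma ImM z y : complex.Im (z * y) =
  complex.Re z * complex.Im y + complex.Im z * complex.Re y.
Proof. by case: z y => [? ?] []. Qed.

Definition sqmod z : R := complex.Re z ^+ 2 + complex.Im z ^+ 2.

Lemma sqmod_ge0 z : 0 <= sqmod z.
Proof. by rewrite addr_ge0 ?sqr_ge0. Qed.

Lemma normcE z : Normc.normc z = Num.sqrt (sqmod z).
Proof. by case: z. Qed.

Lemma sqr_normcE z : Normc.normc z ^+ 2 = sqmod z.
Proof. by rewrite normcE sqr_sqrtr// sqmod_ge0. Qed.

Lemma sqmodM z y : sqmod (z * y) = sqmod z * sqmod y.
Proof. by rewrite -!sqr_normcE Normc.normcM exprMn. Qed.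

End sqmod.

Section weighted_tails.
Context {R : realType}.
Local Open Scope ereal_scope.

(** A pointwise majorant of the squared distance from [z n] to the limit of
    [z], when [s k] is the square of [|z k.+1 - z k|]. Its integral is finite as
    soon as the norms of the increments decrease like [4 ^- k], and the weights
    are large enough for its finiteness to force the convergence of [z]. *)
Definition weighted_tail (s : nat -> R) n : \bar R :=
  \sum_(0 <= k <oo) (4 ^+ k.+1 * s (n + k)%N)%:E.

Lemma weighted_tailS (s : nat -> R) n : (forall k, (0 <= s k)%R) ->
  weighted_tail s n = (4 * s n)%:E + 4%:E * weighted_tail s n.+1.
Proof.
move=> s0.
have f0 m k : 0 <= (4 ^+ k.+1 * s (m + k)%N)%:E by rewrite lee_fin mulr_ge0.
rewrite {1}/weighted_tail nneseries_recl// expr1 addn0; congr (_ + _).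
rewrite -nneseries_addn// -nneseriesZl//; apply: eq_eseriesr => k _.
by rewrite -EFinM mulrA -exprS addn1 addSnnS.
Qed.

Lemma weighted_tail_ge0 (s : nat -> R) n : (forall k, (0 <= s k)%R) ->
  0 <= weighted_tail s n.
Proof. by move=> s0; apply: nneseries_ge0 => k _ _; rewrite lee_fin mulr_ge0. Qed.

(** By [weighted_tailS], the square root of the tail bounds twice the increment
    and at least halves at each step. *)
Lemma weighted_tail_cauchy (z : nat -> R[i]) :
  weighted_tail (fun n => sqmod (z n.+1 - z n)%R) 0 < +oo ->
  exists w, forall n,
    (sqmod (w - z n)%R)%:E <= 4%:E * weighted_tail (fun n => sqmod (z n.+1 - z n)%R) n.
Proof.
set s := (fun n : nat => _ : R); set G := weighted_tail s => G0.
have s0 k : (0 <= s k)%R by exact: sqmod_ge0.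
have Gge0 n : 0 <= G n by exact: weighted_tail_ge0.
have Goo n : G n < +oo.
  elim: n => // n; rewrite /G (weighted_tailS _ s0) -/G; apply: contraTT.
  rewrite -leNgt leye_eq => /eqP ->.
  by rewrite gt0_muley ?lte_fin// addey.
have Gfin n : G n = (fine (G n))%:E by rewrite fineK// ge0_fin_numE.
have g0 n : (0 <= fine (G n))%R by rewrite fine_ge0.
have GS n : fine (G n) = (4 * s n + 4 * fine (G n.+1))%R.
  have := weighted_tailS n s0.
  by rewrite -![weighted_tail s _]/(G _) (Gfin n) (Gfin n.+1) -EFinM -EFinD => -[].
pose e n := (Num.sqrt (fine (G n)) / 2)%R.
have sq n : (Num.sqrt (fine (G n)) ^+ 2 = fine (G n))%R by rewrite sqr_sqrtr.
have se0 n : (0 <= Num.sqrt (fine (G n)))%R by rewrite sqrtr_ge0.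
have [n|n|w wP] := @complex_fast_cauchy R z e.
- rewrite normcE -/(s n) /e -(@ler_pXn2r _ 2) ?nnegrE ?sqrtr_ge0 ?divr_ge0//.
  rewrite sqr_sqrtr// expr_div_n sq (GS n); have := g0 n.+1; lra.
- rewrite /e -(@ler_pXn2r _ 2) ?nnegrE ?divr_ge0//.
  by rewrite !expr_div_n !sq (GS n); have := s0 n; lra.
exists w => n; rewrite Gfin -EFinM lee_fin -sqr_normcE.
have -> : (4 * fine (G n) = (4 * e n) ^+ 2)%R.
  by rewrite /e exprMn expr_div_n sq; lra.
by rewrite ler_pXn2r ?nnegrE ?mulr_ge0 ?divr_ge0// ?normc_ge0// wP.
Qed.

End weighted_tails.

Section L2_space.
Context {R : realType} {dT : measure_display} {T : measurableType dT}.
Variables (mu : {measure set T -> \bar R}) (D : set T).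
Hypothesis mD : measurable D.

Lemma L2normE (f : T -> R[i]) :
  (L2norm mu D f = (\int[mu]_(x in D) (sqmod (f x))%:E) `^ 2^-1)%E.
Proof.
rewrite /L2norm unlock /=; congr (_ `^ _)%E.
rewrite [RHS]integral_mkcond; apply: eq_integral => x _.
rewrite !patchE; case: ifP => _; last by rewrite abse0 poweR0r.
rewrite abse_EFin poweR_EFin ger0_norm ?normc_ge0//.
by rewrite powR_mulrn ?normc_ge0// sqr_normcE.
Qed.

Lemma measurable_sqmod (f : T -> R[i]) : Cmeasurable_fun D f ->
  measurable_fun D (fun x => sqmod (f x)).
Proof.
by move=> [mr mi]; apply: measurable_funD; apply: measurable_funX.
Qed.

Lemma in_L2P (f : T -> R[i]) : in_L2 mu D f <->
  Cmeasurable_fun D f /\ mu.-integrable D (fun x => (sqmod (f x))%:E).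
Proof.
rewrite /in_L2 L2normE; split=> -[mf foo]; split=> //.
  apply/integrableP; split; first exact/measurable_EFinP/measurable_sqmod.
  under eq_integral do rewrite gee0_abs ?lee_fin ?sqmod_ge0//.
  by apply: lty_poweRy foo; rewrite invr_eq0.
move/integrableP : foo => [_].
under eq_integral do rewrite gee0_abs ?lee_fin ?sqmod_ge0//.
exact: poweR_lty.
Qed.

Lemma in_L2_integrable_mul (f g h k : T -> R) :
  measurable_fun D f -> measurable_fun D g ->
  measurable_fun D h -> measurable_fun D k ->
  mu.-integrable D (fun x => (h x)%:E) -> mu.-integrable D (fun x => (k x)%:E) ->
  (forall x, f x ^+ 2 <= h x) -> (forall x, g x ^+ 2 <= k x) ->
  mu.-integrable D (fun x => (f x * g x)%:E).
Proof.
move=> mf mg mh mk ih ik fh gk.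
apply: (@le_integrable _ _ _ mu D mD _ (fun x => (h x + k x)%:E)).
- by apply/measurable_EFinP; exact: measurable_funM.
- move=> x _; rewrite lee_fin normrM.
  have hk : 0 <= h x + k x by have := fh x; have := gk x;
    have := sqr_ge0 (f x); have := sqr_ge0 (g x); lra.
  rewrite (ger0_norm hk).
  have := fh x; have := gk x; rewrite -(real_normK (num_real (f x))).
  rewrite -(real_normK (num_real (g x))).
  have := sqr_ge0 (`|f x| - `|g x|); have := normr_ge0 (f x).
  have := normr_ge0 (g x); nra.
- under eq_fun do rewrite EFinD; exact: integrableD.
Qed.

(** The real part of the Hermitian product: it determines the norm, and it
    avoids integrals of complex functions. *)
Definition L2dot (f g : T -> R[i]) : R := \int[mu]_(x in D)
  (complex.Re (f x) * complex.Re (g x) + complex.Im (f x) * complex.Im (g x)).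

Lemma in_L2_dot_integrable (f g : T -> R[i]) : in_L2 mu D f -> in_L2 mu D g ->
  mu.-integrable D (fun x =>
   (complex.Re (f x) * complex.Re (g x) + complex.Im (f x) * complex.Im (g x))%:E).
Proof.
move=> /in_L2P[mf intf] /in_L2P[mg intg].
have msf := measurable_sqmod mf; have msg := measurable_sqmod mg.
under eq_fun do rewrite EFinD.
have lR (z : R[i]) : complex.Re z ^+ 2 <= sqmod z by rewrite /sqmod lerDl sqr_ge0.
have lI (z : R[i]) : complex.Im z ^+ 2 <= sqmod z by rewrite /sqmod lerDr sqr_ge0.
case: mf => mfr mfi; case: mg => mgr mgi.
by apply: integrableD => //;
  [exact: (in_L2_integrable_mul mfr mgr msf msg intf intg (fun x => lR _) (fun x => lR _)) |
   exact: (in_L2_integrable_mul mfi mgi msf msg intf intg (fun x => lI _) (fun x => lI _))].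
Qed.

Lemma in_L2_lin (a : R[i]) (f g : T -> R[i]) : in_L2 mu D f -> in_L2 mu D g ->
  in_L2 mu D (fun x => a * f x + g x).
Proof.
move=> fL gL; have fg := in_L2_dot_integrable fL gL.
move: fL gL => /in_L2P[mf intf] /in_L2P[mg intg].
have mfg : Cmeasurable_fun D (fun x => a * f x + g x).
  case: mf => mfr mfi; case: mg => mgr mgi; split.
    under eq_fun do rewrite ReD ReM; apply: measurable_funD => //.
    by apply: measurable_funB; apply: measurable_funM.
  under eq_fun do rewrite ImD ImM; apply: measurable_funD => //.
  by apply: measurable_funD; apply: measurable_funM.
apply/in_L2P; split=> //.
apply: (@le_integrable _ _ _ mu D mD _
   (fun x => (2 * sqmod a * sqmod (f x) + 2 * sqmod (g x))%:E)).
- exact/measurable_EFinP/measurable_sqmod.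
- move=> x _; rewrite lee_fin.
  have s0 := @sqmod_ge0 R.
  have p0 : 0 <= 2 * sqmod a * sqmod (f x) + 2 * sqmod (g x).
    by apply: addr_ge0; apply: mulr_ge0 => //; apply: mulr_ge0.
  rewrite (ger0_norm (s0 _)) (ger0_norm p0) -mulrA -sqmodM; set z := a * f x.
  rewrite /sqmod ReD ImD.
  have := sqr_ge0 (complex.Re z - complex.Re (g x)).
  have := sqr_ge0 (complex.Im z - complex.Im (g x)); lra.
- rewrite (_ : (fun x => _) = (fun x => (2 * sqmod a)%:E * (sqmod (f x))%:E +
      2%:E * (sqmod (g x))%:E)%E); last by apply/funext => x; rewrite EFinD !EFinM.
  by apply: integrableD => //; apply: integrableZl.
Qed.

Lemma in_L2_cst0 : in_L2 mu D (fun=> 0).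
Proof.
apply/in_L2P; split; first by split; exact: measurable_cst.
rewrite (_ : (fun _ => _) = cst 0%E); first exact: integrable0.
by apply/funext => x; rewrite /sqmod /= expr0n addr0.
Qed.

(** The measurability of [D] is a parameter because the proof that this
    predicate is closed under linear combinations depends on it, and a canonical
    instance only finds what occurs in the predicate. *)
Definition L2pred : {pred T -> (R[i])^o} :=
  let _ := mD in fun f => `[< in_L2 mu D f >].

Lemma L2predP (f : T -> R[i]) : reflect (in_L2 mu D f) (f \in L2pred).
Proof. exact: asboolP. Qed.

Lemma L2pred_submod_closed : submod_closed L2pred.
Proof.
split; first by apply/L2predP; exact: in_L2_cst0.
by move=> a f g /L2predP fL /L2predP gL; apply/L2predP; exact: in_L2_lin.
Qed.

End L2_space.

Section L2_type.
Context {R : realType} {dT : measure_display} {T : measurableType dT}.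
Variables (mu : {measure set T -> \bar R}) (D : set T) (mD : measurable D).

HB.instance Definition _ :=
  GRing.isSubmodClosed.Build _ _ (L2pred mu mD) (L2pred_submod_closed mu mD).

Record L2space := L2Space { L2fun :> T -> (R[i])^o ; _ : L2fun \in L2pred mu mD }.

HB.instance Definition _ := [isSub for L2fun].
HB.instance Definition _ := [Choice of L2space by <:].
HB.instance Definition _ := [SubChoice_isSubLmodule of L2space by <:].

Lemma L2spaceP (f : L2space) : in_L2 mu D f.
Proof. exact/(L2predP mu mD)/(valP f). Qed.

Definition toL2 (f : T -> R[i]) (fL : in_L2 mu D f) : L2space :=
  L2Space (introT (L2predP mu mD f) fL).

Definition L2N (f : L2space) : R := fine (L2norm mu D f).

Lemma L2valZ (a : R[i]) (f : L2space) x : (a *: f : L2space) x = a * f x :> R[i].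
Proof. by []. Qed.

Lemma L2valD (f g : L2space) x : (f + g : L2space) x = f x + g x :> R[i].
Proof. by []. Qed.

Lemma L2norm_fin (f : L2space) : L2norm mu D f = (L2N f)%:E.
Proof.
rewrite fineK// ge0_fin_numE ?(L2spaceP f).2//; exact: Lnorm_ge0.
Qed.

Lemma L2N_ge0 f : 0 <= L2N f.
Proof. by rewrite fine_ge0// Lnorm_ge0. Qed.

Lemma L2dotE (f g : L2space) : mu.-integrable D (fun x =>
   (complex.Re (f x) * complex.Re (g x) + complex.Im (f x) * complex.Im (g x))%:E).
Proof. by apply: in_L2_dot_integrable => //; exact: L2spaceP. Qed.

Lemma sqr_L2N (f : L2space) : L2N f ^+ 2 = L2dot mu D f f.
Proof.
rewrite /L2N L2normE /L2dot.
have int := L2dotE f f.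
have E : (\int[mu]_(x in D) (sqmod (f x))%:E)%E = (L2dot mu D f f)%:E.
  rewrite /L2dot fineK; first by apply: eq_integral => x _.
  exact: integrable_fin_num.
rewrite E poweR_EFin /= powR12_sqrt ?sqr_sqrtr//.
  by apply: Rintegral_ge0 => x _; exact: sqmod_ge0.
by apply: Rintegral_ge0 => x _; exact: sqmod_ge0.
Qed.

Lemma L2dotDl (f g h : L2space) :
  L2dot mu D (f + g : L2space) h = L2dot mu D f h + L2dot mu D g h.
Proof.
rewrite /L2dot -RintegralD//; [|exact: L2dotE..].
apply: eq_Rintegral => x _; rewrite !L2valD.
by case: (f x) (g x) => [a b] [a' b'] /=; ring.
Qed.

Lemma L2dot0l (g : L2space) : L2dot mu D (0 : L2space) g = 0.
Proof.
by have := L2dotDl 0 0 g; rewrite addr0 => /eqP; rewrite -subr_eq subrr => /eqP.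
Qed.

Lemma L2dotC (f g : T -> R[i]) : L2dot mu D f g = L2dot mu D g f.
Proof. by apply: eq_Rintegral => x _; rewrite mulrC [X in _ + X]mulrC. Qed.

Lemma L2N_Z (a : R[i]) f : L2N (a *: f) = Normc.normc a * L2N f.
Proof.
apply/eqP; rewrite -(@eqrXn2 _ 2) ?mulr_ge0 ?L2N_ge0 ?normc_ge0//.
rewrite exprMn !sqr_L2N sqr_normcE /L2dot -RintegralZl//; last exact: L2dotE.
apply/eqP/eq_Rintegral => x _; rewrite !L2valZ.
by case: (f x) a => [? ?] [? ?]; rewrite /sqmod /=; ring.
Qed.

Lemma L2dotZl (a : R) (f g : L2space) :
  L2dot mu D (a%:C%C *: f : L2space) g = a * L2dot mu D f g.
Proof.
rewrite /L2dot -RintegralZl//; last exact: L2dotE.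
apply: eq_Rintegral => x _; rewrite !L2valZ.
by case: (f x) => ? ?; rewrite /=; ring.
Qed.

Lemma L2dotDr (f g h : L2space) :
  L2dot mu D h (f + g : L2space) = L2dot mu D h f + L2dot mu D h g.
Proof. by rewrite L2dotC L2dotDl !(L2dotC h). Qed.

Lemma L2dotZr (a : R) (f g : L2space) :
  L2dot mu D g (a%:C%C *: f : L2space) = a * L2dot mu D g f.
Proof. by rewrite L2dotC L2dotZl (L2dotC g). Qed.

Lemma L2_cauchy_schwarz (f g : L2space) : `|L2dot mu D f g| <= L2N f * L2N g.
Proof.
have H t : 0 <= L2N f ^+ 2 + 2 * t * L2dot mu D f g + t ^+ 2 * L2N g ^+ 2.
  have := sqr_ge0 (L2N (f + t%:C%C *: g)); rewrite (sqr_L2N (_ + _)).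
  by rewrite !(L2dotDl, L2dotDr, L2dotZl, L2dotZr) -!sqr_L2N (L2dotC g f); lra.
rewrite -(@ler_pXn2r _ 2) ?nnegrE ?mulr_ge0 ?L2N_ge0// exprMn real_normK ?num_real//.
have [g0|g0] := eqVneq (L2N g ^+ 2) 0.
  set q := L2dot mu D f g in H *; rewrite g0 mulr0 leNgt; apply/negP => q0.
  have q1 : q != 0 by apply: contraTneq q0 => ->; rewrite expr0n ltxx.
  have := H (- (L2N f ^+ 2 + 1) / (2 * q)); rewrite g0 mulr0 addr0.
  have -> : 2 * (- (L2N f ^+ 2 + 1) / (2 * q)) * q = - (L2N f ^+ 2 + 1) by field.
  by lra.
have gp : 0 < L2N g ^+ 2 by rewrite lt0r g0 sqr_ge0.
set q := L2dot mu D f g in H *; set p := L2N g ^+ 2 in H g0 gp *.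
have := H (- q / p).
have -> : L2N f ^+ 2 + 2 * (- q / p) * q + (- q / p) ^+ 2 * p =
  L2N f ^+ 2 - q ^+ 2 / p by field.
by rewrite subr_ge0 ler_pdivrMr.
Qed.

Lemma L2N_D (f g : L2space) : L2N (f + g) <= L2N f + L2N g.
Proof.
rewrite -(@ler_pXn2r _ 2) ?nnegrE ?addr_ge0 ?L2N_ge0//.
rewrite (sqr_L2N (_ + _)) !(L2dotDl, L2dotDr) -!sqr_L2N (L2dotC g f).
have := L2_cauchy_schwarz f g; rewrite ler_norml => /andP[_]; lra.
Qed.

End L2_type.

Section L2_completeness.
Context {R : realType} {dT : measure_display} {T : measurableType dT}.
Variables (mu : {measure set T -> \bar R}) (D : set T) (mD : measurable D).
Local Notation V := (L2space mu mD).

Lemma integral_sqmod (f : V) :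
  (\int[mu]_(x in D) (sqmod (f x))%:E)%E = (L2N f ^+ 2)%:E.
Proof.
have int := L2dotE f f.
rewrite sqr_L2N /L2dot fineK; first by apply: eq_integral => x _.
exact: integrable_fin_num.
Qed.

Lemma weighted_tail_decay (s : nat -> R) (g : R) n : (forall k, 0 <= s k) ->
  weighted_tail s 0 = g%:E -> (weighted_tail s n <= (g / 4 ^+ n)%:E)%E.
Proof.
move=> s0 g0; elim: n => [|n IH]; first by rewrite g0 divr1.
have : (4%:E * weighted_tail s n.+1 <= (g / 4 ^+ n)%:E)%E.
  apply: le_trans IH; rewrite [leRHS]weighted_tailS// leeDr//.
  by rewrite lee_fin mulr_ge0.
rewrite -lee_pdivlMl// -EFinM => /le_trans; apply.
by rewrite lee_fin exprS invfM mulrCA.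
Qed.

Lemma weighted_tail_pinfty (s : nat -> R) n : (forall k, 0 <= s k) ->
  weighted_tail s 0 = +oo%E -> weighted_tail s n = +oo%E.
Proof.
move=> s0 g0; elim: n => // n; rewrite weighted_tailS//.
have := weighted_tail_ge0 n.+1 s0.
by case: (weighted_tail s n.+1) => // r _; rewrite -EFinM -EFinD.
Qed.

Lemma Cmeasurable_funB (f g : T -> R[i]) : Cmeasurable_fun D f ->
  Cmeasurable_fun D g -> Cmeasurable_fun D (fun x => f x - g x).
Proof.
move=> [fr fi] [gr gi]; split.
  rewrite (_ : (fun x => _) = (fun x => complex.Re (f x) - complex.Re (g x))).
    exact: measurable_funB.
  by apply/funext => x; case: (f x) (g x) => [? ?] [].
rewrite (_ : (fun x => _) = (fun x => complex.Im (f x) - complex.Im (g x))).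
  exact: measurable_funB.
by apply/funext => x; case: (f x) (g x) => [? ?] [].
Qed.

(** The limit [w] is pointwise where the weighted tail [G 0] is finite, and 0
    elsewhere. The bound of [sqmod (w x - h n x)] by [4 * G n x] holds
    everywhere, since all the tails are infinite where [G 0] is. *)
Lemma L2_complete (h : nat -> V) (e : nat -> R) :
  (forall n, L2N (h n.+1 - h n) <= e n) -> (forall n, e n.+1 <= e n / 4) ->
  exists f : V, forall n, L2N (f - h n) <= 8 * e n.
Proof.
move=> he e4.
have e0 n : 0 <= e n by apply: le_trans (he n); exact: L2N_ge0.
pose d x n := sqmod (h n.+1 x - h n x : R[i]).
pose G n x := weighted_tail (d x) n.
have d0 x n : 0 <= d x n by exact: sqmod_ge0.
have md n : measurable_fun D (d^~ n).
  apply: (@measurable_sqmod _ _ _ D (fun x => (h n.+1 - h n : V) x)).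
  by have [] := L2spaceP (h n.+1 - h n).
have mG n : measurable_fun D (G n).
  rewrite /G /weighted_tail.
  apply: (@ge0_emeasurable_sum _ _ _ D (fun k x => (4 ^+ k.+1 * d x (n + k)%N)%:E) xpredT).
    by move=> k x _ _; rewrite lee_fin mulr_ge0.
  by move=> k _; apply/measurable_EFinP; exact: measurable_funM.
have eD n k : e (n + k)%N <= e n / 4 ^+ k.
  elim: k => [|k IH]; first by rewrite addn0 divr1.
  rewrite addnS; apply: le_trans (e4 _) _.
  by rewrite exprSr invfM mulrA ler_pM2r.
have IG n : (\int[mu]_(x in D) G n x <= (8 * e n ^+ 2)%:E)%E.
  rewrite /G /weighted_tail integral_nneseries//; last first.
  - by move=> k x _; rewrite lee_fin mulr_ge0.
  - by move=> k; apply/measurable_EFinP; exact: measurable_funM.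
  have tk k : (\int[mu]_(x in D) (4 ^+ k.+1 * d x (n + k)%N)%:E <=
      (4 / 4 ^+ k * e n ^+ 2)%:E)%E.
    under eq_integral do rewrite EFinM.
    rewrite ge0_integralZl//;
      [|exact/measurable_EFinP|by move=> x _; rewrite lee_fin].
    rewrite (integral_sqmod (h (n + k).+1 - h (n + k)%N)) -EFinM lee_fin.
    apply: le_trans (_ : 4 ^+ k.+1 * (e n / 4 ^+ k) ^+ 2 <= _).
      rewrite ler_pM2l ?exprn_gt0// ler_pXn2r ?nnegrE ?L2N_ge0 ?divr_ge0//.
      exact: le_trans (he _) (eD _ _).
    rewrite exprS le_eqVlt; apply/orP; left; apply/eqP; field.
    by rewrite expf_neq0.
  have tS K : (\sum_(0 <= k < K) \int[mu]_(x in D) (4 ^+ k.+1 * d x (n + k)%N)%:E <=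
      ((8 - 8 / 4 ^+ K) * e n ^+ 2)%:E)%E.
    elim: K => [|K IH]; first by rewrite big_nil divr1 subrr mul0r.
    rewrite big_nat_recr//=; apply: le_trans (leeD IH (tk K)) _.
    rewrite -EFinD lee_fin -mulrDl ler_wpM2r ?sqr_ge0//.
    rewrite exprS invfM; have : 0 < (4 ^+ K)^-1 :> R by rewrite invr_gt0 exprn_gt0.
    by lra.
  apply: lime_le.
    apply: is_cvg_nneseries => k _ _; apply: integral_ge0 => x _.
    by rewrite lee_fin mulr_ge0.
  apply: nearW => K; apply: le_trans (tS K) _.
  by rewrite lee_fin ler_wpM2r ?sqr_ge0// gerBl divr_ge0// exprn_ge0.
have lim x : exists z : R[i],
    (forall n, ((sqmod (z - h n x : R[i]))%:E <= 4%:E * G n x)%E) /\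
    (G 0%N x = +oo%E -> z = 0).
  have [Goo|Gfin] := eqVneq (G 0%N x) +oo%E.
    exists 0; split=> // n.
    rewrite /G (weighted_tail_pinfty _ (d0 x) Goo) gt0_muley ?lte_fin//.
    exact: leey.
  have [|z zP] := @weighted_tail_cauchy R (fun n => h n x).
    by rewrite ltey.
  by exists z; split=> // Goo; move: Gfin; rewrite Goo eqxx.
have [w wP] := choice lim.
have mZ : measurable (D `&` [set x | G 0%N x < +oo]%E).
  exact: emeasurable_fun_infty_o.
set Z := D `&` _ in mZ.
(* p is the real or the imaginary part *)
have wcvg (p : R[i] -> R) : p 0 = 0 -> (forall z y, `|p z - p y| <= Normc.normc (z - y)) ->
    (forall n, measurable_fun D (fun x => p (h n x))) ->
    measurable_fun D (fun x => p (w x)).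
  move=> p0 lip mp.
  apply: (@measurable_fun_cvg _ _ _ D (fun n x => p (h n x) * \1_Z x)).
    by move=> n; apply: measurable_funM => //; exact: measurable_indic.
  move=> x Dx; have [Goo|Gfin] := eqVneq (G 0%N x) +oo%E.
    rewrite (wP x).2// p0 indicE memNset; last by rewrite /Z /= Goo ltxx => -[].
    by under eq_fun do rewrite mulr0; exact: cvg_cst.
  rewrite indicE mem_set; last by split=> //=; rewrite ltey.
  under eq_fun do rewrite mulr1.
  have G0 : 0 <= fine (G 0%N x) by rewrite fine_ge0// weighted_tail_ge0.
  have Gf : G 0%N x = (fine (G 0%N x))%:E.
    by rewrite fineK// ge0_fin_numE ?ltey// weighted_tail_ge0.
  pose g := Num.sqrt (fine (G 0%N x)).
  have wh n : `|p (w x) - p (h n x)| <= 2 * g / 2 ^+ n.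
    apply: le_trans (lip _ _) _.
    rewrite -(@ler_pXn2r _ 2) ?nnegrE ?normc_ge0 ?divr_ge0 ?mulr_ge0 ?sqrtr_ge0 ?exprn_ge0//.
    rewrite sqr_normcE expr_div_n exprMn sqr_sqrtr// -exprM mulnC exprM.
    have := (wP x).1 n; have := @weighted_tail_decay _ _ n (d0 x) Gf => H1 H2.
    rewrite -lee_fin; apply: le_trans H2 _.
    apply: le_trans (_ : 4%:E * (fine (G 0%N x) / 4 ^+ n)%:E <= _)%E.
      by rewrite lee_pmul2l ?lte_fin.
    rewrite -EFinM lee_fin mulrA.
    by have -> : 2 ^+ 2 = 4 :> R by rewrite expr2; lra.
  apply/cvgrPdist_le => eps eps0.
  near=> n; apply: le_trans (wh n) _.
  rewrite ler_pdivrMr ?exprn_gt0// [leRHS]mulrC -ler_pdivrMr//.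
  apply: le_trans (_ : n%:R <= _); last by rewrite -natrX ler_nat ltnW// ltn_expl.
  by near: n; exact: nbhs_infty_ger.
have mw : Cmeasurable_fun D w.
  split; apply: wcvg => //.
  - by move=> [a b] [a' b']; exact: (normc_Re (Complex (a - a') (b - b'))).
  - by move=> n; have [[]] := L2spaceP (h n).
  - by move=> [a b] [a' b']; exact: (normc_Im (Complex (a - a') (b - b'))).
  - by move=> n; have [[]] := L2spaceP (h n).
have Iw n : (\int[mu]_(x in D) (sqmod (w x - h n x : R[i]))%:E <=
    (32 * e n ^+ 2)%:E)%E.
  apply: (@le_trans _ _ (\int[mu]_(x in D) (4%:E * G n x))%E).
    apply: ge0_le_integral => //.
    - by move=> x _; rewrite lee_fin sqmod_ge0.
    - apply/measurable_EFinP/measurable_sqmod/Cmeasurable_funB => //.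
      by have [] := L2spaceP (h n).
    - by apply: measurable_funeM.
    - by move=> x _; exact: (wP x).1.
  rewrite ge0_integralZl//; last by move=> x _; exact: weighted_tail_ge0.
  apply: le_trans (lee_wpmul2l _ (IG n)) _ => //.
  by rewrite -EFinM lee_fin mulrA; apply/ler_wpM2r; [exact: sqr_ge0|lra].
have wL : in_L2 mu D w.
  have w0L : in_L2 mu D (fun x => w x - h 0%N x).
    have mw0 : Cmeasurable_fun D (fun x => w x - h 0%N x).
      by apply: Cmeasurable_funB => //; have [] := L2spaceP (h 0%N).
    apply/in_L2P; split=> //; apply/integrableP; split.
      exact/measurable_EFinP/measurable_sqmod.
    under eq_integral do rewrite gee0_abs ?lee_fin ?sqmod_ge0//.
    by apply: le_lt_trans (Iw 0%N) _; rewrite ltry.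
  have := in_L2_lin mD 1 w0L (L2spaceP (h 0%N)).
  by under eq_fun do rewrite mul1r subrK.
exists (toL2 mD wL) => n.
rewrite -(@ler_pXn2r _ 2) ?nnegrE ?L2N_ge0 ?mulr_ge0//.
rewrite -lee_fin -integral_sqmod; apply: le_trans (Iw n) _.
rewrite lee_fin exprMn ler_wpM2r ?sqr_ge0//; lra.
Unshelve. all: by end_near.
Qed.

Let sum_valE (c : nat -> R[i]) (b : nat -> V) n x :
  (\sum_(k < n) c k *: b k : V) x = \sum_(k < n) c k * b k x :> R[i].
Proof.
elim: n => [|n IH]; first by rewrite !big_ord0.
by rewrite !big_ord_recr -IH.
Qed.

Lemma L2N_expansion (c : nat -> R[i]) (b : nat -> V) (f : V) n :
  L2norm mu D (fun x => f x - \sum_(k < n) c k * b k x) =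
  (L2N (f - \sum_(k < n) c k *: b k))%:E.
Proof.
rewrite -L2norm_fin; congr L2norm; apply/funext => x.
by rewrite -sum_valE.
Qed.

Lemma cvg_EFin0P (u : nat -> R) : (forall n, 0 <= u n) ->
  ((u n)%:E @[n --> \oo] --> 0%E) <->
  (forall e, 0 < e -> exists n0, forall n, (n0 <= n)%N -> u n <= e).
Proof.
move=> u0; split.
  move=> /fine_cvgP[_ /cvgrPdist_le H] e /H[N _ HN].
  by exists N => n /HN; rewrite /= sub0r normrN ger0_norm.
move=> H; apply/fine_cvgP; split; first exact: nearW.
apply/cvgrPdist_le => e /H[N HN]; exists N => // n /HN.
by rewrite /= sub0r normrN ger0_norm.
Qed.

Theorem schauder_basis_L2_coef_bounded (b : nat -> T -> R[i]) (beta : R) :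
  schauder_basis_L2 mu D b -> 0 < beta ->
  (forall k, (beta%:E <= L2norm mu D (b k))%E) ->
  exists2 M : R, 0 < M & forall (f : V) (c : nat -> R[i]),
    (L2norm mu D (fun x => f x - \sum_(k < n) c k * b k x) @[n --> \oo] --> 0%E) ->
    forall rho, 0 < rho -> L2N f <= rho ->
    forall k, Normc.normc (c k) <= M * rho.
Proof.
move=> [bL basis] beta0 blb.
pose B k : V := toL2 mD (bL k).
have conv (f : V) (c : nat -> R[i]) :
    (L2norm mu D (fun x => f x - \sum_(k < n) c k * b k x) @[n --> \oo] --> 0%E) <->
    (forall e, 0 < e -> exists n0, forall n, (n0 <= n)%N ->
      L2N (f - \sum_(k < n) c k *: B k) <= e).
  rewrite -cvg_EFin0P; last by move=> n; exact: L2N_ge0.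
  rewrite (_ : (fun n => L2norm _ _ _) =
    (fun n => (L2N (f - \sum_(k < n) c k *: B k))%:E))//.
  by apply/funext => n; rewrite (L2N_expansion c B).
have [|f|M M0 HM] := schauder_coef_bounded (@L2N_ge0 _ _ _ mu D mD)
    (@L2N_D _ _ _ mu D mD) (@L2N_Z _ _ _ mu D mD) L2_complete (b := B) beta0.
- by move=> k; rewrite -lee_fin -L2norm_fin; exact: blb.
- have [c [cP cU]] := basis f (L2spaceP f); exists c.
  by split; [exact/conv|move=> c' /conv; exact: cU].
- by exists M => // f c /conv; exact: HM.
Qed.

End L2_completeness.

(** * The Bessel equation *)

Section cosine_transforms.
Context {R : realType}.
Local Notation mu := (@lebesgue_measure R).
Implicit Types (k : R -> R) (x s : R).

Lemma continuous_mul (f g : R -> R) : continuous f -> continuous g ->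
  continuous (fun s => f s * g s).
Proof. by move=> cf cg s; apply: continuousM; [exact: cf|exact: cg]. Qed.

Lemma is_derive_cosM x s : is_derive x 1 (fun t => cos (t * s)) (- sin (x * s) * s).
Proof.
have H : is_derive x 1 (fun t : R => t * s) s.
  by apply: is_derive_eq; rewrite scaler0 add0r /GRing.scale /= mulr1.
have := @is_derive1_comp _ cos (fun t => t * s) x _ _ (is_derive_cos _) H.
by [].
Qed.

Lemma is_derive_sinM x s : is_derive x 1 (fun t => sin (t * s)) (cos (x * s) * s).
Proof.
have H : is_derive x 1 (fun t : R => t * s) s.
  by apply: is_derive_eq; rewrite scaler0 add0r /GRing.scale /= mulr1.
have := @is_derive1_comp _ sin (fun t => t * s) x _ _ (is_derive_sin _) H.
by [].
Qed.

Lemma continuous_cosM x : continuous (fun s => cos (x * s)).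
Proof.
move=> s; apply: (@continuous_comp _ _ _ (fun s => x * s) cos).
  exact: mulrl_continuous.
exact: continuous_cos.
Qed.

Lemma continuous_sinM x : continuous (fun s => sin (x * s)).
Proof.
move=> s; apply: (@continuous_comp _ _ _ (fun s => x * s) sin).
  exact: mulrl_continuous.
exact: continuous_sin.
Qed.

Lemma continuous_integrable_itv a b k : continuous k ->
  mu.-integrable `[a, b] (EFin \o k).
Proof.
move=> ck; apply: continuous_compact_integrable; first exact: segment_compact.
exact: continuous_subspaceT.
Qed.

Lemma is_derive_under_integral (f df : R -> R -> R) (G : R -> R) a b x :
  (forall x, continuous (f x)) ->
  (forall x s, is_derive x 1 (f ^~ s) (df x s)) ->
  continuous G -> (forall x s, `|df x s| <= G s) ->
  is_derive x 1 (fun x => \int[mu]_(s in `[a, b]) f x s)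
    (\int[mu]_(s in `[a, b]) df x s).
Proof.
move=> cf dfE cG dfG.
have pE y s : partial1of2 f y s = df y s.
  by rewrite partial1of2E; apply: derive_val.
have xI : `]x - 1, x + 1[%classic x by rewrite /= in_itv /=; apply/andP; split; lra.
have intf y : `]x - 1, x + 1[%classic y -> mu.-integrable `[a, b] (EFin \o f y).
  by move=> _; exact: continuous_integrable_itv.
have der y s : `]x - 1, x + 1[%classic y -> `[a, b]%classic s -> derivable (f ^~ s) y 1.
  by move=> _ _; exact: (@ex_derive _ _ _ _ _ _ _ (dfE y s)).
have G0 s : 0 <= G s by apply: le_trans (dfG 0 s).
have intG : mu.-integrable `[a, b] (EFin \o G) by exact: continuous_integrable_itv.
have Gub y s : `]x - 1, x + 1[%classic y -> `[a, b]%classic s ->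
   `|partial1of2 f y s| <= G s by move=> _ _; rewrite pE.
have mab : measurable (`[a, b]%classic : set R) by [].
apply: DeriveDef.
  exact: (@derivable_under_integral _ _ _ mu f _ mab x _ _ xI intf der G G0 intG Gub).
rewrite -derive1E.
rewrite (@differentiation_under_integral _ _ _ mu f _ mab x _ _ xI intf der G G0 intG Gub).
by apply: eq_Rintegral => s _; rewrite pE.
Qed.

Lemma is_derive_cos_transform k x : continuous k ->
  is_derive x 1 (fun x => \int[mu]_(s in `[-1, 1]) (cos (x * s) * k s))
    (- \int[mu]_(s in `[-1, 1]) (sin (x * s) * (s * k s))).
Proof.
move=> ck.
have cs : continuous (fun s : R => s * k s).
  by apply: continuous_mul => // s; exact: cvg_id.
have -> : - (\int[mu]_(s in `[-1, 1]) (sin (x * s) * (s * k s))) =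
    \int[mu]_(s in `[-1, 1]) (- sin (x * s) * s * k s).
  rewrite -[LHS]mulN1r -RintegralZl//; last first.
    apply: (@continuous_integrable_itv _ _ (fun s => sin (x * s) * (s * k s))).
    by apply: continuous_mul; [exact: continuous_sinM|exact: cs].
  by apply: eq_Rintegral => s _; ring.
apply: (@is_derive_under_integral (fun x s => cos (x * s) * k s)
  (fun x s => - sin (x * s) * s * k s) (fun s => `|s * k s|)).
- by move=> y s; apply: continuousM; [exact: continuous_cosM|exact: ck].
- move=> y s; have H := is_derive_cosM y s.
  by apply: is_derive_eq; rewrite scaler0 add0r /GRing.scale /= mulrC.
- by move=> s; apply: (@continuous_comp _ _ _ (fun s => s * k s) Num.norm);
    [exact: cs|exact: norm_continuous].
- move=> y s; rewrite -mulrA normrM normrN -[leRHS]mul1r ler_wpM2r//.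
  by rewrite ler_norml sin_geN1 sin_le1.
Qed.

Lemma is_derive_sin_transform k x : continuous k ->
  is_derive x 1 (fun x => \int[mu]_(s in `[-1, 1]) (sin (x * s) * k s))
    (\int[mu]_(s in `[-1, 1]) (cos (x * s) * (s * k s))).
Proof.
move=> ck.
have cs : continuous (fun s : R => s * k s).
  by apply: continuous_mul => // s; exact: cvg_id.
have -> : (\int[mu]_(s in `[-1, 1]) (cos (x * s) * (s * k s))) =
    \int[mu]_(s in `[-1, 1]) (cos (x * s) * s * k s).
  by apply: eq_Rintegral => s _; ring.
apply: (@is_derive_under_integral (fun x s => sin (x * s) * k s)
  (fun x s => cos (x * s) * s * k s) (fun s => `|s * k s|)).
- by move=> y s; apply: continuousM; [exact: continuous_sinM|exact: ck].
- move=> y s; have H := is_derive_sinM y s.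
  by apply: is_derive_eq; rewrite scaler0 add0r /GRing.scale /= mulrC.
- by move=> s; apply: (@continuous_comp _ _ _ (fun s => s * k s) Num.norm);
    [exact: cs|exact: norm_continuous].
- move=> y s; rewrite -mulrA normrM -[leRHS]mul1r ler_wpM2r//.
  by rewrite ler_norml cos_geN1 cos_le1.
Qed.

End cosine_transforms.

Section bessel_equation.
Context {R : realType}.
Local Notation mu := (@lebesgue_measure R).

(** The density of the projection of the unit ball of dimension [m.+1] on an
    axis, up to a constant. *)
Definition slice m (s : R) : R := Num.sqrt (1 - s ^+ 2) ^+ m.

Lemma continuous_slice m : continuous (slice m).
Proof.
have c1 : continuous (fun s : R => 1 - s ^+ 2).
  move=> s; apply: cvgB; first exact: cvg_cst.
  exact: exprn_continuous.
have c2 : continuous (Num.sqrt \o (fun s : R => 1 - s ^+ 2)).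
  by move=> s; apply: continuous_comp; [exact: c1|exact: sqrt_continuous].
rewrite (_ : slice m = (fun u : R => u ^+ m) \o (Num.sqrt \o (fun s : R => 1 - s ^+ 2)))//.
by move=> s; apply: continuous_comp; [exact: c2|exact: exprn_continuous].
Qed.

(** By Poisson's integral this is, up to a constant factor, [J_nu x / x ^ nu]
    where [nu = (m + 1) / 2]. *)
Definition bessel m (x : R) : R := \int[mu]_(s in `[-1, 1]) (cos (x * s) * slice m s).
Definition bessel' m (x : R) : R :=
  - \int[mu]_(s in `[-1, 1]) (sin (x * s) * (s * slice m s)).
Definition bessel'' m (x : R) : R :=
  - \int[mu]_(s in `[-1, 1]) (cos (x * s) * (s * (s * slice m s))).

Lemma is_derive_bessel (m : nat) (x : R) : is_derive x 1 (bessel m) (bessel' m x).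
Proof. exact/is_derive_cos_transform/continuous_slice. Qed.

Lemma is_derive_bessel' (m : nat) (x : R) : is_derive x 1 (bessel' m) (bessel'' m x).
Proof.
rewrite /bessel'; apply: (@is_deriveN _ _ _ _ x 1).
apply: (@is_derive_sin_transform _ (fun s => s * slice m s)).
by move=> s; apply: continuousM; [exact: cvg_id|exact: continuous_slice].
Qed.

Lemma is_derive_slice (m : nat) (s : R) : s \in `]-1, 1[ ->
  is_derive s 1 (slice m.+2) (- (m.+2%:R * s * slice m s)).
Proof.
rewrite in_itv /= => /andP[s1 s2].
have p0 : 0 < 1 - s ^+ 2 by nra.
have H1 : is_derive s 1 (fun s : R => 1 - s ^+ 2) (- (2 * s)).
  by apply: is_derive_eq; rewrite /GRing.scale /=; ring.
have H2 := @is_derive1_comp _ Num.sqrt (fun s : R => 1 - s ^+ 2) s _ _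
  (is_derive1_sqrt p0) H1.
have q0 : 0 < Num.sqrt (1 - s ^+ 2) by rewrite sqrtr_gt0.
have H3 (y : R) : is_derive y 1 (fun u : R => u ^+ m.+2) (m.+2%:R * y ^+ m.+1).
  by apply: DeriveDef; [exact: exprn_derivable|rewrite exp_derive /GRing.scale /= mulr1].
have H4 := @is_derive1_comp _ (fun u : R => u ^+ m.+2) _ s _ _ (H3 _) H2.
apply: (@is_derive_eq _ _ _ (slice m.+2) s 1 _ _ H4).
by rewrite /= /slice exprS; field; rewrite gt_eqF.
Qed.

(** The derivative of [sin (x s) (1 - s^2)^(m/2 + 1)] has integral 0 over
    [[-1, 1]], as this function of [s] vanishes at both ends. *)
Lemma bessel_ode m x : x * bessel'' m x + m.+2%:R * bessel' m x + x * bessel m x = 0.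
Proof.
pose f (s : R) := x * (cos (x * s) * slice m.+2 s) -
  m.+2%:R * (sin (x * s) * (s * slice m s)).
pose F (s : R) := sin (x * s) * slice m.+2 s.
have cslice := @continuous_slice.
have cc := @continuous_cosM R x; have cs := @continuous_sinM R x.
have cid : continuous (fun s : R => s) by move=> s; exact: cvg_id.
have ccst (a : R) : continuous (fun s : R => a) by move=> s; exact: cvg_cst.
have c1 : continuous (fun s => cos (x * s) * slice m.+2 s) by exact: continuous_mul.
have c2 : continuous (fun s => sin (x * s) * (s * slice m s)).
  exact: (continuous_mul cs (continuous_mul cid (cslice m))).
have cf : continuous f.
  by move=> s; apply: cvgB; [exact: (continuous_mul (ccst x) c1)|
    exact: (continuous_mul (ccst m.+2%:R) c2)].
have cF : continuous F by exact: continuous_mul.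
have F1 : F 1 = 0 by rewrite /F /slice expr1n subrr sqrtr0 expr0n mulr0.
have FN1 : F (-1) = 0 by rewrite /F /slice sqrrN expr1n subrr sqrtr0 expr0n mulr0.
have dF (s : R) : s \in `]-1, 1[ -> is_derive s 1 F (f s).
  move=> s1; have H1 := is_derive_slice m s1.
  have H2 : is_derive s 1 (fun s => sin (x * s)) (cos (x * s) * x).
    by under eq_fun do rewrite mulrC; rewrite [x * s]mulrC; exact: is_derive_sinM.
  by apply: is_derive_eq; rewrite /f /GRing.scale /=; ring.
have := @continuous_FTC2 R f F (-1) 1.
rewrite F1 FN1 sube0 => H.
have {H} : (\int[mu]_(s in `[-1, 1]) f s = 0)%R.
  rewrite /Rintegral H//.
  - exact: continuous_subspaceT.
  - split; first by move=> s /dF [].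
    exact/cvg_at_right_filter/cF. exact/cvg_at_left_filter/cF.
  - by move=> s /dF ds; rewrite derive1E; apply: derive_val.
rewrite /f RintegralB//; [|exact: (continuous_integrable_itv _ _ (continuous_mul (ccst _) c1))
  |exact: (continuous_integrable_itv _ _ (continuous_mul (ccst _) c2))].
rewrite !RintegralZl//; [|exact: continuous_integrable_itv..].
have -> : (\int[mu]_(s in `[-1, 1]) (cos (x * s) * slice m.+2 s) =
    bessel m x + bessel'' m x)%R.
  rewrite /bessel /bessel'' -RintegralB//.
  - apply: eq_Rintegral => s; rewrite inE /= in_itv /= => /andP[s1 s2].
    rewrite /slice !exprS mulrA -expr2 sqr_sqrtr; [ring|nra].
  - by apply: continuous_integrable_itv; exact: continuous_mul.
  - apply: continuous_integrable_itv; apply: (continuous_mul cc).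
    exact: (continuous_mul cid (continuous_mul cid (cslice m))).
by rewrite /bessel' => H; rewrite -[RHS]H; ring.
Qed.

End bessel_equation.

(** * Zeros of solutions of a perturbed wave equation *)

Section perturbed_wave_equation.
Context {R : realType}.

Lemma ler_norm_mean_value (f df : R -> R) (X M a b : R) :
  (forall t, X <= t -> is_derive t 1 f (df t)) ->
  (forall t, X <= t -> `|df t| <= M) ->
  X <= a -> X <= b -> `|f a - f b| <= M * `|a - b|.
Proof.
move=> fdf dfM; wlog ab : a b / a <= b => [H Xa Xb|Xa Xb].
  have [|/ltW] := leP a b => ab; first exact: H.
  by rewrite distrC (distrC a); exact: H.
have [||c cab] := @MVT_segment R f df a b ab.
- by move=> t; rewrite in_itv /= => /andP[at_ _]; apply: fdf; lra.
- apply: derivable_within_continuous => s; rewrite in_itv /= => /andP[as_ _].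
  by apply: (@ex_derive _ _ _ _ _ _ _ (fdf s _)); lra.
rewrite distrC => ->; rewrite normrM (distrC a) ler_wpM2r// dfM//.
by move: cab; rewrite in_itv /= => /andP[]; lra.
Qed.

Lemma ler_dist_cos (a b : R) : `|cos a - cos b| <= `|a - b|.
Proof.
rewrite -[leRHS]mul1r.
apply: (@ler_norm_mean_value cos (fun t => - sin t) (Num.min a b)) => [t _||].
- by rewrite normrN ler_norml sin_geN1 sin_le1.
- by rewrite ge_min lexx.
- by rewrite ge_min lexx orbT.
Qed.

Lemma ler_dist_sin (a b : R) : `|sin a - sin b| <= `|a - b|.
Proof.
rewrite -[leRHS]mul1r.
apply: (@ler_norm_mean_value sin cos (Num.min a b)) => [t _||].
- by rewrite ler_norml cos_geN1 cos_le1.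
- by rewrite ge_min lexx.
- by rewrite ge_min lexx orbT.
Qed.

Variables (h h' : R -> R) (k : R).
Hypothesis dh : forall x : R, 0 < x -> is_derive x 1 h (h' x).
Hypothesis dh' : forall x : R, 0 < x -> is_derive x 1 h' (- (1 - k / x ^+ 2) * h x).
Hypothesis h1 : h 1 != 0.

Let E x := h x ^+ 2 + h' x ^+ 2.
Let K : R := `|k|.

Let K0 : 0 <= K. Proof. exact: normr_ge0. Qed.

Let dE (x : R) : 0 < x -> is_derive x 1 E (2 * k / x ^+ 2 * (h x * h' x)).
Proof.
move=> x0; have H1 := dh x0; have H2 := dh' x0.
apply: is_derive_eq; rewrite /GRing.scale /=.
by field; rewrite gt_eqF.
Qed.

Let dE_bound (x : R) : 0 < x -> `|2 * k / x ^+ 2 * (h x * h' x)| <= K / x ^+ 2 * E x.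
Proof.
move=> x0; rewrite !normrM (ger0_norm (_ : 0 <= (2 : R)))// normfV.
rewrite (ger0_norm (sqr_ge0 x)) -/K.
have -> : 2 * K / x ^+ 2 * (`|h x| * `|h' x|) = K / x ^+ 2 * (2 * (`|h x| * `|h' x|)).
  by ring.
rewrite ler_wpM2l ?divr_ge0 ?sqr_ge0 ?normr_ge0// /E -(real_normK (num_real (h x))).
rewrite -(real_normK (num_real (h' x))).
have := sqr_ge0 (`|h x| - `|h' x|); lra.
Qed.

Let dexp (a x : R) : 0 < x ->
  is_derive x 1 (fun x => expR (a / x)) (- (a / x ^+ 2) * expR (a / x)).
Proof.
move=> x0; have x0' : x != 0 by rewrite gt_eqF.
have H1 : is_derive x 1 (fun x => a / x) (- (a / x ^+ 2)).
  have H : is_derive x 1 (fun y : R => y^-1) (- x ^- 2 *: 1).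
    by have := @is_deriveV R id x 1 1 x0' (is_derive_id _ _).
  by apply: is_derive_eq; rewrite /GRing.scale /=; field.
have H2 := @is_derive1_comp _ expR (fun x => a / x) x _ _ (is_derive_expR _) H1.
by rewrite mulrC.
Qed.

(** The derivative of [E] is at most [K E / x^2] in absolute value, so that
    [E x * exp (- K / x)] is nondecreasing and [E x * exp (K / x)] is
    nonincreasing. *)
Lemma wave_energy_bounds : exists c C : R, 0 < c /\
  forall x, 1 <= x -> c <= E x <= C.
Proof.
exists (E 1 * expR (- K)), (E 1 * expR K).
have E1 : 0 < E 1.
  by rewrite /E; apply: ltr_pwDl; [rewrite exprn_even_gt0|exact: sqr_ge0].
split; first by rewrite mulr_gt0// expR_gt0.
move=> x x1.
have E0 : 0 <= E x by rewrite addr_ge0 ?sqr_ge0.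
have dG (a t : R) : 0 < t -> is_derive t 1 (fun t => E t * expR (a / t))
   ((2 * k / t ^+ 2 * (h t * h' t) - a / t ^+ 2 * E t) * expR (a / t)).
  move=> t0; have H1 := dE t0; have H2 := dexp a t0.
  by apply: is_derive_eq; rewrite /GRing.scale /=; ring.
have tpos (t : R) : t \in `]1, x[ -> 0 < t by rewrite in_itv /= => /andP[]; lra.
have tpos' (t : R) : t \in `[1, x] -> 0 < t by rewrite in_itv /= => /andP[]; lra.
have ctn (a : R) : {within `[1, x], continuous (fun t => E t * expR (a / t))}.
  apply: derivable_within_continuous => t /tpos' t0.
  exact: (@ex_derive _ _ _ _ _ _ _ (dG a t t0)).
apply/andP; split.
  apply: le_trans (_ : E x * expR (- K / x) <= _); last first.
    rewrite ler_piMr// -expR0 ler_expR mulNr oppr_le0 divr_ge0//; lra.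
  rewrite -[X in expR X]divr1.
  apply: (@ger0_derive1_ndecr _ (fun t => E t * expR (- K / t)) 1 x) => // t /tpos t0.
    exact: (@ex_derive _ _ _ _ _ _ _ (dG _ t t0)).
  rewrite derive1E (@derive_val _ _ _ _ _ _ _ (dG _ t t0)).
  rewrite mulr_ge0 ?expR_ge0//; have := dE_bound t0.
  by rewrite ler_norml mulNr => /andP[]; lra.
apply: le_trans (_ : E x * expR (K / x) <= _).
  by rewrite ler_peMr// -expR0 ler_expR divr_ge0//; lra.
rewrite -[X in _ <= _ * expR X]divr1.
apply: (@ler0_derive1_nincr _ (fun t => E t * expR (K / t)) 1 x) => // t /tpos t0.
  exact: (@ex_derive _ _ _ _ _ _ _ (dG _ t t0)).
rewrite derive1E (@derive_val _ _ _ _ _ _ _ (dG _ t t0)).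
rewrite mulr_le0_ge0// ?expR_ge0//; have := dE_bound t0.
by rewrite ler_norml => /andP[]; lra.
Qed.

(** The function [Q t = h t cos (x - t) + h' t sin (x - t)] would be constant
    without the perturbation [k / x^2]; its derivative is [O(1 / t^2)]. As
    [Q x = h x], the smallness of [h x] and [h y] makes [h' y sin (x - y)] small,
    whereas [h' y] is bounded from below by [wave_energy_bounds]. *)
Lemma wave_phase_rigidity (eta L : R) : 0 < eta -> exists eps X : R,
  [/\ 0 < eps, 1 <= X & forall x y, X <= x -> X <= y -> `|x - y| <= L ->
      `|h x| <= eps -> `|h y| <= eps -> `|sin (x - y)| <= eta].
Proof.
move=> eta0; have [c [C [c0 cEC]]] := wave_energy_bounds.
pose c1 := Num.sqrt (c / 2); have c10 : 0 < c1 by rewrite sqrtr_gt0; lra.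
have c1E : c1 ^+ 2 = c / 2 by rewrite sqr_sqrtr//; lra.
have C0 : 0 < C by have /andP[] := cEC 1 (lexx _); lra.
have hC (x : R) : 1 <= x -> `|h x| <= 1 + C.
  move=> /cEC/andP[_]; rewrite /E -(real_normK (num_real (h x))).
  by have := sqr_ge0 (h' x); have := sqr_ge0 (`|h x| - 1); nra.
pose A := K * (1 + C) * (`|L| + 1).
have A0 : 0 <= A by rewrite /A !mulr_ge0 ?addr_ge0// ltW.
exists (Num.min c1 (eta * c1 / 4)), (Num.max 1 (2 * A / (eta * c1))).
have ec0 : 0 < eta * c1 by rewrite mulr_gt0.
split.
- by rewrite lt_min c10 divr_gt0.
- by rewrite le_max lexx.
move=> x y; rewrite !ge_max !le_min => /andP[x1 xA] /andP[y1 yA] xyL.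
move=> /andP[_ hx] /andP[hy1 hy].
pose X := Num.min x y.
have X1 : 1 <= X by rewrite le_min x1 y1.
have XA : A / X ^+ 2 <= eta * c1 / 2.
  have : 2 * A / (eta * c1) <= X by rewrite le_min xA yA.
  rewrite !ler_pdivrMr//; last by nra.
  by nra.
pose Q (t : R) := h t * cos (x - t) + h' t * sin (x - t).
have dQ (t : R) : X <= t -> is_derive t 1 Q (k / t ^+ 2 * (h t * sin (x - t))).
  move=> Xt; have t0 : 0 < t by lra.
  have H1 := dh t0; have H2 := dh' t0.
  have H3 : is_derive t 1 (fun t : R => x - t) (-1).
    by apply: is_derive_eq; rewrite /GRing.scale /=; ring.
  have H4 : is_derive t 1 (fun t => cos (x - t)) (- sin (x - t) * -1) :=
    @is_derive1_comp _ cos (fun t => x - t) t _ _ (is_derive_cos _) H3.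
  have H5 : is_derive t 1 (fun t => sin (x - t)) (cos (x - t) * -1) :=
    @is_derive1_comp _ sin (fun t => x - t) t _ _ (is_derive_sin _) H3.
  apply: is_derive_eq; rewrite /GRing.scale /=.
  by field; rewrite gt_eqF.
have dQb (t : R) : X <= t -> `|k / t ^+ 2 * (h t * sin (x - t))| <= K * (1 + C) / X ^+ 2.
  move=> Xt; rewrite normrM normrM normfV -/K (ger0_norm (sqr_ge0 t)).
  apply: le_trans (_ : K / t ^+ 2 * (1 + C) <= _).
    rewrite ler_wpM2l ?divr_ge0 ?sqr_ge0// normrM -[leRHS]mulr1.
    by rewrite ler_pM// ?hC//; [lra|rewrite ler_norml sin_geN1 sin_le1].
  rewrite mulrAC ler_wpM2l// ?mulr_ge0//; first lra.
  by rewrite lef_pV2 ?posrE ?exprn_gt0//; [|lra..]; nra.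
have Xx : X <= x by rewrite ge_min lexx.
have Xy : X <= y by rewrite ge_min lexx orbT.
have := ler_norm_mean_value dQ dQb Xx Xy.
rewrite {1 2}/Q subrr cos0 sin0 mulr1 mulr0 addr0 => Qxy.
have {Qxy} Qxy : `|h x - (h y * cos (x - y) + h' y * sin (x - y))| <= eta * c1 / 2.
  apply: le_trans Qxy _; apply: le_trans XA.
  rewrite mulrAC /A ler_wpM2r ?invr_ge0 ?sqr_ge0//.
  rewrite ler_wpM2l ?mulr_ge0//; first lra.
  by have := ler_norm L; lra.
have h'y : c1 <= `|h' y|.
  have : c1 ^+ 2 <= `|h' y| ^+ 2.
    have /andP[+ _] := cEC y y1; rewrite /E -(real_normK (num_real (h y))).
    rewrite -(real_normK (num_real (h' y))) c1E.
    by have := normr_ge0 (h y); nra.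
  by rewrite ler_pXn2r// nnegrE// ltW.
have : `|h' y * sin (x - y)| <= eta * c1.
  have -> : h' y * sin (x - y) = h x - h y * cos (x - y) -
    (h x - (h y * cos (x - y) + h' y * sin (x - y))) by ring.
  apply: le_trans (ler_normB _ _) _.
  have : `|h x - h y * cos (x - y)| <= eta * c1 / 4 + eta * c1 / 4.
    apply: le_trans (ler_normB _ _) _; rewrite lerD//.
    rewrite normrM -[leRHS]mulr1 ler_pM//.
    by rewrite ler_norml cos_geN1 cos_le1.
  lra.
rewrite normrM => H; rewrite -(ler_pM2l c10) [leRHS]mulrC.
by apply: le_trans H; rewrite ler_wpM2r.
Qed.

End perturbed_wave_equation.

Section bessel_phase.
Context {R : realType}.
Variable m : nat.
Let p : R := m.+2%:R / 2.

(** This excludes that [bessel m] is the zero solution of its equation. *)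
Lemma bessel1_gt0 : 0 < bessel m (1 : R).
Proof.
have c_ge (s : R) : 1 - `|s| <= cos s.
  have := ler_dist_cos 0 s; rewrite cos0 sub0r normrN.
  by rewrite ler_norml => /andP[]; lra.
pose c : R := 1 / 2 * Num.sqrt (3 / 4) ^+ m.
have c0 : 0 < c by rewrite mulr_gt0// exprn_gt0// sqrtr_gt0; lra.
pose f s : R := cos (1 * s) * slice m s.
have f0 (s : R) : `[-1, 1]%classic s -> 0 <= f s.
  rewrite /= in_itv /= => s1; rewrite mulr_ge0// ?exprn_ge0// ?sqrtr_ge0//.
  rewrite mul1r; apply: le_trans (c_ge s); rewrite subr_ge0.
  by rewrite ler_norml.
have cf (s : R) : `[-1/2, 1/2]%classic s -> c <= f s.
  rewrite /= in_itv /= => s1.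
  have s2 : `|s| <= 1/2 by rewrite ler_norml; move: s1; lra.
  rewrite /f /c [1 * s]mul1r; apply: ler_pM.
  - by lra.
  - by rewrite exprn_ge0// sqrtr_ge0.
  - by apply: le_trans (c_ge s); lra.
  - by rewrite /slice lerXn2r// ?nnegrE ?sqrtr_ge0// ler_wsqrtr//; nra.
have sub : (`[-1/2, 1/2] `<=` `[-1, 1 : R])%classic.
  by move=> s /=; rewrite !in_itv /= => /andP[? ?]; apply/andP; split; lra.
have intf : (@lebesgue_measure R).-integrable `[-1, 1] (EFin \o f).
  apply/continuous_integrable_itv/continuous_mul; first exact: continuous_cosM.
  exact: continuous_slice.
have mf := measurable_int _ intf.
have fin : (\int[@lebesgue_measure R]_(s in `[(-1)%R, 1%R]) (f s)%:E)%E \is a fin_num.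
  exact: integrable_fin_num.
rewrite /bessel /Rintegral -lte_fin fineK//.
apply: (@lt_le_trans _ _ c%:E); first by rewrite lte_fin.
apply: (@le_trans _ _ (\int[@lebesgue_measure R]_(s in `[(-1/2)%R, (1/2)%R]) (f s)%:E)%E).
  have -> : c%:E = (\int[@lebesgue_measure R]_(s in `[(-1/2)%R, (1/2)%R]) c%:E)%E.
    rewrite integral_cst// [X in (_ * X)%E]lebesgue_measure_itv /= lte_fin ifT; last by lra.
    rewrite -EFinD -EFinM; congr EFin; lra.
  apply: ge0_le_integral => //.
  - by move=> s _; rewrite lee_fin ltW.
  - exact: measurable_funS mf.
exact: ge0_subset_integral.
Qed.

(** The factor [x ^ p] eliminates the term of order one of [bessel_ode]. *)
Lemma bessel_phase_rigidity (eta L : R) : 0 < eta -> exists eps X : R,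
  [/\ 0 < eps, 1 <= X & forall x y, X <= x -> X <= y -> `|x - y| <= L ->
      `|x `^ p * bessel m x| <= eps -> `|y `^ p * bessel m y| <= eps ->
      `|sin (x - y)| <= eta].
Proof.
pose h (x : R) := x `^ p * bessel m x.
pose h' (x : R) := p * x `^ (p - 1) * bessel m x + x `^ p * bessel' m x.
pose k := p * (p - 1).
have dh (x : R) : 0 < x -> is_derive x 1 h (h' x).
  move=> x0; have H1 := is_derive1_powR p x0; have H2 := is_derive_bessel m x.
  by apply: is_derive_eq; rewrite /h' /GRing.scale /=; ring.
have dh' (x : R) : 0 < x -> is_derive x 1 h' (- (1 - k / x ^+ 2) * h x).
  move=> x0; have H1 := is_derive1_powR p x0; have H2 := is_derive_bessel m x.
  have H3 := is_derive_bessel' m x; have H4 := is_derive1_powR (p - 1) x0.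
  apply: is_derive_eq; rewrite /h /k /GRing.scale /=.
  have x0' : x != 0 by rewrite gt_eqF.
  have E1 : x `^ (p - 1) = x `^ p / x.
    by rewrite powRD ?x0' ?implybT// powR_inv1 ?ltW.
  have E2 : x `^ (p - 1 - 1) = x `^ p / x ^+ 2.
    by rewrite powRD ?x0' ?implybT// powR_inv1 ?ltW// E1; field.
  have -> : bessel'' m x = - (2 * p / x) * bessel' m x - bessel m x.
    have := bessel_ode m x => ode.
    apply: (mulfI x0').
    have -> : x * (- (2 * p / x) * bessel' m x - bessel m x) =
      - (2 * p) * bessel' m x - x * bessel m x by field.
    have p2 : 2 * p = m.+2%:R by rewrite /p; field.
    by rewrite p2; apply/eqP; rewrite -subr_eq0 -[X in _ == X]ode; apply/eqP; ring.
  by rewrite E1 E2; field.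
apply: (wave_phase_rigidity dh dh').
by rewrite /h powR1 mul1r gt_eqF// bessel1_gt0.
Qed.

End bessel_phase.

(** * Invariance properties of the Lebesgue measure *)

Section translation_invariance.
Context {R : realType}.
Local Open Scope ereal_scope.

Definition image_measure {d1 d2} {S : measurableType d1} {T : measurableType d2}
    (mu : {measure set S -> \bar R}) (f : S -> T)
    (mf : measurable_fun [set: S] f) : {measure set T -> \bar R} :=
  measure_function_pushforward__canonical__measure_function_Measure mu mf.

Lemma measurable_coordT n (i : 'I_n) :
  measurable_fun [set: 'rV[R]_n] (fun x : 'rV[R]_n => x ord0 i).
Proof. exact: measurable_coord. Qed.

Lemma measurable_rV_fun d0 (S : measurableType d0) n (f : S -> 'rV[R]_n) :
  (forall j, measurable_fun [set: S] (fun s => f s ord0 j)) ->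
  measurable_fun [set: S] f.
Proof. by move=> mf; apply: measurable_fun_mxP => i j; rewrite (ord1 i). Qed.

Lemma measurable_preimage d1 d2 (S : measurableType d1) (T : measurableType d2)
    (f : S -> T) (A : set T) :
  measurable_fun [set: S] f -> measurable A -> measurable (f @^-1` A).
Proof. by move=> mf mA; rewrite -[X in measurable X]setTI; exact: mf. Qed.

Definition translation_invariant n (mu : set 'rV[R]_n -> \bar R) :=
  forall (v : 'rV[R]_n) (A : set 'rV[R]_n), measurable A ->
    mu ((fun x => v + x)%R @^-1` A) = mu A.

(** For fixed [y] the section of [S1] is a translate of [E] if [y] is in [B] and
    empty otherwise, so that [S1] has measure [mu E * nu B]; likewise for [S2]
    and [mu B * nu E], by the symmetry of [B]. For fixed [x] the sections of [S1]
    and [S2] are translates of each other. *)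
Lemma translation_invariant_unique n
    (mu nu : {sigma_finite_measure set 'rV[R]_n -> \bar R}) (B E : set 'rV[R]_n) :
  translation_invariant mu -> translation_invariant nu ->
  measurable B -> (forall x, B x -> B (- x)%R) -> measurable E ->
  mu E * nu B = mu B * nu E.
Proof.
move=> muT nuT mB symB mE.
pose S1 := [set p : 'rV[R]_n * 'rV[R]_n | B p.2 /\ E (p.1 + p.2)%R].
pose S2 := [set p : 'rV[R]_n * 'rV[R]_n | E p.2 /\ B (p.2 - p.1)%R].
have mfst j : measurable_fun setT (fun p : 'rV[R]_n * 'rV[R]_n => p.1 ord0 j).
  exact: (measurableT_comp (measurable_coordT j) measurable_fst).
have msnd j : measurable_fun setT (fun p : 'rV[R]_n * 'rV[R]_n => p.2 ord0 j).
  exact: (measurableT_comp (measurable_coordT j) measurable_snd).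
have mD : measurable_fun setT (fun p : 'rV[R]_n * 'rV[R]_n => (p.1 + p.2)%R).
  apply: measurable_rV_fun => j; under eq_fun do rewrite mxE.
  exact: measurable_funD.
have mBf : measurable_fun setT (fun p : 'rV[R]_n * 'rV[R]_n => (p.2 - p.1)%R).
  apply: measurable_rV_fun => j; under eq_fun do rewrite !mxE.
  exact: measurable_funB.
have mS1 : measurable S1.
  rewrite (_ : S1 = snd @^-1` B `&` (fun p => (p.1 + p.2)%R) @^-1` E)//.
  by apply: measurableI; apply: measurable_preimage.
have mS2 : measurable S2.
  rewrite (_ : S2 = snd @^-1` E `&` (fun p => (p.2 - p.1)%R) @^-1` B)//.
  by apply: measurableI; apply: measurable_preimage.
have := indic_fubini_tonelli mu nu mS1.
rewrite indic_fubini_tonelli_FE// indic_fubini_tonelli_GE// => F1.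
have := indic_fubini_tonelli mu nu mS2.
rewrite indic_fubini_tonelli_FE// indic_fubini_tonelli_GE// => F2.
have xS x : nu (xsection S1 x) = nu (xsection S2 x).
  rewrite -(nuT x (xsection S2 x)); last exact: measurable_xsection.
  congr (nu _); rewrite !xsectionE; apply/seteqP; split => y /=.
    by move=> [By Ey]; split => //; rewrite addrAC subrr add0r.
  by move=> [Ey]; rewrite addrAC subrr add0r.
have yS1 y : mu (ysection S1 y) = (cst (mu E) \_ B) y.
  rewrite patchE; case: ifPn => [/set_mem By|/negP nBy].
    rewrite -(muT y E)//; congr (mu _); rewrite ysectionE.
    apply/seteqP; split => x /=; first by rewrite addrC => -[].
    by rewrite addrC.
  rewrite (_ : ysection S1 y = set0) ?measure0//.
  by rewrite ysectionE; apply/seteqP; split => // x [By _]; apply: nBy; rewrite inE.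
have yS2 y : mu (ysection S2 y) = (cst (mu B) \_ E) y.
  rewrite patchE; case: ifPn => [/set_mem Ey|/negP nEy].
    rewrite -(muT (- y)%R B)//; congr (mu _); rewrite ysectionE.
    apply/seteqP; split => x /=; first by move=> [_ /symB]; rewrite opprB addrC.
    by move=> /symB; rewrite opprD opprK => ?; split.
  rewrite (_ : ysection S2 y = set0) ?measure0//.
  by rewrite ysectionE; apply/seteqP; split => // x [Ey _]; apply: nEy; rewrite inE.
have I1 : \int[nu]_y (mu \o ysection S1) y = mu E * nu B.
  by under eq_integral do rewrite /= yS1; rewrite -integral_mkcond integral_cst.
have I2 : \int[nu]_y (mu \o ysection S2) y = mu B * nu E.
  by under eq_integral do rewrite /= yS2; rewrite -integral_mkcond integral_cst.
by rewrite -I1 -I2 -F1 -F2; apply: eq_integral => x _; exact: xS.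
Qed.

Lemma lebesgue_measure_shift (a : R) (A : set (measurableTypeR R)) :
  measurable A -> lebesgue_measure ((fun x : R => x + a)%R @^-1` A) =
                  lebesgue_measure A.
Proof.
move=> mA; pose f : measurableTypeR R -> measurableTypeR R := fun x => (x + a)%R.
have mf : measurable_fun [set: measurableTypeR R] f by exact: measurable_funD.
suff H X : ocitv X -> lebesgue_measure X = image_measure lebesgue_measure mf X.
  exact: (esym (lebesgue_measure_unique H mA)).
case=> -[b c] _ <-.
rewrite /= /pushforward.
have -> : (fun x : R => x + a)%R @^-1` `]b, c]%classic = `](b - a)%R, (c - a)%R]%classic.
  by apply/seteqP; split => x; rewrite /= !in_itv /= ltrBlDr lerBrDr.
rewrite !lebesgue_measure_itv /= !lte_fin ltrD2r; case: ifP => // _.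
by rewrite -!EFinB; congr EFin; ring.
Qed.

Lemma lebesgue_rVS n (A : set 'rV[R]_n.+1) :
  lebesgue_rV A = \int[lebesgue_measure]_s lebesgue_rV (fun y => A (cons_rV (s, y))).
Proof.
rewrite /= /pushforward /product_measure1; apply: eq_integral => s _ /=.
by rewrite xsectionE.
Qed.

Lemma lebesgue_rV_translation_invariant n :
  translation_invariant (@lebesgue_rV R n).
Proof.
elim: n => [v A mA|n IH v A mA].
  congr lebesgue_rV; apply/seteqP; split => x /=; rewrite (_ : (v + x)%R = x)//;
  by apply/rowP => -[].
rewrite !lebesgue_rVS.
have mcons : measurable (@cons_rV R n @^-1` A).
  exact: (measurable_preimage (@measurable_cons_rV R n)).
pose S (s : measurableTypeR R) : set 'rV[R]_n := fun y => A (cons_rV (s, y)).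
have SE s : S s = xsection (@cons_rV R n @^-1` A) s by rewrite xsectionE.
pose g (s : measurableTypeR R) := lebesgue_rV (S s).
have mg : measurable_fun [set: measurableTypeR R] g.
  have := @measurable_fun_xsection _ _ (measurableTypeR R) _ R (@lebesgue_rV R n) _ mcons.
  by apply: eq_measurable_fun => s _ /=; rewrite /g SE.
have mS s : measurable (S s) by rewrite SE; exact: measurable_xsection.
pose a := v ord0 ord0; pose w := (\row_(i < n) v ord0 (lift ord0 i))%R.
pose f : measurableTypeR R -> measurableTypeR R := fun x => (x + a)%R.
have mf : measurable_fun [set: measurableTypeR R] f by exact: measurable_funD.
have -> : (\int[lebesgue_measure]_s
    lebesgue_rV (fun y => ((fun x => v + x)%R @^-1` A) (cons_rV (s, y)))) =
    \int[lebesgue_measure]_s (g \o f) s.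
  apply: eq_integral => s _; rewrite /g /comp -(IH w (S (f s)) (mS _)).
  congr lebesgue_rV; apply/funext => y; rewrite /preimage /S /f /=; congr (A _).
  apply/rowP => i; rewrite mxE; case: (unliftP ord0 i) => [j|] ->.
    by rewrite !cons_rVS !mxE.
  by rewrite !cons_rV0 addrC.
have -> : (\int[lebesgue_measure]_s lebesgue_rV (fun y => A (cons_rV (s, y))) =
  \int[lebesgue_measure]_s g s) by [].
have := @ge0_integral_pushforward _ _ _ _ _ f mf (@lebesgue_measure R) setT g measurableT mg.
rewrite preimage_setT => <-; last by move=> s _; exact: measure_ge0.
apply: (@eq_measure_integral _ _ _ setT lebesgue_measure
  (image_measure lebesgue_measure mf) g) => B mB _.
exact: lebesgue_measure_shift.
Qed.

End translation_invariance.

Section image_of_lebesgue.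
Context {R : realType}.
Local Open Scope ereal_scope.

Section image_sigma_finite.
Variables (n : nat) (phi psi : 'rV[R]_n -> 'rV[R]_n).
Hypothesis mphi : measurable_fun [set: 'rV[R]_n] phi.
Hypothesis mpsi : measurable_fun [set: 'rV[R]_n] psi.
Hypothesis phiK : cancel phi psi.

Let nu := pushforward (@lebesgue_rV R n) phi.

Let nu0 : nu set0 = 0.
Proof. by rewrite /nu /pushforward preimage_set0 measure0. Qed.

Let nu_ge0 A : 0 <= nu A.
Proof. exact: (measure_ge0 (@lebesgue_rV R n)). Qed.

Let nu_sigma_additive : semi_sigma_additive nu.
Proof.
move=> F mF tF mUF.
exact: (@measure_semi_sigma_additive _ _ _ (image_measure (@lebesgue_rV R n) mphi)).
Qed.

HB.instance Definition _ := isMeasure.Build _ _ _ nu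
  nu0 nu_ge0 nu_sigma_additive.

Let nu_sigma_finite : sigma_finite setT nu.
Proof.
have /sigma_finiteP[F [TF ndF Foo]] := sigma_finiteT (@lebesgue_rV R n).
exists (fun k => psi @^-1` F k).
  by rewrite -preimage_bigcup -TF preimage_setT.
move=> k; have [mF Fk] := Foo k; split; first exact: measurable_preimage.
rewrite /nu /pushforward -comp_preimage.
by rewrite (_ : psi \o phi = id) ?preimage_id//; apply/funext => x /=; rewrite phiK.
Qed.

HB.instance Definition _ := Measure_isSigmaFinite.Build _ _ _ nu
  nu_sigma_finite.

Lemma image_sigma_finite :
  exists nu' : {sigma_finite_measure set 'rV[R]_n -> \bar R},
    forall A, nu' A = lebesgue_rV (phi @^-1` A).
Proof. by exists nu. Qed.

End image_sigma_finite.

(** The image of the Lebesgue measure under an additive bijection is translation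
    invariant, hence proportional to it; [B] serves to compute the ratio. *)
Lemma lebesgue_rV_additive_image n (phi psi : 'rV[R]_n -> 'rV[R]_n)
    (B E : set 'rV[R]_n) :
  measurable_fun [set: 'rV[R]_n] phi -> measurable_fun [set: 'rV[R]_n] psi ->
  cancel phi psi -> cancel psi phi -> {morph phi : x y / (x + y)%R} ->
  measurable B -> (forall x, B x -> B (- x)%R) -> measurable E ->
  lebesgue_rV (phi @^-1` E) * lebesgue_rV B =
  lebesgue_rV (phi @^-1` B) * lebesgue_rV E.
Proof.
move=> mphi mpsi phiK psiK phiD mB symB mE.
have [nu nuE] := image_sigma_finite mphi mpsi phiK.
rewrite -!nuE; apply: translation_invariant_unique => //; last first.
  exact: lebesgue_rV_translation_invariant.
move=> v A mA; rewrite !nuE.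
rewrite -[RHS](lebesgue_rV_translation_invariant (psi v)); last first.
  exact: measurable_preimage.
by congr lebesgue_rV; apply/seteqP; split => x /=; rewrite phiD psiK.
Qed.

Lemma integral_lebesgue_rVS n (f : 'rV[R]_n.+1 -> \bar R) :
  (@lebesgue_rV R n.+1).-integrable setT f ->
  \int[lebesgue_rV]_x f x =
  \int[lebesgue_measure]_s \int[lebesgue_rV]_y f (cons_rV (s, y)).
Proof.
move=> intf; have mf := measurable_int _ intf.
pose c : measurableTypeR R * 'rV[R]_n -> 'rV[R]_n.+1 := @cons_rV R n.
have mc : measurable_fun [set: measurableTypeR R * 'rV[R]_n] c.
  exact: measurable_cons_rV.
have mfc : measurable_fun setT (f \o c) by exact: measurableT_comp.
have intfc : ((@lebesgue_measure R) \x (@lebesgue_rV R n)).-integrable setT (f \o c).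
  apply/integrableP; split=> //.
  have maf : measurable_fun setT (abse \o f) by exact: measurableT_comp.
  have := @ge0_integral_pushforward _ _ _ _ R c mc
    (lebesgue_measure \x (@lebesgue_rV R n)) setT (abse \o f) measurableT maf.
  rewrite preimage_setT => /(_ (fun y _ => abse_ge0 _)) <-.
  by have /integrableP[_] := intf.
have := @integral_pushforward _ _ _ _ R c mc
    (lebesgue_measure \x (@lebesgue_rV R n)) setT f mf.
rewrite preimage_setT => /(_ intfc measurableT) E.
transitivity (\int[lebesgue_measure \x (@lebesgue_rV R n)]_x (f \o c) x); first exact: E.
by rewrite -integral12_prod_meas1.
Qed.

End image_of_lebesgue.

Section scalar_product.
Context {R : realType} {n : nat}.
Implicit Types (x y z w : 'rV[R]_n).

Lemma dotpC x y : dotp x y = dotp y x.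
Proof. by apply: eq_bigr => i _; rewrite mulrC. Qed.

Lemma dotpDl x y z : dotp (x + y) z = dotp x z + dotp y z.
Proof. by rewrite -big_split; apply: eq_bigr => i _; rewrite mxE mulrDl. Qed.

Lemma dotpZl a x y : dotp (a *: x) y = a * dotp x y.
Proof. by rewrite mulr_sumr; apply: eq_bigr => i _; rewrite mxE mulrA. Qed.

Lemma dotpNl x y : dotp (- x) y = - dotp x y.
Proof. by rewrite -scaleN1r dotpZl mulN1r. Qed.

Lemma dotpBl x y z : dotp (x - y) z = dotp x z - dotp y z.
Proof. by rewrite dotpDl dotpNl. Qed.

Lemma dotpDr x y z : dotp z (x + y) = dotp z x + dotp z y.
Proof. by rewrite dotpC dotpDl !(dotpC z). Qed.

Lemma dotpZr a x y : dotp y (a *: x) = a * dotp y x.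
Proof. by rewrite dotpC dotpZl (dotpC y). Qed.

Lemma dotpNr x y : dotp y (- x) = - dotp y x.
Proof. by rewrite dotpC dotpNl (dotpC y). Qed.

Lemma dotpBr x y z : dotp z (x - y) = dotp z x - dotp z y.
Proof. by rewrite dotpDr dotpNr. Qed.

Lemma dotp_ge0 x : 0 <= dotp x x.
Proof. by apply: sumr_ge0 => i _; rewrite -expr2 sqr_ge0. Qed.

Lemma dotp_eq0 x : dotp x x = 0 -> x = 0.
Proof.
move=> /eqP; rewrite psumr_eq0; last by move=> i _; rewrite -expr2 sqr_ge0.
move=> /allP h; apply/rowP => i; rewrite mxE.
by have := h i (mem_index_enum _); rewrite /= -expr2 sqrf_eq0 => /eqP.
Qed.

Lemma enorm_ge0 x : 0 <= enorm x.
Proof. exact: sqrtr_ge0. Qed.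

Lemma sqr_enorm x : enorm x ^+ 2 = dotp x x.
Proof. by rewrite sqr_sqrtr// dotp_ge0. Qed.

Lemma unit_ballE : @unit_ball R n = [set x | dotp x x <= 1].
Proof.
apply/funext => x; rewrite /unit_ball /enorm /=.
by rewrite -[X in _ <= X]sqrtr1 ler_sqrt.
Qed.

Lemma unit_ball_coord x i : unit_ball x -> `|x ord0 i| <= 1.
Proof.
rewrite unit_ballE /= => x1.
rewrite -(@ler_pXn2r _ 2)// ?nnegrE// expr1n real_normK ?num_real//.
apply: le_trans x1; rewrite /dotp (bigD1 i)//= -expr2 lerDl.
by apply: sumr_ge0 => j _; rewrite -expr2 sqr_ge0.
Qed.

Lemma measurable_dotp y : measurable_fun [set: 'rV[R]_n] (fun x => dotp x y).
Proof.
apply: measurable_sum => i; apply: measurable_funM => //.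
exact: measurable_coordT.
Qed.

Lemma measurable_sqdotp : measurable_fun [set: 'rV[R]_n] (fun x => dotp x x).
Proof.
by apply: measurable_sum => i; apply: measurable_funM; exact: measurable_coordT.
Qed.

Lemma measurable_eball (r : R) : measurable [set x : 'rV[R]_n | dotp x x <= r].
Proof.
have := measurable_preimage measurable_sqdotp (measurable_itv `]-oo, r]).
by congr measurable; apply/seteqP; split => x /=; rewrite in_itv.
Qed.

Lemma measurable_unit_ball : measurable (@unit_ball R n).
Proof. by rewrite unit_ballE; exact: measurable_eball. Qed.

(** The reflection in the hyperplane orthogonal to [w]; the identity if [w] is
    0. *)
Definition reflection w x : 'rV[R]_n := x - (2 / dotp w w * dotp x w) *: w.

Lemma measurable_reflection w : measurable_fun [set: 'rV[R]_n] (reflection w).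
Proof.
apply: measurable_rV_fun => j.
under eq_fun do rewrite !mxE.
apply: measurable_funB; first exact: measurable_coordT.
apply: measurable_funM => //; apply: measurable_funM => //.
exact: measurable_dotp.
Qed.

Lemma reflectionD w : {morph reflection w : x y / x + y}.
Proof.
by move=> x y; rewrite /reflection dotpDl mulrDr scalerDl opprD addrACA.
Qed.

Let reflection_coef w : 2 / dotp w w * dotp w w = 2 \/ 2 / dotp w w = 0.
Proof.
have [w0|w0] := eqVneq (dotp w w) 0; first by right; rewrite w0 invr0 mulr0.
by left; rewrite divfK.
Qed.

Lemma dotp_reflection w x y : dotp (reflection w x) y = dotp x (reflection w y).
Proof.
by rewrite /reflection dotpBl dotpBr dotpZl dotpZr (dotpC y w); ring.
Qed.

Lemma reflectionK w : involutive (reflection w).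
Proof.
move=> x; rewrite /reflection dotpBl dotpZl.
set c := 2 / dotp w w; rewrite -addrA -opprD -scalerDl.
suff -> : c * dotp x w + c * (dotp x w - c * dotp x w * dotp w w) = 0.
  by rewrite scale0r subr0.
have -> : c * dotp x w + c * (dotp x w - c * dotp x w * dotp w w) =
  c * dotp x w * (2 - c * dotp w w) by ring.
by have := reflection_coef w; rewrite -/c => -[->|->]; ring.
Qed.

Lemma dotp_reflection2 w x y : dotp (reflection w x) (reflection w y) = dotp x y.
Proof. by rewrite dotp_reflection reflectionK. Qed.

Lemma reflection_enorm x e : dotp e e = 1 ->
  reflection (x - enorm x *: e) x = enorm x *: e.
Proof.
move=> e1; set w := x - enorm x *: e.
have ww : dotp w w = 2 * dotp x w.
  rewrite /w !(dotpBl, dotpBr, dotpZl, dotpZr) e1 -sqr_enorm (dotpC e).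
  ring.
have [w0|w0] := eqVneq (dotp w w) 0.
  have /eqP := dotp_eq0 w0; rewrite subr_eq0 => /eqP <-.
  by rewrite /reflection w0 invr0 mulr0 mul0r scale0r subr0.
rewrite /reflection (_ : _ * _ = 1) ?scale1r ?subKr//.
by rewrite mulrAC -ww divff.
Qed.

End scalar_product.

Section ball_volume.
Context {R : realType}.

Definition cube n (r : R) : set 'rV[R]_n :=
  [set x | forall i, `[- r, r]%classic (x ord0 i)].
Arguments cube : clear implicits.

Let measurable_cube (n : nat) (r : R) : measurable (cube n r).
Proof. by apply: (@measurable_box R n (fun=> `[- r, r]%classic)) => i. Qed.

Let lebesgue_cube (n : nat) (r : R) : 0 < r ->
  lebesgue_rV (cube n r) = ((2 * r) ^+ n)%:E.
Proof.
move=> r0; rewrite /cube (@lebesgue_rV_box R n (fun=> `[- r, r]%classic))//.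
rewrite (eq_bigr (fun=> (2 * r)%:E)); last first.
  move=> i _; rewrite lebesgue_measure_itv /= lte_fin ifT; last lra.
  by rewrite -EFinB; congr EFin; ring.
by rewrite prodEFin prodr_const card_ord.
Qed.

Let cubeN (n : nat) (r : R) (x : 'rV[R]_n) : cube n r x -> cube n r (- x).
Proof.
by move=> h i; have := h i; rewrite /= mxE !in_itv /= lerN2 lerNl => /andP[-> ->].
Qed.

Lemma unit_ball_volume n : exists2 kappa : R, 0 < kappa &
  lebesgue_rV (@unit_ball R n) = kappa%:E.
Proof.
have sub1 : @unit_ball R n `<=` cube n 1.
  by move=> x x1 i; rewrite /= in_itv /= -ler_norml; exact: unit_ball_coord.
have sub2 : cube n (n.+1%:R^-1) `<=` @unit_ball R n.
  rewrite unit_ballE => x xc /=.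
  apply: le_trans (_ : \sum_(i < n) n.+1%:R^-1 <= _).
    apply: ler_sum => i _; have := xc i; rewrite /= in_itv /= -ler_norml => xi.
    rewrite -expr2 -(real_normK (num_real _)) expr2.
    apply: le_trans (ler_pM _ _ xi xi) _; rewrite ?normr_ge0//.
    by rewrite ler_piMr ?invr_ge0// invf_le1// ler1n.
  rewrite sumr_const card_ord -[leLHS]mulr_natr [leLHS]mulrC ler_pdivrMr// mul1r ler_nat.
  by [].
have fin : lebesgue_rV (@unit_ball R n) \is a fin_num.
  rewrite ge0_fin_numE ?measure_ge0//.
  apply: le_lt_trans (le_measure lebesgue_rV _ _ sub1) _; rewrite ?inE//.
    exact: measurable_unit_ball.
  by rewrite [ltLHS](lebesgue_cube n ltr01) ltry.
exists (fine (lebesgue_rV (@unit_ball R n))); last by rewrite fineK.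
rewrite -lte_fin fineK//.
apply: lt_le_trans (le_measure lebesgue_rV _ _ sub2); rewrite ?inE//; last first.
  exact: measurable_unit_ball.
have n0 : (0 : R) < n.+1%:R^-1 by rewrite invr_gt0.
by rewrite [ltRHS](lebesgue_cube n n0) lte_fin exprn_gt0// mulr_gt0.
Qed.

(** The ratio of the image of the measure under the dilation is read off from
    cubes, whose volume is known. *)
Lemma ball_volume n (kappa r : R) :
  lebesgue_rV (@unit_ball R n) = kappa%:E -> (0 < n)%N -> 0 <= r ->
  lebesgue_rV [set x : 'rV[R]_n | dotp x x <= r ^+ 2] = (r ^+ n * kappa)%:E.
Proof.
move=> kE n0; rewrite le_eqVlt => /predU1P[<-|r0].
  rewrite !expr0n (gtn_eqF n0) /= mul0r.
  apply/eqP; rewrite eq_le measure_ge0 andbT.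
  apply: (@le_trans _ _ (lebesgue_rV
    [set x : 'rV[R]_n | forall i, [set 0] (x ord0 i)])).
    apply: le_measure; rewrite ?inE; first exact: measurable_eball.
      by apply: (@measurable_box R n (fun=> [set 0])) => i.
    move=> x /= x0 i; suff -> : x = 0 by rewrite mxE.
    by apply: dotp_eq0; apply/eqP; rewrite eq_le x0 dotp_ge0.
  rewrite (@lebesgue_rV_box R n (fun=> [set 0]))//.
  case: n n0 {kE} => // n _.
  by rewrite big_ord_recl lebesgue_measure_set1 mul0e.
have r0' : r != 0 by rewrite gt_eqF.
have mU : measurable (@unit_ball R n) by exact: measurable_unit_ball.
have mscale (a : R) : measurable_fun [set: 'rV[R]_n] (fun x : 'rV[R]_n => a *: x).
  apply: measurable_rV_fun => j; under eq_fun do rewrite mxE.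
  by apply: measurable_funM => //; exact: measurable_coordT.
have : (lebesgue_rV ((fun x : 'rV[R]_n => r^-1 *: x) @^-1` @unit_ball R n) *
    lebesgue_rV (cube n 1) =
    lebesgue_rV ((fun x : 'rV[R]_n => r^-1 *: x) @^-1` cube n 1) *
    lebesgue_rV (@unit_ball R n))%E.
  apply: (lebesgue_rV_additive_image (psi := fun x => r *: x)) => //.
  - exact: scalerKV.
  - exact: scalerK.
  - exact: scalerDr.
  - exact: cubeN.
have -> : (fun x : 'rV[R]_n => r^-1 *: x) @^-1` (@unit_ball R n) =
    [set x | dotp x x <= r ^+ 2].
  rewrite unit_ballE; apply/seteqP; split => x /=.
    rewrite dotpZl dotpZr mulrA -invfM -expr2 mulrC.
    by rewrite ler_pdivrMr ?exprn_gt0// mul1r.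
  rewrite dotpZl dotpZr mulrA -invfM -expr2 mulrC.
  by rewrite ler_pdivrMr ?exprn_gt0// mul1r.
have -> : (fun x : 'rV[R]_n => r^-1 *: x) @^-1` (cube n 1) = cube n r.
  apply/seteqP; split => x /= h i; have := h i; rewrite /= mxE !in_itv /=;
  by rewrite -!ler_norml normrM gtr0_norm ?invr_gt0// mulrC ler_pdivrMr ?mul1r.
rewrite !lebesgue_cube// mulr1 kE => h.
rewrite -[LHS]mule1 (_ : 1%E = ((2 ^+ n)%:E * (2 ^- n)%:E)%E); last first.
  by rewrite -EFinM divff// expf_neq0.
rewrite muleA h -EFinM; congr EFin; rewrite exprMn.
by field; rewrite expf_neq0.
Qed.

(** The ratio is 1 because the unit ball is mapped to itself and has positive
    finite measure. *)
Lemma reflection_lebesgue n (w : 'rV[R]_n) (E : set 'rV[R]_n) : measurable E ->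
  lebesgue_rV (reflection w @^-1` E) = lebesgue_rV E.
Proof.
move=> mE; have [kappa k0 kE] := unit_ball_volume n.
have mU : measurable (@unit_ball R n) by exact: measurable_unit_ball.
have : (lebesgue_rV (reflection w @^-1` E) * lebesgue_rV (@unit_ball R n) =
    lebesgue_rV (reflection w @^-1` @unit_ball R n) * lebesgue_rV E)%E.
  apply: (lebesgue_rV_additive_image (psi := reflection w)) => //.
  - exact: measurable_reflection.
  - exact: measurable_reflection.
  - exact: reflectionK.
  - exact: reflectionK.
  - exact: reflectionD.
  - by move=> x; rewrite unit_ballE /= dotpNl dotpNr opprK.
have -> : reflection w @^-1` (@unit_ball R n) = @unit_ball R n.
  by rewrite unit_ballE; apply/seteqP; split => x /=; rewrite dotp_reflection2.
rewrite kE [RHS]muleC => h; rewrite -[LHS]mule1 -[RHS]mule1.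
rewrite (_ : 1%E = (kappa%:E * (kappa^-1)%:E)%E); last by rewrite -EFinM divff// gt_eqF.
by rewrite !muleA h.
Qed.

End ball_volume.

(** * The Fourier transform of the ball *)

Section fourier_transform_of_ball.
Context {R : realType}.

Lemma bounded_integrable_ball n (f : 'rV[R]_n -> R) (M : R) :
  measurable_fun [set: 'rV[R]_n] f -> (forall x, `|f x| <= M) ->
  (@lebesgue_rV R n).-integrable (@unit_ball R n) (EFin \o f).
Proof.
move=> mf fM; have mU : measurable (@unit_ball R n) by exact: measurable_unit_ball.
have [k _ kE] := @unit_ball_volume R n.
apply: (@measurable_bounded_integrable _ _ _ (@lebesgue_rV R n)) => //.
- by rewrite [ltLHS]kE ltry.
- exact: measurable_funTS.
- by exists M; split; [exact: num_real|move=> x Mx y _ /=; exact: le_trans (fM y) (ltW Mx)].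
Qed.

Lemma dotp_cons_rV n (s : R) (y : 'rV[R]_n) (v : 'rV[R]_n.+1) :
  dotp (cons_rV (s, y)) v =
  s * v ord0 ord0 + dotp y (\row_i v ord0 (lift ord0 i)).
Proof.
rewrite /dotp big_ord_recl cons_rV0; congr (_ + _).
by apply: eq_bigr => i _; rewrite cons_rVS mxE.
Qed.

Lemma dotp_cons_rV2 n (s : R) (y : 'rV[R]_n) :
  dotp (cons_rV (s, y)) (cons_rV (s, y)) = s ^+ 2 + dotp y y.
Proof.
rewrite dotp_cons_rV cons_rV0 -expr2; congr (_ + dotp y _).
by apply/rowP => i; rewrite mxE cons_rVS.
Qed.

Lemma measurable_cosM d0 (S : measurableType d0) (f : S -> R) :
  measurable_fun [set: S] f -> measurable_fun [set: S] (fun x => cos (f x)).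
Proof.
move=> mf; apply: (measurableT_comp _ mf).
apply: (@continuous_measurable_fun R cos) => x.
exact: continuous_cos.
Qed.

(** The sections of the ball orthogonal to the first axis are balls of dimension
    [n], of radius [sqrt (1 - s^2)] at abscissa [s]. *)
Lemma integral_ball_cos_axis n (kappa t : R) : (0 < n)%N ->
  lebesgue_rV (@unit_ball R n) = kappa%:E ->
  \int[lebesgue_rV]_(x in @unit_ball R n.+1) cos (t * x ord0 ord0) =
  kappa * bessel n t.
Proof.
move=> n0 kE.
pose F (x : 'rV[R]_n.+1) := (cos (t * x ord0 ord0))%:E.
have mF : measurable_fun [set: 'rV[R]_n.+1] (fun x : 'rV[R]_n.+1 => cos (t * x ord0 ord0)).
  by apply: measurable_cosM; apply: measurable_funM => //; exact: measurable_coordT.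
have intF : lebesgue_rV.-integrable (@unit_ball R n.+1) F.
  apply: (@bounded_integrable_ball _ _ 1) => // x.
  by rewrite ler_norml cos_geN1 cos_le1.
have mU : measurable (@unit_ball R n.+1) by exact: measurable_unit_ball.
have intFU : lebesgue_rV.-integrable setT (F \_ (@unit_ball R n.+1)).
  by apply/integrable_restrict => //; rewrite setTI.
rewrite /Rintegral -/F [in LHS]integral_mkcond integral_lebesgue_rVS//.
have inner s : (\int[lebesgue_rV]_y (F \_ (@unit_ball R n.+1)) (cons_rV (s, y)) =
    ((fun s => (kappa * (cos (t * s) * slice n s))%:E) \_ `[(-1)%R, 1%R]) s)%E.
  transitivity (\int[lebesgue_rV]_y
     ((cst (cos (t * s))%:E) \_ [set y : 'rV[R]_n | (dotp y y <= 1 - s ^+ 2)%R]) y)%E.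
    apply: eq_integral => y _; rewrite !patchE /F cons_rV0.
    rewrite (_ : (cons_rV (s, y) \in _) = (y \in [set y | dotp y y <= 1 - s ^+ 2]))//.
    apply/idP/idP; rewrite !inE unit_ballE /= dotp_cons_rV2 => h; first by rewrite lerBrDl.
    by rewrite -lerBrDl.
  rewrite -integral_mkcond integral_cst; last exact: measurable_eball.
  rewrite patchE; case: ifPn => [|/negP].
    rewrite inE /= in_itv /= => /andP[s1 s2].
    have p0 : 0 <= 1 - s ^+ 2 by nra.
    rewrite -{1}(sqr_sqrtr p0) [X in (_ * X)%E](ball_volume kE n0 (sqrtr_ge0 _)) -EFinM /slice.
    by congr EFin; ring.
  rewrite inE /= in_itv /= => s1.
  rewrite (_ : [set y : 'rV[R]_n | dotp y y <= 1 - s ^+ 2] = set0) ?measure0 ?mule0//.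
  apply/seteqP; split => // y /= ys; apply: s1.
  have := le_trans (dotp_ge0 y) ys; rewrite subr_ge0.
  by rewrite -ler_norml -[s ^+ 2](real_normK (num_real s)) expr_le1.
under eq_integral do rewrite inner.
rewrite -integral_mkcond -[LHS]/(Rintegral _ _ _) RintegralZl//.
apply/continuous_integrable_itv/continuous_mul; first exact: continuous_cosM.
exact: continuous_slice.
Qed.

(** A reflection maps [xi] to the first axis. *)
Lemma integral_ball_cos n (kappa : R) (xi : 'rV[R]_n.+1) : (0 < n)%N ->
  lebesgue_rV (@unit_ball R n) = kappa%:E ->
  \int[lebesgue_rV]_(x in @unit_ball R n.+1) cos (2 * pi * dotp x xi) =
  kappa * bessel n (2 * pi * enorm xi).
Proof.
move=> n0 kE; rewrite -integral_ball_cos_axis//.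
pose e : 'rV[R]_n.+1 := delta_mx 0 0.
have xe (x : 'rV[R]_n.+1) : dotp x e = x ord0 ord0.
  rewrite /dotp (bigD1 ord0)//= mxE !eqxx mulr1 big1 ?addr0// => i i0.
  by rewrite mxE (negbTE i0) andbF mulr0.
have ee : dotp e e = 1 by rewrite xe mxE !eqxx.
pose w := xi - enorm xi *: e; pose Q := reflection w.
have mQ : measurable_fun setT Q by exact: measurable_reflection.
have mU : measurable (@unit_ball R n.+1) by exact: measurable_unit_ball.
pose F (x : 'rV[R]_n.+1) := (cos (2 * pi * dotp x xi))%:E.
have mF : measurable_fun setT F.
  apply/measurable_EFinP; apply: measurable_cosM; apply: measurable_funM => //.
  exact: measurable_dotp.
have FQ x : F (Q x) = (cos (2 * pi * enorm xi * x ord0 ord0))%:E.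
  rewrite /F dotp_reflection (reflection_enorm _ ee) dotpZr xe.
  by rewrite !mulrA.
have QU : Q @^-1` @unit_ball R n.+1 = @unit_ball R n.+1.
  by rewrite unit_ballE; apply/seteqP; split => x /=; rewrite dotp_reflection2.
have intFQ : lebesgue_rV.-integrable (Q @^-1` @unit_ball R n.+1) (F \o Q).
  rewrite QU (_ : F \o Q = EFin \o fun x => cos (2 * pi * enorm xi * x ord0 ord0)); last first.
    by apply/funext => x /=; rewrite FQ.
  apply: (@bounded_integrable_ball _ _ 1).
    by apply: measurable_cosM; apply: measurable_funM => //; exact: measurable_coordT.
  by move=> x; rewrite ler_norml cos_geN1 cos_le1.
rewrite /Rintegral; congr fine; rewrite -/F.
transitivity (\int[pushforward lebesgue_rV Q]_(x in @unit_ball R n.+1) F x)%E.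
  apply: (@eq_measure_integral _ _ _ _ (image_measure lebesgue_rV mQ)) => A mA _.
  exact: (esym (reflection_lebesgue w mA)).
rewrite (integral_pushforward mQ mF intFQ mU) QU.
by apply: eq_integral => x _; rewrite /= FQ.
Qed.

Lemma Re_fourier_ball n (kappa : R) (xi : 'rV[R]_n.+1) : (0 < n)%N ->
  lebesgue_rV (@unit_ball R n) = kappa%:E ->
  complex.Re (fourier_indic (@unit_ball R n.+1) xi) =
  kappa * bessel n (2 * pi * enorm xi).
Proof.
move=> n0 kE; rewrite -integral_ball_cos//=.
by apply: eq_Rintegral => x _; rewrite cosN.
Qed.

End fourier_transform_of_ball.

(** * Sums over separated points *)

Section separated_points.
Context {R : realType}.

(** The number of the interval of length [delta] containing [t]: even numbers
    for nonnegative [t], odd numbers for negative [t]. Natural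
    numbers as labels bound sums over cells by the series of [(j + 1) ^- 2]. *)
Definition cell (delta t : R) : nat :=
  if 0 <= t then (Num.truncn (t / delta)).*2 else (Num.truncn (- t / delta)).*2.+1.

Lemma cell_close (delta t u : R) : 0 < delta -> cell delta t = cell delta u ->
  `|t - u| < delta.
Proof.
move=> d0; have aux (x y : R) : 0 <= x -> 0 <= y ->
    Num.truncn (x / delta) = Num.truncn (y / delta) -> `|x - y| < delta.
  move=> x0 y0 xy.
  have /andP[] := truncn_itv (divr_ge0 x0 (ltW d0)).
  have /andP[] := truncn_itv (divr_ge0 y0 (ltW d0)).
  rewrite xy ler_pdivlMr// ltr_pdivrMr// ler_pdivlMr// ltr_pdivrMr// -natr1 mulrDl mul1r.
  by rewrite ltr_norml => ? ? ? ?; apply/andP; split; lra.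
rewrite /cell; case: ifPn => t0; case: ifPn => u0 E.
- by apply: aux => //; apply: double_inj.
- by have := congr1 odd E; rewrite /= !odd_double.
- by have := congr1 odd E; rewrite /= !odd_double.
- rewrite -normrN opprB.
  have {}t0 : 0 <= - t by rewrite oppr_ge0 ltW// ltNge.
  have {}u0 : 0 <= - u by rewrite oppr_ge0 ltW// ltNge.
  have := aux _ _ t0 u0 (double_inj (succn_inj E)).
  by rewrite opprK addrC.
Qed.

Lemma cell_ub (delta t : R) : 0 < delta -> delta <= 1 ->
  (cell delta t)%:R + 1 <= 2 / delta * (1 + `|t|).
Proof.
move=> d0 d1.
have aux (x : R) : 0 <= x -> 2 * (Num.truncn (x / delta))%:R + 2 <= 2 / delta * (1 + x).
  move=> x0; have /andP[+ _] := truncn_itv (divr_ge0 x0 (ltW d0)).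
  have : 1 <= delta^-1 by rewrite -[leLHS]invr1 lef_pV2// posrE.
  lra.
rewrite /cell; case: ifPn => t0.
  rewrite ger0_norm// -mul2n natrM; have := aux t t0; lra.
have {}t0 : 0 <= - t by rewrite oppr_ge0 ltW// ltNge.
rewrite -normrN ger0_norm// -addn1 -mul2n natrD natrM; have := aux _ t0; lra.
Qed.

Lemma sum_inv_sqr (L : nat) : \sum_(j < L) ((j%:R + 1) ^- 2 : R) <= 2.
Proof.
case: L => [|L]; first by rewrite big_ord0.
suff H : \sum_(j < L.+1) ((j%:R + 1) ^- 2 : R) <= 2 - (L%:R + 1)^-1.
  by apply: le_trans H _; rewrite gerBl invr_ge0 addr_ge0.
elim: L => [|L IH]; first by rewrite big_ord1 !add0r expr1n invr1; lra.
rewrite big_ord_recr /=; apply: le_trans (lerD IH (lexx _)) _.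
rewrite -[L.+1%:R]natr1; set x : R := L%:R + 1.
have x0 : 0 < x by rewrite ltr_wpDl.
have x1 : 0 < x + 1 by rewrite addr_gt0.
rewrite -subr_ge0.
have -> : 2 - (x + 1)^-1 - (2 - x^-1 + (x + 1) ^- 2) = (x * (x + 1) ^+ 2)^-1.
  by field; rewrite !gt_eqF.
by rewrite invr_ge0 mulr_ge0 ?exprn_ge0// ltW.
Qed.

(** The points lie in distinct cells of a grid of mesh [delta], so that the sum
    is at most a sum over all cells, which is the [d]-th power of a
    one-dimensional sum. *)
Lemma separated_sum_bound d N (a : 'I_N -> 'rV[R]_d) (delta : R) :
  0 < delta -> delta <= 1 ->
  (forall k l, k != l -> exists i, delta <= `|a k ord0 i - a l ord0 i|) ->
  \sum_(k < N) \prod_(i < d) (1 + `|a k ord0 i|) ^- 2 <=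
  (8 / delta ^+ 2) ^+ d.
Proof.
move=> d0 d1 sep.
pose c k i := cell delta (a k ord0 i).
have [L cL] : exists L, forall k i, (c k i < L.+1)%N.
  exists (\max_(p : 'I_N * 'I_d) c p.1 p.2) => k i; rewrite ltnS.
  exact: (leq_bigmax (k, i)).
pose phi k : {ffun 'I_d -> 'I_L.+1} := [ffun i => Ordinal (cL k i)].
have phi_inj : injective phi.
  move=> k l kl; apply/eqP; apply: contraT => nkl; case: (sep k l nkl) => i.
  rewrite leNgt cell_close//.
  by have /ffunP/(_ i) := kl; rewrite !ffunE => -[].
pose F (g : {ffun 'I_d -> 'I_L.+1}) : R :=
  \prod_(i < d) (4 / delta ^+ 2 * ((g i)%:R + 1) ^- 2).
have p0 t : 0 < 1 + `|t| :> R by rewrite ltr_pwDl.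
have q0 (m : nat) : 0 < m%:R + 1 :> R by rewrite ltr_wpDl.
have F0 g : 0 <= F g.
  apply: prodr_ge0 => i _; rewrite mulr_ge0 ?divr_ge0 ?invr_ge0 ?exprn_ge0// ltW//.
apply: (@le_trans _ _ (\sum_(k < N) F (phi k))).
  apply: ler_sum => k _; apply: ler_prod => i _.
  rewrite invr_ge0 exprn_ge0 ?(ltW (p0 _))//= ffunE /=.
  have := cell_ub (a k ord0 i) d0 d1; rewrite -/(c k i) => h.
  have -> : 4 / delta ^+ 2 * ((c k i)%:R + 1) ^- 2 =
     ((delta / 2 * ((c k i)%:R + 1)) ^+ 2)^-1.
    by field; rewrite !gt_eqF.
  have h' : delta / 2 * ((c k i)%:R + 1) <= 1 + `|a k ord0 i|.
    by rewrite -ler_pdivlMl ?divr_gt0// invf_div.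
  have r0 : 0 < delta / 2 * ((c k i)%:R + 1) by rewrite mulr_gt0// divr_gt0.
  rewrite lef_pV2 ?posrE ?exprn_gt0// ler_pXn2r// nnegrE ltW//.
rewrite -(big_imset F) /=; last by move=> k l _ _; exact: phi_inj.
apply: (@le_trans _ _ (\sum_g F g)).
  by rewrite [leRHS](bigID (mem (phi @: 'I_N)))/= lerDl sumr_ge0.
rewrite /F -(bigA_distr_bigA
  (fun (i : 'I_d) (j : 'I_L.+1) => 4 / delta ^+ 2 * (j%:R + 1) ^- 2)) /=.
have -> : (8 / delta ^+ 2) ^+ d = \prod_(i < d) (8 / delta ^+ 2).
  by rewrite prodr_const card_ord.
apply: ler_prod => i _.
rewrite -mulr_sumr; apply/andP; split.
  by rewrite mulr_ge0 ?divr_ge0 ?exprn_ge0 ?(ltW d0)// sumr_ge0// => j _;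
    rewrite invr_ge0 exprn_ge0// ltW.
have -> : 8 / delta ^+ 2 = 4 / delta ^+ 2 * 2 by ring.
by rewrite ler_wpM2l ?sum_inv_sqr// divr_ge0// exprn_ge0// ltW.
Qed.

End separated_points.

(** * A bump function and its Fourier transform *)

Section bump.
Context {R : realType}.
Local Notation mu := (@lebesgue_measure R).
Variable c : R.
Hypothesis c0 : 0 < c.
Hypothesis c1 : c <= 1.

Let q (s : R) : R := (c ^+ 2 - s ^+ 2) ^+ 2.

Let continuous_q : continuous q.
Proof.
have H : continuous (fun s : R => c ^+ 2 - s ^+ 2).
  by move=> s; apply: cvgB; [exact: cvg_cst|exact: exprn_continuous].
by rewrite (_ : q = fun s => (c ^+ 2 - s ^+ 2) * (c ^+ 2 - s ^+ 2))//; exact: continuous_mul.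
Qed.

Definition bump_hat (theta : R) : R :=
  \int[mu]_(s in `[- c, c]) (q s * cos (theta * s)).

Let continuous_qcos theta : continuous (fun s => q s * cos (theta * s)).
Proof. by apply: continuous_mul => //; exact: continuous_cosM. Qed.

Let continuous_qsin theta : continuous (fun s => q s * sin (theta * s)).
Proof. by apply: continuous_mul => //; exact: continuous_sinM. Qed.

Lemma bump_sin_integral theta :
  \int[mu]_(s in `[- c, c]) (q s * sin (theta * s)) = 0.
Proof.
set I := (X in X = 0).
suff : I = - I by lra.
have := @integration_by_substitution_oppr R (fun s => q s * sin (theta * s)) (- c) c.
rewrite opprK => H.
have cc : - c <= c by move: c0; lra.
have {}H := H cc (continuous_subspaceT (@continuous_qsin theta)).
rewrite {1}/I /Rintegral H.
transitivity (\int[mu]_(s in `[- c, c]) (-1 * (q s * sin (theta * s)))).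
  congr fine; apply: eq_integral => s _ /=.
  by rewrite /q sqrrN mulrN sinN mulrN mulN1r.
rewrite RintegralZl ?mulN1r//; exact: continuous_integrable_itv.
Qed.

Lemma bump_phase_integral theta tau :
  \int[mu]_(s in `[- c, c]) (q s * cos (theta * s + tau)) = bump_hat theta * cos tau.
Proof.
transitivity (\int[mu]_(s in `[- c, c]) (cos tau * (q s * cos (theta * s)) -
   sin tau * (q s * sin (theta * s)))).
  by apply: eq_Rintegral => s _; rewrite cosD; ring.
have ccst (a : R) : continuous (fun s : R => a) by move=> s; exact: cvg_cst.
rewrite RintegralB//.
- rewrite !RintegralZl//; [|exact: continuous_integrable_itv..].
  by rewrite bump_sin_integral mulr0 subr0 mulrC.
- exact: (continuous_integrable_itv _ _ (continuous_mul (ccst _) (@continuous_qcos theta))).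
- exact: (continuous_integrable_itv _ _ (continuous_mul (ccst _) (@continuous_qsin theta))).
Qed.

Let FTC (f F : R -> R) : continuous f -> (forall s : R, is_derive s 1 F (f s)) ->
  \int[mu]_(s in `[- c, c]) f s = F c - F (- c).
Proof.
move=> cf dF.
have cF : continuous F.
  by move=> s; apply: differentiable_continuous; apply/derivable1_diffP; case: (dF s).
rewrite /Rintegral (@continuous_FTC2 _ f F)//.
- by rewrite gtrN.
- exact: continuous_subspaceT.
- split; first by move=> s _; case: (dF s).
  + exact/cvg_at_right_filter/cF.
  + exact/cvg_at_left_filter/cF.
- by move=> s _; rewrite derive1E; apply: derive_val.
Qed.

Lemma bump_hat0_gt0 : 0 < bump_hat 0.
Proof.
pose F (s : R) := c ^+ 4 * s - 2 / 3 * c ^+ 2 * s ^+ 3 + s ^+ 5 / 5.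
have dF (s : R) : is_derive s 1 F (q s).
  by apply: is_derive_eq; rewrite /q /GRing.scale /=; field.
have -> : bump_hat 0 = F c - F (- c).
  rewrite -(FTC continuous_q dF).
  by apply: eq_Rintegral => s _; rewrite mul0r cos0 mulr1.
have -> : F c - F (- c) = 16 / 15 * c ^+ 5 by rewrite /F; field.
by rewrite mulr_gt0// exprn_gt0.
Qed.

Lemma bump_hatE theta : theta != 0 -> bump_hat theta =
  - 16 * c ^+ 2 * sin (theta * c) / theta ^+ 3 -
  48 * c * cos (theta * c) / theta ^+ 4 + 48 * sin (theta * c) / theta ^+ 5.
Proof.
move=> t0.
pose F (s : R) := q s * sin (theta * s) / theta
  + (4 * s ^+ 3 - 4 * c ^+ 2 * s) * cos (theta * s) / theta ^+ 2
  - (12 * s ^+ 2 - 4 * c ^+ 2) * sin (theta * s) / theta ^+ 3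
  - 24 * s * cos (theta * s) / theta ^+ 4 + 24 * sin (theta * s) / theta ^+ 5.
have dF (s : R) : is_derive s 1 F (q s * cos (theta * s)).
  have Hs : is_derive s 1 (fun s => sin (theta * s)) (cos (theta * s) * theta).
    by under eq_fun do rewrite mulrC; rewrite [theta * s]mulrC; exact: is_derive_sinM.
  have Hc : is_derive s 1 (fun s => cos (theta * s)) (- sin (theta * s) * theta).
    by under eq_fun do rewrite mulrC; rewrite [theta * s]mulrC; exact: is_derive_cosM.
  by apply: is_derive_eq; rewrite /q /GRing.scale /=; field.
rewrite /bump_hat (FTC (@continuous_qcos theta) dF).
by rewrite /F /q mulrN sinN cosN; field.
Qed.

(** The squared polynomial vanishes to the order 2 at both ends of the interval,
    whence the exponent 3: two powers make sums over separated points
    converge, and the third one makes them small far from the origin. *)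
Lemma bump_hat_decay theta : `|bump_hat theta| <= 900 / (1 + `|theta|) ^+ 3.
Proof.
set a := `|theta|; have a0 : 0 <= a by exact: normr_ge0.
have d0 : 0 < (1 + a) ^+ 3 by rewrite exprn_gt0// ltr_wpDr.
have [t1|t1] := leP 1 a; last first.
  apply: (@le_trans _ _ 2).
    have intq := continuous_integrable_itv (- c) c (@continuous_qcos theta).
    have nr : `|bump_hat theta| <= \int[mu]_(s in `[- c, c]) `|q s * cos (theta * s)|.
      exact: le_normr_Rintegral.
    apply: le_trans nr _; apply: (@le_trans _ _ (\int[mu]_(s in `[- c, c]) 1)).
      apply: le_Rintegral => //.
      - have cn : continuous (Num.norm \o (fun s => q s * cos (theta * s))).
          move=> s; apply: continuous_comp; first exact: continuous_qcos.
          exact: norm_continuous.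
        exact: (continuous_integrable_itv _ _ cn).
      - have cc : continuous (fun s : R => 1 : R) by move=> s; exact: cvg_cst.
        exact: (continuous_integrable_itv _ _ cc).
      move=> s; rewrite /= in_itv /= -ler_norml => sc.
      have s2 : s ^+ 2 <= c ^+ 2.
        by rewrite -(real_normK (num_real s)) ler_pXn2r ?nnegrE// ltW.
      have c2 : c ^+ 2 <= 1 by rewrite expr_le1// ltW.
      rewrite normrM -[leRHS]mulr1 ler_pM//.
        rewrite ger0_norm ?sqr_ge0// expr_le1 ?subr_ge0//.
        by have := sqr_ge0 s; lra.
      by rewrite ler_norml cos_geN1 cos_le1.
    rewrite Rintegral_cst//= lebesgue_measure_itv /= lte_fin ifT; last by move: c0; lra.
    by rewrite -EFinB /=; move: c1; lra.
  rewrite ler_pdivlMr//.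
  have -> : (1 + a) ^+ 3 = 1 + 3 * a + 3 * a ^+ 2 + a ^+ 3 by ring.
  have a2 : a ^+ 2 <= 1 by rewrite expr_le1// ltW.
  have a3 : a ^+ 3 <= 1 by rewrite expr_le1// ltW.
  lra.
have tn0 : theta != 0 by rewrite -normr_gt0; apply: lt_le_trans t1.
rewrite bump_hatE//.
have agt0 : 0 < a by lra.
have a3 : 0 < a ^+ 3 by rewrite exprn_gt0.
have sin1 : `|sin (theta * c)| <= 1 by rewrite ler_norml sin_geN1 sin_le1.
have cos1 : `|cos (theta * c)| <= 1 by rewrite ler_norml cos_geN1 cos_le1.
have c2 : `|c ^+ 2| <= 1 by rewrite ger0_norm ?sqr_ge0// expr_le1// ltW.
have cn : `|c| <= 1 by rewrite ger0_norm// ltW.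
have inv k : (3 <= k)%N -> `|(theta ^+ k)^-1| <= (a ^+ 3)^-1.
  move=> k3; rewrite normfV normrX -/a lef_pV2 ?posrE ?exprn_gt0//.
  exact: ler_weXn2l.
have aux x y z : `|x| <= 1 -> `|y| <= 1 -> `|z| <= (a ^+ 3)^-1 ->
    `|x * y * z| <= (a ^+ 3)^-1.
  move=> hx hy hz; rewrite !normrM -[leRHS]mul1r ler_pM ?mulr_ge0//.
  by rewrite -[leRHS]mulr1 ler_pM.
have b1 : `|- 16 * c ^+ 2 * sin (theta * c) / theta ^+ 3| <= 16 * (a ^+ 3)^-1.
  rewrite (_ : _ / _ = - 16 * (c ^+ 2 * sin (theta * c) * (theta ^+ 3)^-1)); last by ring.
  rewrite normrM normrN [`|16|]ger0_norm// ler_pM2l//.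
  exact: (aux _ _ _ c2 sin1 (inv 3%N isT)).
have b2 : `|48 * c * cos (theta * c) / theta ^+ 4| <= 48 * (a ^+ 3)^-1.
  rewrite (_ : _ / _ = 48 * (c * cos (theta * c) * (theta ^+ 4)^-1)); last by ring.
  rewrite normrM [`|48|]ger0_norm// ler_pM2l//.
  exact: (aux _ _ _ cn cos1 (inv 4%N isT)).
have b3 : `|48 * sin (theta * c) / theta ^+ 5| <= 48 * (a ^+ 3)^-1.
  rewrite (_ : _ / _ = 48 * (1 * sin (theta * c) * (theta ^+ 5)^-1)); last by ring.
  rewrite normrM [`|48|]ger0_norm// ler_pM2l//.
  by apply: (aux _ _ _ _ sin1 (inv 5%N isT)); rewrite normr1.
apply: (@le_trans _ _ (112 * (a ^+ 3)^-1)).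
  apply: le_trans (ler_normD _ _) _; apply: le_trans (lerD (ler_normB _ _) (lexx _)) _.
  lra.
rewrite ler_pdivlMr// mulrAC ler_pdivrMr//.
have -> : (1 + a) ^+ 3 = 1 + 3 * a + 3 * a ^+ 2 + a ^+ 3 by ring.
have e1 : a <= a ^+ 3 by apply: ler_eXnr => //.
have e2 : a ^+ 2 <= a ^+ 3 by apply: ler_weXn2l.
have e3 : 1 <= a ^+ 3 by apply: exprn_ege1.
lra.
Qed.

(** Unlike the squared polynomial [q], [bump] vanishes outside [-c, c]. *)
Definition bump (s : R) : R := Num.max 0 (c ^+ 2 - s ^+ 2) ^+ 2.

Lemma bumpE s : bump s = (q \_ `[- c, c]) s.
Proof.
rewrite patchE /bump; case: ifPn => [|/negP].
  rewrite inE /= in_itv /= -ler_norml => sc.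
  have s2 : s ^+ 2 <= c ^+ 2.
    by rewrite -(real_normK (num_real s)) ler_pXn2r ?nnegrE// ltW.
  by rewrite max_r ?subr_ge0.
rewrite inE /= in_itv /= -ler_norml => /negP; rewrite -ltNge => sc.
rewrite max_l ?expr0n// subr_le0 -(real_normK (num_real s)).
by rewrite ler_pXn2r ?nnegrE// ltW.
Qed.

Lemma bump_ge0 s : 0 <= bump s.
Proof. exact: sqr_ge0. Qed.

Lemma bump_le1 s : bump s <= 1.
Proof.
rewrite /bump expr_le1// ?le_max ?lexx// ge_max ler01 /=.
have : c ^+ 2 <= 1 by rewrite expr_le1// ltW.
by have := sqr_ge0 s; lra.
Qed.

Lemma measurable_bump : measurable_fun [set: R] bump.
Proof.
apply: measurable_funX; apply: measurable_maxr; first exact: measurable_cst.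
by apply: measurable_funB => //; exact: measurable_funX.
Qed.

Definition bump_rV n (x : 'rV[R]_n) : R := \prod_(i < n) bump (x ord0 i).

Lemma bump_rV_ge0 n (x : 'rV[R]_n) : 0 <= bump_rV x.
Proof. by apply: prodr_ge0 => i _; exact: bump_ge0. Qed.

Lemma bump_rV_le1 n (x : 'rV[R]_n) : bump_rV x <= 1.
Proof. by apply: prodr_ile1 => i _; rewrite bump_ge0 bump_le1. Qed.

Lemma measurable_bump_rV n : measurable_fun [set: 'rV[R]_n] (@bump_rV n).
Proof.
apply: measurable_prod => i _.
by apply: (measurableT_comp measurable_bump); exact: measurable_coordT.
Qed.

Lemma bump_rV_out n (x : 'rV[R]_n) : n%:R * c ^+ 2 <= 1 ->
  ~ @unit_ball R n x -> bump_rV x = 0.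
Proof.
move=> nc; rewrite unit_ballE /= => xout; apply/eqP; apply: contraT => p0.
exfalso; apply: xout; apply: le_trans nc.
rewrite -[n in n%:R]card_ord -sum1_card natr_sum mulr_suml.
apply: ler_sum => i _; rewrite mul1r -expr2 leNgt; apply/negP => ci.
move: p0; rewrite /bump_rV (bigD1 i)//= /bump max_l ?expr0n ?mul0r ?eqxx//.
by rewrite subr_le0 ltW.
Qed.

Lemma bump_rV_integrable n (f : 'rV[R]_n -> R) : n%:R * c ^+ 2 <= 1 ->
  measurable_fun [set: 'rV[R]_n] f -> (forall x, `|f x| <= 1) ->
  lebesgue_rV.-integrable setT (fun x => (bump_rV x * f x)%:E).
Proof.
move=> nc mf f1.
have mU : measurable (@unit_ball R n) by exact: measurable_unit_ball.
rewrite (_ : (fun x => _) = (fun x => (bump_rV x * f x)%:E) \_ (@unit_ball R n)).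
  apply/integrable_restrict => //; rewrite setTI.
  apply: (@bounded_integrable_ball _ _ _ 1) => [|x].
    by apply: measurable_funM => //; exact: measurable_bump_rV.
  rewrite normrM -[leRHS]mulr1 ler_pM//.
  by rewrite ger0_norm ?bump_rV_ge0 ?bump_rV_le1.
apply/funext => x; rewrite patchE; case: ifPn => // /negP; rewrite inE => xU.
by rewrite bump_rV_out ?mul0r.
Qed.

Let measurable_phase n (theta : 'rV[R]_n) (tau : R) :
  measurable_fun [set: 'rV[R]_n] (fun x : 'rV[R]_n => cos (dotp x theta + tau)).
Proof.
apply: measurable_cosM; apply: measurable_funD => //; exact: measurable_dotp.
Qed.

Let cos_norm_le1 (t : R) : `|cos t| <= 1.
Proof. by rewrite ler_norml cos_geN1 cos_le1. Qed.

(** The phase [tau] stands for the other coordinates in the induction on the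
    dimension; by parity only its cosine remains. *)
Lemma bump_rV_phase n (theta : 'rV[R]_n) tau : n%:R * c ^+ 2 <= 1 ->
  (\int[lebesgue_rV]_x (bump_rV x * cos (dotp x theta + tau))%:E =
   (cos tau * \prod_(i < n) bump_hat (theta ord0 i))%:E)%E.
Proof.
elim: n theta tau => [|n IH] theta tau nc.
  rewrite (_ : (fun x => _) = cst (cos tau)%:E); last first.
    by apply/funext => x; rewrite /bump_rV /dotp !big_ord0 add0r mul1r.
  rewrite integral_cst// big_ord0 mulr1.
  rewrite [X in (_ * X)%E](_ : _ = 1%E) ?mule1//.
  by rewrite /= diracE mem_set.
have nc' : n%:R * c ^+ 2 <= 1.
  apply: le_trans nc; rewrite ler_wpM2r ?sqr_ge0// ler_nat//.
rewrite integral_lebesgue_rVS; last first.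
  exact: (bump_rV_integrable nc (measurable_phase _ _) (fun=> cos_norm_le1 _)).
pose P := \prod_(i < n) bump_hat (theta ord0 (lift ord0 i)).
transitivity (\int[mu]_s ((fun s => (P * (q s * cos (theta ord0 ord0 * s + tau)))%:E)
    \_ `[(- c)%R, c]) s)%E.
  apply: eq_integral => s _.
  pose theta' := \row_(i < n) theta ord0 (lift ord0 i).
  transitivity (\int[lebesgue_rV]_y ((bump s)%:E *
    (bump_rV y * cos (dotp y theta' + (theta ord0 ord0 * s + tau)))%:E))%E.
    apply: eq_integral => y _; rewrite -EFinM; congr EFin.
    rewrite /bump_rV big_ord_recl cons_rV0 dotp_cons_rV mulrA; congr (_ * _ * cos _).
      by apply: eq_bigr => i _; rewrite cons_rVS.
    by rewrite /theta' [s * _]mulrC; ring.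
  rewrite integralZl//; last first.
    exact: (bump_rV_integrable nc' (measurable_phase _ _) (fun=> cos_norm_le1 _)).
  rewrite IH// -EFinM bumpE !patchE; case: ifP => _; last by rewrite mul0r.
  congr EFin; rewrite (eq_bigr (fun i => bump_hat (theta ord0 (lift ord0 i)))).
    by rewrite -/P; ring.
  by move=> i _; rewrite mxE.
rewrite -integral_mkcond.
have cq : continuous (fun s => q s * cos (theta ord0 ord0 * s + tau)).
  apply: continuous_mul => // s.
  apply: (@continuous_comp _ _ _ (fun s => theta ord0 ord0 * s + tau) cos);
    last exact: continuous_cos.
  by apply: cvgD; [exact: mulrl_continuous|exact: cvg_cst].
have int : mu.-integrable `[- c, c]
    (fun s => (P * (q s * cos (theta ord0 ord0 * s + tau)))%:E).
  apply: (continuous_integrable_itv _ _ (continuous_mul _ cq)).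
  by move=> s; exact: cvg_cst.
rewrite -[LHS]fineK; last exact: integrable_fin_num.
rewrite -/(Rintegral _ _ _) RintegralZl//; last exact: continuous_integrable_itv.
rewrite bump_phase_integral big_ord_recl; congr EFin; rewrite /P; ring.
Qed.

End bump.

(** * Frequencies of a basis of exponentials *)

Section exponentials.
Context {R : realType}.
Implicit Types (d : nat).

Lemma sqmod_expo d (a x : 'rV[R]_d) : sqmod (expo a x) = 1.
Proof. by rewrite /sqmod /expo /cis /= cos2Dsin2. Qed.

Lemma measurable_sinM (dS : measure_display) (S : measurableType dS) (f : S -> R) :
  measurable_fun [set: S] f -> measurable_fun [set: S] (fun x => sin (f x)).
Proof.
move=> mf; apply: (measurableT_comp _ mf).
apply: (@continuous_measurable_fun R sin) => x.
exact: continuous_sin.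
Qed.

Lemma measurable_expo_phase d (a : 'rV[R]_d) :
  measurable_fun [set: 'rV[R]_d] (fun x => 2 * pi * dotp x a).
Proof. by apply: measurable_funM => //; exact: measurable_dotp. Qed.

Lemma sqmod_cisB (s t : R) : sqmod (cis s - cis t) <= 2 * (s - t) ^+ 2.
Proof.
rewrite /sqmod /cis /= -(real_normK (num_real (s - t))).
rewrite -(real_normK (num_real (cos s - cos t))) -(real_normK (num_real (sin s - sin t))).
have := ler_dist_cos s t; have := ler_dist_sin s t.
have := normr_ge0 (cos s - cos t); have := normr_ge0 (sin s - sin t).
nra.
Qed.

Lemma sqmod_expoB d (a b x : 'rV[R]_d) eta : unit_ball x ->
  (forall i, `|a ord0 i - b ord0 i| <= eta) ->
  sqmod (expo a x - expo b x) <= 2 * (2 * pi * (d%:R * eta)) ^+ 2.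
Proof.
move=> xB ab; rewrite /expo; apply: le_trans (sqmod_cisB _ _) _.
rewrite ler_pM2l// -mulrBr -dotpBr -(real_normK (num_real (_ * _))).
have eta0 : 0 <= d%:R * eta.
  case: d a b x xB ab => [|d'] a b x xB ab; first by rewrite mul0r.
  by rewrite mulr_ge0//; exact: le_trans (ab ord0).
have pi2 : 0 <= 2 * pi :> R by rewrite mulr_ge0 ?pi_ge0.
have Y0 : 0 <= 2 * pi * (d%:R * eta) by exact: mulr_ge0.
rewrite ler_pXn2r ?nnegrE//.
rewrite normrM (ger0_norm pi2) ler_wpM2l//.
apply: le_trans (ler_norm_sum _ _ _) _.
rewrite -[d in leRHS]card_ord -sum1_card natr_sum mulr_suml.
apply: ler_sum => i _; rewrite mul1r normrM !mxE -[leRHS]mul1r.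
by apply: ler_pM => //; exact: unit_ball_coord.
Qed.

End exponentials.

Section exponential_bases.
Context {R : realType} {d : nat} (d_gt0 : (0 < d)%N).
Variable a : nat -> 'rV[R]_d.
Local Notation B := (@unit_ball R d).
Local Notation lam := (@lebesgue_rV R d).
Hypothesis basis : schauder_basis_L2 lam B (fun n => expo (a n)).

Let mB : measurable B := measurable_unit_ball.
Local Notation V := (L2space lam mB).

Let kappa : R := projT1 (cid2 (unit_ball_volume d)).
Let kappa0 : 0 < kappa. Proof. by rewrite /kappa; case: cid2. Qed.
Let kappaE : lam B = kappa%:E. Proof. by rewrite /kappa; case: cid2. Qed.

Let e k : V := toL2 mB (basis.1 k).

Let L2norm_expo (q : 'rV[R]_d) : L2norm lam B (expo q) = (Num.sqrt kappa)%:E.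
Proof.
rewrite L2normE; under eq_integral do rewrite sqmod_expo.
rewrite integral_cst// mul1e [X in (X `^ _)%E](_ : _ = kappa%:E) -?kappaE//.
by rewrite kappaE poweR_EFin powR12_sqrt// ltW.
Qed.

Let expo_L2 (q : 'rV[R]_d) : in_L2 lam B (expo q).
Proof.
split; last by rewrite L2norm_expo ltry.
split; apply: measurable_funTS; [apply: measurable_cosM|apply: measurable_sinM];
  exact: measurable_expo_phase.
Qed.

Let coef_bound : exists2 M : R, 0 < M & forall (f : V) (c : nat -> R[i]),
  (L2norm lam B (fun x => f x - \sum_(k < n) c k * expo (a k) x) @[n --> \oo] --> 0%E) ->
  forall rho, 0 < rho -> L2N f <= rho ->
  forall k, Normc.normc (c k) <= M * rho.
Proof.
have [||M M0 H] := @schauder_basis_L2_coef_bounded R _ _ _ _ mB _ (Num.sqrt kappa) basis.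
- by rewrite sqrtr_gt0.
- by move=> k; rewrite L2norm_expo.
- by exists M.
Qed.

(** The difference of two exponentials of the basis has the coefficient 1, while
    its norm is at most [C] times the distance of the two frequencies. *)
Lemma exp_basis_separated : exists2 delta : R, 0 < delta &
  forall k l, k != l -> exists i, delta <= `|a k ord0 i - a l ord0 i|.
Proof.
have [M M0 HM] := coef_bound.
pose C : R := 4 * pi * d.+1%:R * (1 + kappa).
have C0 : 0 < C by rewrite /C !mulr_gt0 ?pi_gt0// addr_gt0.
pose delta := (2 * (M * C))^-1.
have delta0 : 0 < delta by rewrite invr_gt0 mulr_gt0// mulr_gt0.
exists delta => // k l kl; apply: contrapT => near.
have {}near i : `|a k ord0 i - a l ord0 i| <= delta.
  by rewrite leNgt; apply/negP => /ltW ?; apply: near; exists i.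
pose f : V := e k - e l.
pose c (j : nat) : R[i] := (j == k)%:R - (j == l)%:R.
have sum1 (m n : nat) (g : nat -> R[i]) : (m < n)%N ->
    \sum_(j < n) (nat_of_ord j == m)%:R * g j = g m.
  move=> mn; rewrite (bigD1 (Ordinal mn))//= eqxx mul1r big1 ?addr0// => j jm.
  suff -> : (nat_of_ord j == m) = false by rewrite mul0r.
  by apply: contraNF jm => /eqP jm; apply/eqP/val_inj.
have conv : L2norm lam B (fun x => f x - \sum_(k < n) c k * expo (a k) x)
    @[n --> \oo] --> 0%E.
  apply: cvg_near_cst; exists (maxn k l).+1 => // n /= kln.
  rewrite L2normE (_ : (\int[_]_(x in _) _)%E = 0%E).
    by rewrite poweR0r// invr_neq0.
  apply: integral0_eq => x _.
  rewrite /c; under eq_bigr do rewrite mulrBl.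
  have kn : (k < n)%N by apply: leq_trans kln; rewrite ltnS leq_maxl.
  have ln : (l < n)%N by apply: leq_trans kln; rewrite ltnS leq_maxr.
  rewrite sumrB (sum1 _ _ (fun j => expo (a j) x) kn) (sum1 _ _ (fun j => expo (a j) x) ln).
  by rewrite /sqmod subrr /= expr0n addr0.
have rho0 : 0 < C * delta by rewrite mulr_gt0.
have frho : L2N f <= C * delta.
  rewrite -(@ler_pXn2r _ 2) ?nnegrE ?L2N_ge0 ?(ltW rho0)//.
  rewrite -lee_fin -integral_sqmod.
  apply: (@le_trans _ _ (\int[lam]_(x in B) (2 * (2 * pi * (d%:R * delta)) ^+ 2)%:E)%E).
    apply: ge0_le_integral => //.
    - by move=> x _; rewrite lee_fin sqmod_ge0.
    - by apply/measurable_EFinP/measurable_sqmod; have [] := L2spaceP f.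
    - by move=> x Bx; rewrite lee_fin; exact: sqmod_expoB.
  rewrite integral_cst// [X in (_ * X)%E](_ : _ = kappa%:E) ?kappaE// -EFinM lee_fin.
  rewrite /C -[d.+1%:R]natr1.
  set X := 2 * pi * (d%:R * delta).
  have X0 : 0 <= X by rewrite !mulr_ge0 ?pi_ge0// ltW.
  have Y0 : 0 <= 2 * pi * delta by rewrite !mulr_ge0 ?pi_ge0// ltW.
  have -> : 4 * pi * (d%:R + 1) * (1 + kappa) * delta =
    2 * (X + 2 * pi * delta) * (1 + kappa) by rewrite /X; ring.
  set Y := 2 * pi * delta in Y0 *.
  have k0 := kappa0.
  have h1 : X ^+ 2 <= (X + Y) ^+ 2 by rewrite ler_pXn2r ?nnegrE ?addr_ge0// lerDl.
  have h2 : 2 * kappa <= 2 ^+ 2 * (1 + kappa) ^+ 2 by nra.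
  have h3 : 0 <= X ^+ 2 by exact: sqr_ge0.
  have h4 : 0 <= 2 * kappa by rewrite mulr_ge0// ltW.
  have := ler_pM h3 h4 h1 h2; lra.
have := HM f c conv _ rho0 frho k.
rewrite /c eqxx (negbTE kl) subr0 Normc.normc1 leNgt => /negP; apply.
have -> : M * (C * delta) = 1 / 2 by rewrite /delta; field; rewrite !gt_eqF.
lra.
Qed.

Let b : R := d%:R^-1.
Let b0 : 0 < b. Proof. by rewrite invr_gt0 ltr0n. Qed.
Let b1 : b <= 1. Proof. by rewrite invf_le1 ?ltr0n// ler1n. Qed.
Let db : d%:R * b ^+ 2 <= 1.
Proof.
rewrite /b expr2 mulrA divff ?mul1r//.
by rewrite pnatr_eq0 -lt0n.
Qed.

Let wave (p : 'rV[R]_d) : 'rV[R]_d -> R[i] := fun x => (bump_rV b x)%:C%C * expo p x.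

Let wave_L2 p : in_L2 lam B (wave p).
Proof.
have mbump := measurable_bump_rV b (n := d).
apply/in_L2P; split.
  split; apply: measurable_funTS.
    under eq_fun do rewrite ReM /= mul0r subr0.
    apply: measurable_funM => //; apply: measurable_cosM.
    exact: measurable_expo_phase.
  under eq_fun do rewrite ImM /= mul0r addr0.
  apply: measurable_funM => //; apply: measurable_sinM.
  exact: measurable_expo_phase.
rewrite (_ : (fun x => _) = EFin \o (fun x => bump_rV b x ^+ 2)).
  apply: (@bounded_integrable_ball _ _ _ 1); first exact: measurable_funX.
  move=> x; rewrite ger0_norm ?sqr_ge0// expr_le1 ?bump_rV_ge0//.
  exact: bump_rV_le1.
apply/funext => x /=; rewrite /wave sqmodM sqmod_expo mulr1.
by rewrite /sqmod /= expr0n addr0.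
Qed.

Let W p : V := toL2 mB (wave_L2 p).

Let integral_ball_bump (theta : 'rV[R]_d) (tau : R) :
  \int[lam]_(x in B) (bump_rV b x * cos (dotp x theta + tau)) =
  cos tau * \prod_(i < d) bump_hat b (theta ord0 i).
Proof.
rewrite /Rintegral integral_mkcond -[RHS]/(fine (_%:E)) -bump_rV_phase//.
congr fine; apply: eq_integral => x _; rewrite patchE; case: ifPn => // /negP.
by rewrite inE => xB; rewrite bump_rV_out// mul0r.
Qed.

Let dot_expo_wave (z : R[i]) (q p : 'rV[R]_d) :
  L2dot lam B (fun x => z * expo q x) (wave p) =
  complex.Re z * \prod_(i < d) bump_hat b (2 * pi * (q ord0 i - p ord0 i)).
Proof.
pose theta := (2 * pi) *: (q - p).
have int tau : lam.-integrable B (fun x => (bump_rV b x * cos (dotp x theta + tau))%:E).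
  apply: (@bounded_integrable_ball _ _ _ 1).
    apply: measurable_funM; first exact: measurable_bump_rV.
    by apply: measurable_cosM; apply: measurable_funD => //; exact: measurable_dotp.
  move=> x; rewrite normrM -[leRHS]mulr1 ler_pM//; last first.
    by rewrite ler_norml cos_geN1 cos_le1.
  by rewrite ger0_norm ?bump_rV_ge0 ?bump_rV_le1.
transitivity (\int[lam]_(x in B)
   (complex.Re z * (bump_rV b x * cos (dotp x theta + 0)) +
    complex.Im z * (bump_rV b x * cos (dotp x theta + pi / 2)))).
  apply: eq_Rintegral => x _; rewrite /wave !ReM !ImM /= cosDpihalf addr0.
  have -> : dotp x theta = 2 * pi * dotp x q - 2 * pi * dotp x p.
    by rewrite /theta dotpZr dotpBr mulrBr.
  by rewrite cosB sinB; ring.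
rewrite RintegralD//; [|exact: (integrableZl mB _ (int 0))|
  exact: (integrableZl mB _ (int _))].
rewrite !RintegralZl//; [|exact: int..].
transitivity (complex.Re z * (cos 0 * \prod_(i < d) bump_hat b (theta ord0 i)) +
    complex.Im z * (cos (pi / 2) * \prod_(i < d) bump_hat b (theta ord0 i))).
  by congr (_ * _ + _ * _); exact: integral_ball_bump.
rewrite cos0 cos_pihalf mul0r mulr0 addr0 mul1r.
by congr (_ * _); apply: eq_bigr => i _; rewrite !mxE.
Qed.

(** Pairing the expansion of the wave packet [W p] with [W p] gives
    [nu ^+ 2 <= M * nu * sum_k |w k|] for its norm [nu]. If all the frequencies
    were at distance at least [r] from [p], the sum would be [O(1 / (1 + r))],
    whereas [nu] is bounded from below by pairing [W p] with the exponential of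
    frequency [p]. *)
Lemma exp_basis_relatively_dense :
  exists2 r : R, 0 < r & forall p : 'rV[R]_d, exists k, forall i, `|a k ord0 i - p ord0 i| < r.
Proof.
have [M M0 HM] := coef_bound.
have [delta0 delta0_gt0 sep] := exp_basis_separated.
pose delta := Num.min 1 (2 * pi * delta0).
have pi2 : 0 < 2 * pi :> R by rewrite mulr_gt0 ?pi_gt0.
have delta_gt0 : 0 < delta by rewrite lt_min ltr01 mulr_gt0.
have delta1 : delta <= 1 by rewrite ge_min lexx.
have [K K0 decay] : exists2 K : R, 0 < K &
    forall t, `|bump_hat b t| <= K / (1 + `|t|) ^+ 3.
  by exists 900; [rewrite ltr0n|move=> t; exact: bump_hat_decay].
pose A : R := K ^+ d * (8 / delta ^+ 2) ^+ d.
have A0 : 0 < A by rewrite mulr_gt0// exprn_gt0// divr_gt0// exprn_gt0.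
pose h0 := bump_hat b 0 ^+ d.
have h00 : 0 < h0 by rewrite exprn_gt0//; exact: bump_hat0_gt0.
have sk0 : 0 < Num.sqrt kappa by rewrite sqrtr_gt0.
pose r := M * A * Num.sqrt kappa / h0.
have r0 : 0 < r by rewrite divr_gt0//; apply: mulr_gt0 => //; exact: mulr_gt0.
exists r => // p; apply: contrapT => nex.
have far k : exists i, r <= `|a k ord0 i - p ord0 i|.
  apply: contrapT => nk; apply: nex; exists k => i.
  by rewrite ltNge; apply/negP => ri; apply: nk; exists i.
pose w k := \prod_(i < d) bump_hat b (2 * pi * (a k ord0 i - p ord0 i)).
have wsum n : \sum_(k < n) `|w k| <= A / (1 + r).
  pose eta (k : 'I_n) : 'rV[R]_d := (2 * pi) *: (a k - p).
  have etaE k i : eta k ord0 i = 2 * pi * (a k ord0 i - p ord0 i) by rewrite !mxE.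
  have eta_sep k l : k != l -> exists i, delta <= `|eta k ord0 i - eta l ord0 i|.
    move=> kl; have [i di] := sep k l kl; exists i.
    rewrite !etaE -mulrBr opprB addrA subrK normrM (gtr0_norm pi2).
    by rewrite ge_min ler_pM2l// di orbT.
  have p0 (t : R) : 0 < 1 + `|t| by rewrite ltr_pwDl.
  have wk (k : 'I_n) : `|w k| <= K ^+ d / (1 + r) * \prod_(i < d) (1 + `|eta k ord0 i|) ^- 2.
    have [j rj] := far k.
    have rj' : r <= `|eta k ord0 j|.
      rewrite etaE normrM (gtr0_norm pi2); apply: le_trans rj _.
      rewrite ler_peMl//; have := @pi_ge2 R; lra.
    rewrite /w normr_prod.
    apply: (@le_trans _ _ (\prod_(i < d) (K / (1 + `|eta k ord0 i|) ^+ 3))).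
      by apply: ler_prod => i _; rewrite normr_ge0 etaE /=; exact: decay.
    have -> : \prod_(i < d) (K / (1 + `|eta k ord0 i|) ^+ 3) =
        K ^+ d * (\prod_(i < d) (1 + `|eta k ord0 i|)^-1 *
                   \prod_(i < d) (1 + `|eta k ord0 i|) ^- 2).
      rewrite -[in K ^+ d](card_ord d) -prodr_const -!big_split /=.
      by apply: eq_bigr => i _; rewrite exprS invfM.
    rewrite -mulrA ler_pM2l ?exprn_gt0// ler_wpM2r//.
      by apply: prodr_ge0 => i _; rewrite invr_ge0 exprn_ge0// ltW.
    rewrite (bigD1 j)//= -[leRHS]mulr1 ler_pM ?invr_ge0 ?(ltW (p0 _))//.
    - by apply: prodr_ge0 => i _; rewrite invr_ge0 ltW.
    - by rewrite lef_pV2 ?posrE ?p0 ?addr_gt0// lerD2l.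
    - apply: prodr_ile1 => i _; rewrite invr_ge0 (ltW (p0 _)) /=.
      by rewrite invf_le1// lerDl.
  apply: (@le_trans _ _ (\sum_(k < n)
      K ^+ d / (1 + r) * \prod_(i < d) (1 + `|eta k ord0 i|) ^- 2)).
    exact: ler_sum.
  have -> : A / (1 + r) = K ^+ d / (1 + r) * (8 / delta ^+ 2) ^+ d.
    by rewrite /A mulrAC.
  rewrite -mulr_sumr; apply: ler_wpM2l.
    by apply: divr_ge0; [exact/exprn_ge0/ltW|exact/ltW/addr_gt0].
  exact: separated_sum_bound.
pose nu := L2N (W p).
have h0nu : h0 <= nu * Num.sqrt kappa.
  have eL := expo_L2 p.
  have Ne : L2N (toL2 mB eL) = Num.sqrt kappa by rewrite /L2N [L2norm _ _ _]L2norm_expo.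
  have := L2_cauchy_schwarz (W p) (toL2 mB eL); rewrite Ne; apply: le_trans.
  rewrite L2dotC -[X in L2dot _ _ X _](_ : (fun x => 1 * expo p x) = _); last first.
    by apply/funext => x; rewrite mul1r.
  rewrite dot_expo_wave mul1r (eq_bigr (fun=> bump_hat b 0)).
    by rewrite prodr_const card_ord ler_norm.
  by move=> i _; rewrite subrr mulr0.
have nu0 : 0 < nu.
  rewrite ltNge; apply/negP => nu0; have : h0 <= 0.
    by apply: le_trans h0nu _; rewrite mulr_le0_ge0// ltW.
  by rewrite leNgt h00.
have [c [cP _]] := basis.2 (wave p) (wave_L2 p).
have cb := HM (W p) c cP nu nu0 (lexx _).
pose S n : V := \sum_(k < n) c k *: e k.
have dotS n : L2dot lam B (S n) (W p) <= M * nu * (A / (1 + r)).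
  have -> : L2dot lam B (S n) (W p) = \sum_(k < n) complex.Re (c k) * w k.
    rewrite /S; elim: n => [|n IH]; first by rewrite !big_ord0 L2dot0l.
    rewrite !big_ord_recr L2dotDl IH; congr (_ + _).
    exact: dot_expo_wave.
  apply: le_trans (_ : \sum_(k < n) M * nu * `|w k| <= _).
    apply: ler_sum => k _; apply: le_trans (ler_norm _) _; rewrite normrM.
    by rewrite ler_wpM2r// (le_trans (normc_Re _)).
  by rewrite -mulr_sumr ler_wpM2l// mulr_ge0// ltW.
have nu2 : nu ^+ 2 <= M * nu * (A / (1 + r)).
  apply/ler_addgt0Pr => eps eps0.
  have : (L2N (W p - S n))%:E @[n --> \oo] --> 0%E.
    rewrite (_ : (fun n => _) = (fun n =>
      L2norm lam B (fun x => W p x - \sum_(k < n) c k * expo (a k) x)))//.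
    by apply/funext => n; rewrite (L2N_expansion c e (W p)).
  move/cvg_EFin0P => /(_ (fun=> L2N_ge0 _))/(_ (eps / nu)).
  rewrite divr_gt0// => /(_ isT)[n /(_ n (leqnn n)) Hn].
  rewrite sqr_L2N -[X in L2dot _ _ (L2fun X) _](subrK (S n)).
  rewrite L2dotDl addrC; apply: lerD; first exact: dotS.
  apply: le_trans (ler_norm _) _; apply: le_trans (L2_cauchy_schwarz _ _) _.
  by rewrite -ler_pdivlMr.
have : nu <= M * (A / (1 + r)).
  by rewrite -(ler_pM2r nu0) -expr2 mulrAC.
rewrite -(ler_pM2r sk0) => H.
have := le_trans h0nu H; rewrite leNgt => /negP; apply.
have r1 : 0 < 1 + r by rewrite addr_gt0.
have -> : M * (A / (1 + r)) * Num.sqrt kappa = r * h0 / (1 + r).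
  have -> : r * h0 = M * A * Num.sqrt kappa by rewrite divfK// gt_eqF.
  by rewrite mulrA mulrAC.
by rewrite ltr_pdivrMr// mulrDr mulr1 [h0 * r]mulrC ltrDr.
Qed.

End exponential_bases.

(** * Distances to a point going to infinity *)

Section euclidean_geometry.
Context {R : realType} {d : nat}.
Implicit Types x y z u v e : 'rV[R]_d.

Lemma dotp_cauchy_schwarz x y : `|dotp x y| <= enorm x * enorm y.
Proof.
have [->|y0] := eqVneq y 0.
  have -> : dotp x 0 = 0 by rewrite -(scale0r x) dotpZr mul0r.
  by rewrite normr0 mulr_ge0 ?enorm_ge0.
have yy : 0 < dotp y y.
  by rewrite lt_neqAle dotp_ge0 andbT eq_sym; apply: contra y0 => /eqP/dotp_eq0 ->.
have : 0 <= dotp (dotp y y *: x - dotp x y *: y) (dotp y y *: x - dotp x y *: y).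
  exact: dotp_ge0.
rewrite dotpBl !dotpBr !(dotpZl, dotpZr) (dotpC y x).
have -> : dotp y y * (dotp y y * dotp x x) - dotp y y * (dotp x y * dotp x y) -
    (dotp x y * (dotp y y * dotp x y) - dotp x y * (dotp x y * dotp y y)) =
    dotp y y * (dotp x x * dotp y y - dotp x y ^+ 2) by ring.
rewrite pmulr_rge0// subr_ge0 -!sqr_enorm -exprMn => H.
by rewrite -ler_sqr ?nnegrE ?mulr_ge0 ?enorm_ge0// real_normK// num_real.
Qed.

Lemma ler_enormD x y : enorm (x + y) <= enorm x + enorm y.
Proof.
rewrite -ler_sqr ?nnegrE ?addr_ge0 ?enorm_ge0// sqr_enorm dotpDl !dotpDr.
rewrite (dotpC y x) sqrrD !sqr_enorm.
have := le_trans (ler_norm _) (dotp_cauchy_schwarz x y); rewrite mulr2n; lra.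
Qed.

Lemma enormN x : enorm (- x) = enorm x.
Proof. by rewrite /enorm dotpNl dotpNr opprK. Qed.

Lemma ler_dist_enorm x y : `|enorm (x + y) - enorm x| <= enorm y.
Proof.
rewrite ler_distl; apply/andP; split; last exact: ler_enormD.
by have := ler_enormD (x + y) (- y); rewrite addrK enormN; lra.
Qed.

Lemma enormZ (c : R) x : enorm (c *: x) = `|c| * enorm x.
Proof.
by rewrite /enorm dotpZl dotpZr mulrA -expr2 sqrtrM ?sqr_ge0// sqrtr_sqr.
Qed.

Lemma enorm_coord_bound (r : R) x : 0 <= r -> (forall i, `|x ord0 i| <= r) ->
  enorm x <= d%:R * r.
Proof.
move=> r0 xr; rewrite -ler_sqr ?nnegrE ?enorm_ge0 ?mulr_ge0//.
rewrite sqr_enorm /dotp (@le_trans _ _ (\sum_(i < d) r ^+ 2))//.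
  apply: ler_sum => i _; rewrite -expr2 -[leLHS]real_normK ?num_real//.
  by rewrite ler_sqr ?nnegrE.
rewrite sumr_const card_ord -[leLHS]mulr_natl exprMn ler_wpM2r ?sqr_ge0//.
by rewrite -natrX ler_nat; case: (d) => // m; rewrite leq_pmulr.
Qed.

(** Add [v] to a large multiple of a vector orthogonal to [v], and normalize;
    such a vector exists as the dimension is at least 2. *)
Lemma unit_vector_small_slope v : (1 < d)%N -> v != 0 ->
  exists u, [/\ enorm u = 1, 0 < dotp u v & dotp u v < 1 / 2].
Proof.
move=> d1 v0.
have vv : 0 < dotp v v.
  by rewrite lt_neqAle dotp_ge0 andbT eq_sym; apply: contra v0 => /eqP/dotp_eq0 ->.
have [w0 ww wv] : exists2 w0, 0 < dotp w0 w0 & dotp w0 v = 0.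
  have [i vi] : exists i, v ord0 i != 0.
    apply: contrapT => nv; case/eqP: v0; apply/rowP => i; rewrite mxE.
    by apply: contrapT => vi; apply: nv; exists i; exact/eqP.
  have [j ji] : exists j : 'I_d, j != i.
    have [i0|i0] := eqVneq (i : nat) 0%N.
      by exists (Ordinal d1); rewrite -val_eqE /= i0.
    by exists (Ordinal (ltnW d1)); rewrite -val_eqE /= eq_sym.
  pose w0 : 'rV[R]_d := v ord0 j *: delta_mx ord0 i - v ord0 i *: delta_mx ord0 j.
  have dot_delta k x : dotp (delta_mx ord0 k) x = x ord0 k.
    rewrite /dotp (bigD1 k)//= mxE !eqxx mul1r big1 ?addr0// => l lk.
    by rewrite mxE (negbTE lk) andbF mul0r.
  exists w0; last by rewrite dotpBl !dotpZl !dot_delta mulrC subrr.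
  rewrite lt_neqAle dotp_ge0 andbT eq_sym; apply/eqP => /dotp_eq0 /rowP/(_ j).
  rewrite !mxE !eqxx (negbTE ji) /= mulr0 sub0r mulr1 => /eqP.
  by rewrite oppr_eq0 (negbTE vi).
have w0_gt0 : 0 < enorm w0 by rewrite sqrtr_gt0.
pose N := (2 * dotp v v + 1) / enorm w0.
pose w := N *: w0 + v.
have wvE : dotp w v = dotp v v by rewrite dotpDl dotpZl wv mulr0 add0r.
have wwE : enorm w ^+ 2 = (2 * dotp v v + 1) ^+ 2 + dotp v v.
  rewrite sqr_enorm dotpDr wvE dotpDl dotpZr (dotpC v) !dotpZl wv !mulr0 addr0.
  congr (_ + _); rewrite -sqr_enorm /N mulrA -expr2 -exprMn divfK//.
  by rewrite gt_eqF.
have w_gt : 2 * dotp v v < enorm w.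
  rewrite -ltr_sqr ?nnegrE ?enorm_ge0 ?mulr_ge0// ?ltW// wwE.
  by nra.
have w_gt0 : 0 < enorm w by apply: lt_trans w_gt; rewrite mulr_gt0.
exists ((enorm w)^-1 *: w); split.
- by rewrite enormZ gtr0_norm ?invr_gt0// mulVf// gt_eqF.
- by rewrite dotpZl wvE mulr_gt0// invr_gt0.
- rewrite dotpZl wvE mulrC ltr_pdivrMr//; lra.
Qed.

(** [(|z| - |z - v|) (|z| + |z - v|) = 2 z.v - |v|^2], and both norms are
    [T + O(1)]. *)
Lemma distance_difference_limit u v (E sigma : R) : enorm u = 1 -> 0 < sigma ->
  exists T0, forall T e, T0 <= T -> enorm e <= E ->
    `|enorm (T *: u + e) - enorm (T *: u + e - v) - dotp u v| <= sigma.
Proof.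
move=> u1 sigma0.
pose K := 2 * E * enorm v + enorm v ^+ 2 + `|dotp u v| * (2 * E + enorm v).
exists (`|K| / sigma + `|E| + enorm v + 1) => T e T0 eE.
have v0 := enorm_ge0 v; have E0 := le_trans (enorm_ge0 e) eE.
have K0 : 0 <= `|K| / sigma by rewrite divr_ge0// ltW.
rewrite (ger0_norm E0) in T0.
set P := enorm (T *: u + e); set Q := enorm (T *: u + e - v).
have Tu : enorm (T *: u) = T by rewrite enormZ u1 mulr1 ger0_norm//; lra.
have PT : `|P - T| <= E.
  by rewrite -Tu; apply: le_trans eE; exact: ler_dist_enorm.
have QP : `|Q - P| <= enorm v.
  by have := ler_dist_enorm (T *: u + e) (- v); rewrite enormN.
have PQ : `|K| / sigma <= P + Q.
  move: PT QP; rewrite !ler_distl => /andP[? ?] /andP[? ?]; lra.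
have PQ0 : 0 < P + Q.
  by move: PT QP; rewrite !ler_distl => /andP[? ?] /andP[? ?]; lra.
rewrite -(ler_pM2r PQ0) -[X in _ * X <= _](gtr0_norm PQ0) -normrM.
apply: (@le_trans _ _ K); last first.
  apply: le_trans (ler_norm _) _.
  by rewrite mulrC -ler_pdivrMr.
have -> : (P - Q - dotp u v) * (P + Q) =
    2 * dotp e v - enorm v ^+ 2 - dotp u v * (2 * (P - T) + (Q - P)).
  have : P ^+ 2 - Q ^+ 2 = 2 * (T * dotp u v + dotp e v) - enorm v ^+ 2.
    rewrite -dotpZl -dotpDl /P /Q; set z := T *: u + e.
    by rewrite !sqr_enorm dotpBl !dotpBr (dotpC v); ring.
  move=> H; transitivity (P ^+ 2 - Q ^+ 2 - dotp u v * (P + Q)); first by ring.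
  by rewrite H; ring.
apply: le_trans (ler_normB _ _) _; apply: lerD.
  apply: le_trans (ler_normB _ _) _; apply: lerD.
    rewrite normrM ger0_norm// -mulrA ler_pM2l//.
    by apply: le_trans (dotp_cauchy_schwarz _ _) _; exact: ler_wpM2r.
  by rewrite ger0_norm ?sqr_ge0.
rewrite normrM ler_wpM2l//; apply: le_trans (ler_normD _ _) _; apply: lerD => //.
by rewrite normrM ger0_norm// ler_pM2l.
Qed.

End euclidean_geometry.

(** * Distances of approximately orthogonal frequencies *)

Section approximately_orthogonal_frequencies.
Context {R : realType} {n : nat}.
Hypothesis n_gt0 : (0 < n)%N.
Local Notation p := (n.+2%:R / 2 : R).

(** The exponent is the one for which the decay of [phi] makes the oscillating
    function of [bessel_phase_rigidity] tend to 0 along the distances of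
    frequencies. *)
Lemma approx_orthogonal_bessel (phi : R -> R) :
  (1 + t) `^ p * phi t @[t --> +oo] --> 0 ->
  forall eps, 0 < eps -> exists t0 : R, forall xi xi' : 'rV[R]_n.+1,
    t0 <= enorm (xi - xi') -> approx_orthogonal phi (@unit_ball R n.+1) xi xi' ->
    `|(2 * pi * enorm (xi - xi')) `^ p * bessel n (2 * pi * enorm (xi - xi'))| <= eps.
Proof.
move=> phi0 eps eps0.
have [kappa k0 kE] := @unit_ball_volume R n.
have pi2 : 0 < 2 * pi :> R by rewrite mulr_gt0 ?pi_gt0.
have c0 : 0 < (2 * pi) `^ p / kappa by rewrite divr_gt0// powR_gt0.
have : \forall t \near +oo, `|(1 + t) `^ p * phi t| <= eps / ((2 * pi) `^ p / kappa).
  have /cvgrPdist_le/(_ (eps / ((2 * pi) `^ p / kappa))) := phi0.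
  rewrite divr_gt0// => /(_ isT); apply: filterS => t.
  by rewrite sub0r normrN.
case=> t0 [_ Ht0]; exists (`|t0| + 1) => xi xi'; set t := enorm _ => tt orth.
have t_gt0 : 0 <= t by exact: enorm_ge0.
have phit : kappa * `|bessel n (2 * pi * t)| <= phi t.
  apply: le_trans orth; apply: le_trans (normc_Re _).
  by rewrite (Re_fourier_ball _ n_gt0 kE) normrM (gtr0_norm k0).
have := Ht0 t; have : t0 < t by have := ler_norm t0; lra.
move=> /[swap] /[apply]; rewrite ler_pdivlMr// => H; apply: le_trans H.
rewrite powRM ?(ltW pi2)// !normrM !(ger0_norm (powR_ge0 _ _)).
rewrite -mulrA [leRHS]mulrC -[leRHS]mulrA ler_wpM2l ?powR_ge0//.
rewrite mulrCA ler_pM ?powR_ge0//.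
  have p0 : 0 <= p by rewrite divr_ge0// ler0n.
  by apply: ge0_ler_powR; rewrite ?nnegrE ?lerDr ?addr_ge0.
by rewrite ler_pdivlMl//; apply: le_trans phit _; exact: ler_norm.
Qed.

End approximately_orthogonal_frequencies.

Theorem theorem1p9 (R : realType) (d : nat) (phi : R -> R) :
  (1 < d)%N ->
  (forall t : R, 0 <= t -> 0 <= phi t) ->
  (exists M : R, forall t : R, 0 <= t -> phi t <= M) ->
  Lebesgue_measurable_fun `[0, +oo[ phi ->
  (1 + t) `^ (d.+1%:R / 2) * phi t @[t --> +oo] --> 0 ->
  ~ exists A : set 'rV[R]_d, approx_orthogonal_basis phi (@unit_ball R d) A.
Proof.
case: d => // n n0 _ _ _ phi0 [A [[a [[aA inj_a _] basis]] orth]].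
have [r r0 dense] := exp_basis_relatively_dense (ltn0Sn n) basis.
have a_inj k l : a k = a l -> k = l by apply: inj_a; rewrite inE.
pose v := a 1%N - a 0%N.
have v0 : v != 0 by rewrite subr_eq0; apply/eqP => /a_inj.
have [u [u1 s0 s1]] := unit_vector_small_slope n0 v0.
set s := dotp u v in s0 s1.
have pi2 : 0 < 2 * pi :> R by rewrite mulr_gt0 ?pi_gt0.
have sin0 : 0 < sin (2 * pi * s).
  have s_pi : 2 * pi * s < 2 * pi * (1 / 2) by rewrite ltr_pM2l.
  by apply: sin_gt0_pi; rewrite mulr_gt0//=; apply: lt_le_trans s_pi _; lra.
pose eta := sin (2 * pi * s) / 4.
have eta0 : 0 < eta by rewrite divr_gt0.
have [eps [X [eps0 X1 rigid]]] := bessel_phase_rigidity n (2 * pi * enorm v) eta0.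
have [t0 small] := approx_orthogonal_bessel n0 phi0 eps0.
pose E := n.+1%:R * r.
have [T0 limit] := distance_difference_limit v E u1 (divr_gt0 eta0 pi2).
(* all the terms are nonnegative: T exceeds each of the thresholds *)
pose T := `|T0| + E + enorm v + `|t0| + X + 1.
have [k near_k] := dense (a 0%N + T *: u).
pose e := a k - (a 0%N + T *: u).
have eE : enorm e <= E.
  apply: enorm_coord_bound => [|i]; first exact: ltW.
  by have := near_k i; rewrite !mxE => /ltW.
have E0 : 0 <= E := le_trans (enorm_ge0 _) eE.
have v_ge0 := enorm_ge0 v.
have zP : a k - a 0%N = T *: u + e.
  by rewrite /e [RHS]addrC opprD addrA subrK.
have zQ : a k - a 1%N = T *: u + e - v by rewrite -zP /v opprB addrA subrK.
pose P := enorm (a k - a 0%N); pose Q := enorm (a k - a 1%N).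
have T_ge0 : 0 <= T by rewrite /T; have := normr_ge0 T0; have := normr_ge0 t0; lra.
have PT : T - E <= P.
  have := ler_dist_enorm (T *: u) e; rewrite -zP -/P enormZ u1 mulr1 (ger0_norm T_ge0).
  by rewrite ler_distl => /andP[? _]; lra.
have QP : P - enorm v <= Q.
  have := ler_dist_enorm (T *: u + e) (- v); rewrite -zQ -zP enormN -/P -/Q.
  by rewrite ler_distl => /andP[? _].
have far_P : `|t0| + X + 1 <= P by move: PT; rewrite /T; have := normr_ge0 T0; lra.
have far_Q : `|t0| + X + 1 <= Q by move: PT QP; rewrite /T; have := normr_ge0 T0; lra.
have PQ : `|P - Q - s| <= eta / (2 * pi).
  rewrite /P /Q zQ zP; apply: limit eE; rewrite /T.
  by have := ler_norm T0; have := normr_ge0 t0; lra.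
have A_a l : A (a l) by exact: aA.
have small_at l : `|t0| + X + 1 <= enorm (a k - a l) ->
    `|(2 * pi * enorm (a k - a l)) `^ (n.+2%:R / 2) *
      bessel n (2 * pi * enorm (a k - a l))| <= eps.
  move=> far; apply: small; first by have := ler_norm t0; lra.
  apply: orth => //; apply/eqP => akl; move: far.
  rewrite akl subrr -(scale0r u) enormZ normr0 mul0r.
  by have := normr_ge0 t0; lra.
have scale t : `|t0| + X + 1 <= t -> X <= 2 * pi * t.
  by have := normr_ge0 t0; have := @pi_ge2 R; nra.
have PQv : `|2 * pi * P - 2 * pi * Q| <= 2 * pi * enorm v.
  rewrite -mulrBr normrM (gtr0_norm pi2) ler_pM2l// distrC /P /Q zQ zP.
  by rewrite -[enorm v]enormN; exact: ler_dist_enorm.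
have := rigid _ _ (scale P far_P) (scale Q far_Q) PQv (small_at _ far_P) (small_at _ far_Q).
rewrite -mulrBr => sin_small.
have sin_close : `|sin (2 * pi * s) - sin (2 * pi * (P - Q))| <= eta.
  apply: le_trans (ler_dist_sin _ _) _.
  by rewrite -mulrBr normrM (gtr0_norm pi2) distrC mulrC -ler_pdivlMr.
have := le_trans (ler_norm _) sin_close; have := le_trans (ler_norm _) sin_small.
by rewrite /eta; lra.
Qed.
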